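(* Let $n\ge 0$ and let $-\infty<\alpha_1<\beta_1<\alpha_2<\beta_2<\dots<\alpha_{n+1}<\beta_{n+1}<+\infty$. Put $e=\{\alpha_j,\beta_j\}_{j=1}^{n+1}$, $\mathfrak{e}=\bigcup_{j=1}^{n+1}[\alpha_j,\beta_j]$, and $\Omega=\bar{\mathbb{C}}\setminus\mathfrak{e}$. Let $f$ be analytic in $\Omega$ (including at $\infty$) with $|f(\infty)|=1$, and suppose that for some $p,q\ge 0$ and some constant $K_1>0$, $$\log|f(\lambda)|\le \frac{K_1}{\operatorname{dist}^p(\lambda,\mathfrak{e})\,\operatorname{dist}^q(\lambda,e)},\qquad \lambda\in\Omega\setminus\{\infty\}.$$ Then for every $0<\varepsilon<1$, $$\sum_{\lambda\in Z_f}\operatorname{dist}^{p+1+\varepsilon}(\lambda,\mathfrak{e})\,\operatorname{dist}^{a(p,q,\varepsilon)}(\lambda,e)\,(1+|\lambda|)^{b(p,q,\varepsilon)}\le C\cdot K_1,$$ where $$a(p,q,\varepsilon)=\frac{(p+2q-1+\varepsilon)_+-(p+1+\varepsilon)}{2},\qquad b(p,q,\varepsilon)=(p+q-1+\varepsilon)_+-\frac{(p+2q-1+\varepsilon)_++p+1+\varepsilon}{2},$$ and $C=C(\mathfrak{e},p,q,\varepsilon)>0$ depends only on $\mathfrak{e},p,q,\varepsilon$.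
   Context: $Z_f$ denotes the zero set of $f$ in $\Omega$, each zero repeated according to its multiplicity. $\operatorname{dist}(\lambda,M)$ is the Euclidean distance from $\lambda$ to a set $M$, and $x_+=\max\{x,0\}$. *)

(* Defs.v *)
From Stdlib Require Import Reals List.
From Coquelicot Require Import Coquelicot.
Open Scope R_scope.

Definition dist_set (lam : C) (M : C -> Prop) : R :=
  real (Glb_Rbar (fun r => exists z, M z /\ r = Cmod (Cminus lam z))).

Definition frak_e (n : nat) (alpha beta : nat -> R) (z : C) : Prop :=
  Im z = 0 /\ exists j, (j <= n)%nat /\ alpha j <= Re z <= beta j.

Definition endpoints (n : nat) (alpha beta : nat -> R) (z : C) : Prop :=
  exists j, (j <= n)%nat /\ (z = RtoC (alpha j) \/ z = RtoC (beta j)).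

Definition admissible (n : nat) (alpha beta : nat -> R) : Prop :=
  (forall j, (j <= n)%nat -> alpha j < beta j) /\
  (forall j, (j < n)%nat -> beta j < alpha (S j)).

Definition holo_near (f : C -> C) (z0 : C) : Prop :=
  exists r, 0 < r /\ forall z, Cmod (Cminus z z0) < r -> ex_derive f z.

Definition analytic_at_infty (f : C -> C) (finf : C) : Prop :=
  exists (g : C -> C) (r : R), 0 < r /\ g (RtoC 0) = finf /\
    (forall w, Cmod w < r -> ex_derive g w) /\
    (forall w, 0 < Cmod w < r -> g w = f (Cinv w)).

Fixpoint Cpow (z : C) (m : nat) : C :=
  match m with O => RtoC 1 | S k => Cmult z (Cpow z k) end.

Definition zero_mult (f : C -> C) (z0 : C) (m : nat) : Prop :=
  exists (g : C -> C) (r : R), 0 < r /\ g z0 <> RtoC 0 /\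
    (forall z, Cmod (Cminus z z0) < r -> ex_derive g z) /\
    (forall z, Cmod (Cminus z z0) < r -> f z = Cmult (Cpow (Cminus z z0) m) (g z)).

Definition posp (x : R) : R := Rmax x 0.

Definition a_exp (p q eps : R) : R :=
  (posp (p + 2*q - 1 + eps) - (p + 1 + eps)) / 2.

Definition b_exp (p q eps : R) : R :=
  posp (p + q - 1 + eps) - (posp (p + 2*q - 1 + eps) + p + 1 + eps) / 2.

(* sum over a finite list of (zero, multiplicity) pairs of m * w(zero) *)
Definition zsum (w : C -> R) (s : list (C * nat)) : R :=
  fold_right (fun zm acc => INR (snd zm) * w (fst zm) + acc) 0 s.

(* Main.v *)
Require Import Defs.
From Stdlib Require Import Reals List Lra Lia Psatz Classical ClassicalEpsilon.
From Coquelicot Require Import Coquelicot.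
Open Scope R_scope.

(* The estimate is local: by a Cousin argument it suffices to sum over the zeros near each
   point of the plane and near infinity. Near a point of a band the domain is opened to a
   half-disc by [lambda = c + w] (inside a band) or [lambda = e + w^2] (at an endpoint [e]);
   then [log |f| <= C K / ((Im w)^p |w|^q')], with [q' = 0] and [q' = p + 2 q] respectively,
   and the weights become [(Im w)^(p+1+eps) |w|^((q'-1+eps)_+)]. The zeros with
   [Im w ~ del] and [|w| ~ rho] are divided out by Blaschke factors of the half-plane
   [Im w > del], and the maximum modulus principle is applied in
   [{Im w > del, rho < |w| < 16}]: the singularity of the bound at [0] is majorized by the
   real part of [(- i w)^(-kappa)] with [kappa < 1], and the Blaschke factors on the two
   circular arcs by multiples of [Im w] and [Im w / |w|^2] that are too small to matter at
   the reference point. This bounds [sum m Im w] over one dyadic class, and the factor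
   [eps] in the weights makes the sum over all classes geometric. The reference point, where
   [log |f| >= - C K], is found by propagating [|f(infinity)| = 1] through two discs with
   Poisson kernels. Near infinity Jensen's inequality on dyadic discs is enough. *)

(** * Complex differentiability and the exponential *)

(** A zero at height about [del] is seen only from a half-plane cut at comparable height, where the
    bound costs [del^(-p)]. One class then satisfies [sum m Im w <= C K del^(-p) rho^(-t)]. The
    weight turns this into [del^eps]; as [Im w <= |w|], half of [eps] is spent on the sum over [del]
    and half on the sum over [rho]. The positive parts come from the singularity at 0. The real part
    of [(- i w)^(-kappa)] stays comparable to [|w|^(-kappa)] up to the real axis only for
    [kappa < 1]; hence only the excess [t = (q' - 1 + eps)_+] of [q'] is frozen at the inner radius
    [rho]. The charts dictate [a] and [b]. At an endpoint the distances to the bands and to the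
    endpoints are comparable to [|w| Im w] and [|w|^2], so [2 a] completes [p + 1 + eps] to
    [(p + 2 q - 1 + eps)_+]. At infinity all distances are comparable to [|lambda|], the bound on
    [log |f|] decays like [|lambda|^(-p-q)], and [b] brings the total exponent to
    [(p + q - 1 + eps)_+]. *)

Definition ccont (f : C -> C) (a : C) : Prop :=
  forall eps, 0 < eps -> exists del, 0 < del /\
    forall z, Cmod (z - a) < del -> Cmod (f z - f a) < eps.

(* Caratheodory's form of complex differentiability: product, composition and
   quotient rules become algebraic identities for the slope function. *)
Definition cdiff (f : C -> C) (a : C) : Prop :=
  exists phi, ccont phi a /\ forall z, f z = (f a + phi z * (z - a))%C.

Lemma Cmod_sub_sym (a b : C) : Cmod (a - b) = Cmod (b - a).
Proof. rewrite <- Cmod_opp. f_equal. ring. Qed.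

Lemma Cmod_sub_triangle (a b c : C) : Cmod (a - c) <= Cmod (a - b) + Cmod (b - c).
Proof.
  replace (a - c)%C with ((a - b) + (b - c))%C by ring. apply Cmod_triangle.
Qed.

Lemma Cmod_triangle_inv (a b : C) : Cmod a - Cmod b <= Cmod (a - b).
Proof.
  assert (H := Cmod_triangle (a - b) b).
  replace (a - b + b)%C with a in H by ring. lra.
Qed.

Lemma Cmod_sub_diag (a : C) : Cmod (a - a) = 0.
Proof. replace (a - a)%C with (RtoC 0) by ring. apply Cmod_0. Qed.

Lemma Cmod_sub_pos (a b : C) : a <> b -> 0 < Cmod (a - b).
Proof.
  intros H. apply Cmod_gt_0. intros E. apply H.
  replace a with (a - b + b)%C by ring. rewrite E. ring.
Qed.

Lemma Cmod_Im (z : C) : Rabs (Im z) <= Cmod z.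
Proof. eapply Rle_trans; [apply Rmax_r | apply Rmax_Cmod]. Qed.

Lemma Cmod_sqr (z : C) : (Cmod z)^2 = (Re z)^2 + (Im z)^2.
Proof. apply Cmod2_alt. Qed.

Lemma Cmod_le_abs (z : C) : Cmod z <= Rabs (Re z) + Rabs (Im z).
Proof.
  assert (H := Cmod_sqr z). assert (H0 := Cmod_ge_0 z).
  assert (H1 := Rabs_pos (Re z)). assert (H2 := Rabs_pos (Im z)).
  rewrite <- (pow2_abs (Re z)), <- (pow2_abs (Im z)) in H. nra.
Qed.

Lemma cdiff_of_ex_derive (f : C -> C) (a : C) :
  @ex_derive C_AbsRing C_NormedModule f a -> cdiff f a.
Proof.
  intros [l [_ Hl]].
  (* The derivative is quantified over all limits of the neighbourhood filter of [a]; the identity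
     proves that [a] is one of them. *)
  assert (Hl' := Hl a (fun P H => H)). clear Hl.
  exists (fun z => if excluded_middle_informative (z = a) then l
                   else ((f z - f a) / (z - a))%C).
  split.
  - intros eps He.
    assert (He2 : 0 < eps / 2) by lra.
    destruct (Hl' (mkposreal _ He2)) as [d Hd]. simpl in Hd.
    exists d. split; [apply cond_pos|]. intros z Hz.
    destruct (excluded_middle_informative (a = a)) as [_|n]; [|now destruct n].
    destruct (excluded_middle_informative (z = a)) as [E|E].
    + rewrite Cmod_sub_diag. lra.
    + assert (Hp := Cmod_sub_pos _ _ E).
      assert (Hne : (z - a)%C <> 0) by (now apply Cmod_gt_0).
      specialize (Hd z).
      specialize (Hd Hz).
      change (Cmod ((f z - f a) - (z - a) * l) <= eps / 2 * Cmod (z - a)) in Hd.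
      replace ((f z - f a) / (z - a) - l)%C
        with (((f z - f a) - (z - a) * l) / (z - a))%C by (field; exact Hne).
      rewrite Cmod_div by exact Hne.
      apply Rle_lt_trans with (eps / 2); [|lra].
      apply Rmult_le_reg_r with (Cmod (z - a)); [lra|].
      unfold Rdiv at 1. rewrite Rmult_assoc, Rinv_l by lra. lra.
  - intros z. destruct (excluded_middle_informative (z = a)) as [E|E].
    + subst. ring.
    + field. apply Cmod_gt_0. now apply Cmod_sub_pos.
Qed.

Lemma ccont_const (c a : C) : ccont (fun _ => c) a.
Proof. intros e He. exists 1. split; [lra|]. intros. now rewrite Cmod_sub_diag. Qed.

Lemma ccont_id (a : C) : ccont (fun z => z) a.
Proof. intros e He. exists e. now split. Qed.

Lemma ccont_plus (f g : C -> C) (a : C) : ccont f a -> ccont g a -> ccont (fun z => f z + g z)%C a.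
Proof.
  intros Hf Hg e He.
  destruct (Hf (e/2)) as [d1 [D1 H1]]; [lra|].
  destruct (Hg (e/2)) as [d2 [D2 H2]]; [lra|].
  exists (Rmin d1 d2). split; [now apply Rmin_pos|]. intros z Hz.
  assert (Hz1 := Rlt_le_trans _ _ _ Hz (Rmin_l d1 d2)).
  assert (Hz2 := Rlt_le_trans _ _ _ Hz (Rmin_r d1 d2)).
  specialize (H1 z Hz1). specialize (H2 z Hz2).
  replace (f z + g z - (f a + g a))%C with ((f z - f a) + (g z - g a))%C by ring.
  eapply Rle_lt_trans; [apply Cmod_triangle|]. lra.
Qed.

Lemma ccont_mult (f g : C -> C) (a : C) : ccont f a -> ccont g a -> ccont (fun z => f z * g z)%C a.
Proof.
  intros Hf Hg e He.
  set (A := Cmod (f a) + 1). set (B := Cmod (g a) + 1).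
  assert (HA : 1 <= A) by (unfold A; assert (H := Cmod_ge_0 (f a)); lra).
  assert (HB : 1 <= B) by (unfold B; assert (H := Cmod_ge_0 (g a)); lra).
  destruct (Hf (Rmin 1 (e / (2 * B)))) as [d1 [D1 H1]].
  { apply Rmin_pos; [lra|]. apply Rdiv_lt_0_compat; lra. }
  destruct (Hg (e / (2 * A))) as [d2 [D2 H2]]; [apply Rdiv_lt_0_compat; lra|].
  exists (Rmin d1 d2). split; [now apply Rmin_pos|]. intros z Hz.
  assert (Hz1 := Rlt_le_trans _ _ _ Hz (Rmin_l d1 d2)).
  assert (Hz2 := Rlt_le_trans _ _ _ Hz (Rmin_r d1 d2)).
  specialize (H1 z Hz1). specialize (H2 z Hz2).
  assert (H3 := Rlt_le_trans _ _ _ H1 (Rmin_l _ _)).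
  assert (H4 := Rlt_le_trans _ _ _ H1 (Rmin_r _ _)).
  replace (f z * g z - f a * g a)%C with ((f z - f a) * g a + f z * (g z - g a))%C by ring.
  eapply Rle_lt_trans; [apply Cmod_triangle|]. rewrite !Cmod_mult.
  assert (H5 : Cmod (f z) <= A).
  { unfold A. assert (H := Cmod_triangle_inv (f z) (f a)). lra. }
  assert (H6 : Cmod (f z - f a) * Cmod (g a) <= e / (2 * B) * B).
  { apply Rmult_le_compat; try apply Cmod_ge_0; [lra | unfold B; lra]. }
  assert (H7 : Cmod (f z) * Cmod (g z - g a) <= A * Cmod (g z - g a)).
  { apply Rmult_le_compat_r; [apply Cmod_ge_0|exact H5]. }
  assert (H8 : A * Cmod (g z - g a) < A * (e / (2 * A))).
  { apply Rmult_lt_compat_l; lra. }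
  replace (e / (2 * B) * B) with (e / 2) in H6 by (field; lra).
  replace (A * (e / (2 * A))) with (e / 2) in H8 by (field; lra).
  lra.
Qed.

Lemma ccont_comp (f g : C -> C) (a : C) : ccont f (g a) -> ccont g a -> ccont (fun z => f (g z)) a.
Proof.
  intros Hf Hg e He. destruct (Hf e He) as [d [D H]].
  destruct (Hg d D) as [d' [D' H']]. exists d'. split; auto.
Qed.

Lemma ccont_inv (a : C) : a <> 0 -> ccont Cinv a.
Proof.
  intros Ha e He. assert (Hp : 0 < Cmod a) by now apply Cmod_gt_0.
  set (m := Cmod a) in *.
  exists (Rmin (m / 2) (e * (m * m) / 2)). split.
  { apply Rmin_pos; [lra|]. apply Rdiv_lt_0_compat; [|lra].
    apply Rmult_lt_0_compat; [lra|]. now apply Rmult_lt_0_compat. }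
  intros z Hz.
  assert (Hz1 := Rlt_le_trans _ _ _ Hz (Rmin_l _ _)).
  assert (Hz2 := Rlt_le_trans _ _ _ Hz (Rmin_r _ _)).
  assert (Hzm : m / 2 < Cmod z).
  { assert (H := Cmod_triangle_inv a z). rewrite Cmod_sub_sym in H. fold m in H. lra. }
  assert (Hz0 : z <> 0) by (apply Cmod_gt_0; lra).
  replace (/ z - / a)%C with ((a - z) / (z * a))%C by (field; now split).
  rewrite Cmod_div by now apply Cmult_neq_0.
  rewrite Cmod_mult, Cmod_sub_sym. fold m.
  apply Rmult_lt_reg_r with (Cmod z * m); [apply Rmult_lt_0_compat; lra|].
  unfold Rdiv. rewrite Rmult_assoc, Rinv_l by (apply Rgt_not_eq, Rmult_lt_0_compat; lra).
  rewrite Rmult_1_r.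
  apply Rlt_le_trans with (e * (m * m) / 2); [exact Hz2|].
  replace (e * (m * m) / 2) with (e * (m / 2 * m)) by field.
  apply Rmult_le_compat_l; [lra|]. apply Rmult_le_compat_r; lra.
Qed.

Lemma ccont_ext_loc (f g : C -> C) (a : C) (r : R) :
  0 < r -> (forall z, Cmod (z - a) < r -> f z = g z) -> ccont f a -> ccont g a.
Proof.
  intros Hr E Hf e He. destruct (Hf e He) as [d [D H]].
  exists (Rmin d r). split; [now apply Rmin_pos|]. intros z Hz.
  rewrite <- !E; [apply H | |].
  - eapply Rlt_le_trans; [exact Hz|apply Rmin_l].
  - rewrite Cmod_sub_diag; lra.
  - eapply Rlt_le_trans; [exact Hz|apply Rmin_r].
Qed.

Lemma cdiff_ccont (f : C -> C) (a : C) : cdiff f a -> ccont f a.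
Proof.
  intros [phi [Hc E]].
  assert (H : ccont (fun z => f a + phi z * (z + - a))%C a).
  { apply ccont_plus; [apply ccont_const|]. apply ccont_mult; [exact Hc|].
    apply ccont_plus; [apply ccont_id|apply ccont_const]. }
  apply (ccont_ext_loc _ f a 1) in H; [exact H|lra|].
  intros z _. rewrite (E z). ring.
Qed.

Lemma cdiff_const (c a : C) : cdiff (fun _ => c) a.
Proof. exists (fun _ => RtoC 0). split; [apply ccont_const|]. intros. ring. Qed.

Lemma cdiff_id (a : C) : cdiff (fun z => z) a.
Proof. exists (fun _ => RtoC 1). split; [apply ccont_const|]. intros. ring. Qed.

Lemma cdiff_plus (f g : C -> C) (a : C) : cdiff f a -> cdiff g a -> cdiff (fun z => f z + g z)%C a.
Proof.
  intros [p [Hp Ep]] [q [Hq Eq]]. exists (fun z => p z + q z)%C.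
  split; [now apply ccont_plus|]. intros z. rewrite (Ep z), (Eq z). ring.
Qed.

Lemma cdiff_mult (f g : C -> C) (a : C) : cdiff f a -> cdiff g a -> cdiff (fun z => f z * g z)%C a.
Proof.
  intros Hf [q [Hq Eq]]. assert (Hcf := cdiff_ccont _ _ Hf). destruct Hf as [p [Hp Ep]].
  exists (fun z => p z * g a + f z * q z)%C. split.
  - apply ccont_plus; apply ccont_mult; trivial. apply ccont_const.
  - intros z. rewrite (Eq z). rewrite (Ep z). ring.
Qed.

Lemma cdiff_comp (f g : C -> C) (a : C) : cdiff f (g a) -> cdiff g a -> cdiff (fun z => f (g z)) a.
Proof.
  intros [p [Hp Ep]] Hg. assert (Hcg := cdiff_ccont _ _ Hg). destruct Hg as [q [Hq Eq]].
  exists (fun z => p (g z) * q z)%C. split.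
  - apply ccont_mult; trivial. now apply ccont_comp.
  - intros z. rewrite (Ep (g z)). rewrite (Eq z) at 2. ring.
Qed.

(** The slope identity is demanded at every [z], although differentiability is local. Beyond radius
    [r] the slope is therefore reset to the difference quotient, which does not affect its
    continuity at [a]. *)
Lemma cdiff_ext_loc (f g : C -> C) (a : C) (r : R) :
  0 < r -> (forall z, Cmod (z - a) < r -> f z = g z) -> cdiff f a -> cdiff g a.
Proof.
  intros Hr E [p [Hp Ep]].
  assert (Ea : f a = g a) by (apply E; rewrite Cmod_sub_diag; lra).
  exists (fun z => if Rlt_dec (Cmod (z - a)) r then p z else ((g z - g a) / (z - a))%C).
  split.
  - apply (ccont_ext_loc p _ a r Hr); [|exact Hp]. intros z Hz.
    destruct (Rlt_dec (Cmod (z - a)) r); [reflexivity|contradiction].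
  - intros z. destruct (Rlt_dec (Cmod (z - a)) r) as [H|H].
    + rewrite <- E, <- Ea by exact H. apply Ep.
    + field. apply Cmod_gt_0. lra.
Qed.

Lemma cdiff_inv (a : C) : a <> 0 -> cdiff Cinv a.
Proof.
  intros Ha. assert (Hp : 0 < Cmod a) by now apply Cmod_gt_0.
  (* The slope [- 1 / (a z)] fails at [z = 0]. Changing the value of the function there to [/ a]
     lets the slope be 0 at that point. *)
  assert (H : cdiff (fun z => if Ceq_dec z 0 then (/ a)%C else (/ z)%C) a -> cdiff Cinv a).
  { apply (cdiff_ext_loc _ _ a (Cmod a) Hp). intros z Hz.
    destruct (Ceq_dec z 0) as [E|E]; [|reflexivity].
    subst. exfalso. replace (0 - a)%C with (- a)%C in Hz by ring.
    rewrite Cmod_opp in Hz. lra. }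
  apply H. clear H.
  exists (fun z => if Ceq_dec z 0 then RtoC 0 else (- (/ a * / z))%C). split.
  - apply (ccont_ext_loc (fun z => - / a * / z)%C _ a (Cmod a) Hp).
    + intros z Hz. destruct (Ceq_dec z 0) as [E|E]; [|ring].
      subst. exfalso. replace (0 - a)%C with (- a)%C in Hz by ring.
      rewrite Cmod_opp in Hz. lra.
    + apply ccont_mult; [apply ccont_const|now apply ccont_inv].
  - intros z. destruct (Ceq_dec a 0) as [E|_]; [contradiction|].
    destruct (Ceq_dec z 0) as [E|E]; [ring|]. field. now split.
Qed.

Lemma cdiff_opp (f : C -> C) (a : C) : cdiff f a -> cdiff (fun z => - f z)%C a.
Proof.
  intros H. apply (cdiff_ext_loc (fun z => (- (1)) * f z)%C _ a 1); [lra|intros; ring|].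
  apply cdiff_mult; [apply cdiff_const|exact H].
Qed.

Lemma cdiff_minus (f g : C -> C) (a : C) : cdiff f a -> cdiff g a -> cdiff (fun z => f z - g z)%C a.
Proof. intros Hf Hg. apply cdiff_plus; [exact Hf|now apply cdiff_opp]. Qed.

Lemma cdiff_div (f g : C -> C) (a : C) :
  g a <> RtoC 0 -> cdiff f a -> cdiff g a -> cdiff (fun z => f z / g z)%C a.
Proof.
  intros H Hf Hg. apply cdiff_mult; [exact Hf|].
  apply (cdiff_comp Cinv g); [apply cdiff_inv; exact H|exact Hg].
Qed.

Lemma cdiff_pow (f : C -> C) (a : C) (m : nat) : cdiff f a -> cdiff (fun z => Defs.Cpow (f z) m) a.
Proof.
  intros H. induction m as [|m IH]; simpl; [apply cdiff_const|now apply cdiff_mult].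
Qed.

Definition Cexp (z : C) : C := (exp (Re z) * cos (Im z), exp (Re z) * sin (Im z)).

Lemma Cexp_plus (z w : C) : Cexp (z + w) = (Cexp z * Cexp w)%C.
Proof.
  destruct z as [x y], w as [u v]. unfold Cexp; simpl.
  rewrite exp_plus, cos_plus, sin_plus. unfold Cmult; simpl. f_equal; ring.
Qed.

Lemma Cmod_Cexp (z : C) : Cmod (Cexp z) = exp (Re z).
Proof.
  unfold Cmod, Cexp; simpl fst; simpl snd.
  replace ((exp (Re z) * cos (Im z)) ^ 2 + (exp (Re z) * sin (Im z)) ^ 2)
    with (exp (Re z) ^ 2 * ((sin (Im z))² + (cos (Im z))²)) by (unfold Rsqr; ring).
  rewrite sin2_cos2, Rmult_1_r. apply sqrt_pow2. left. apply exp_pos.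
Qed.

Lemma derivable_pt_lim_0_abs (f : R -> R) (l : R) :
  derivable_pt_lim f 0 l ->
  forall e, 0 < e -> exists d, 0 < d /\
    forall x, Rabs x < d -> Rabs (f x - f 0 - l * x) <= e * Rabs x.
Proof.
  intros H e He. destruct (H e He) as [d Hd]. exists d. split; [apply cond_pos|].
  intros x Hx. destruct (Req_dec x 0) as [E|E].
  - subst. rewrite Rabs_R0. replace (f 0 - f 0 - l * 0) with 0 by ring.
    rewrite Rabs_R0. lra.
  - specialize (Hd x E Hx). rewrite Rplus_0_l in Hd.
    replace (f x - f 0 - l * x) with (((f x - f 0) / x - l) * x) by (field; exact E).
    rewrite Rabs_mult. apply Rmult_le_compat_r; [apply Rabs_pos|lra].
Qed.

Lemma Cexp_slope_0 (e : R) : 0 < e -> exists d, 0 < d /\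
  forall u, Cmod u < d -> Cmod (Cexp u - 1 - u) <= e * Cmod u.
Proof.
  intros He.
  (* In the real part the error [e / 8] occurs once alone and once times [exp x <= 3]. In the
     imaginary part [(exp x - 1) * sin y] is at most [4 m^2 <= (e / 4) m], because [m < e / 16].
     Each part is thus at most [(e / 2) m]. *)
  assert (E4 : 0 < Rmin 1 (e / 8)) by (apply Rmin_pos; lra).
  destruct (derivable_pt_lim_0_abs exp 1) with (e := Rmin 1 (e/8)) as [d1 [D1 H1]];
    [rewrite <- exp_0; apply derivable_pt_lim_exp|exact E4|].
  destruct (derivable_pt_lim_0_abs sin 1) with (e := Rmin 1 (e/8)) as [d2 [D2 H2]];
    [rewrite <- cos_0; apply derivable_pt_lim_sin|exact E4|].
  destruct (derivable_pt_lim_0_abs cos 0) with (e := Rmin 1 (e/8)) as [d3 [D3 H3]];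
    [replace 0 with (- sin 0) at 2 by (rewrite sin_0; ring); apply derivable_pt_lim_cos|exact E4|].
  exists (Rmin (Rmin d1 (Rmin d2 d3)) (Rmin 1 (e / 16))). split.
  { repeat apply Rmin_pos; lra. }
  intros [x y] Hu.
  assert (Hx := re_le_Cmod (x, y)). assert (Hy := Cmod_Im (x, y)).
  set (m := Cmod (x, y)) in *. simpl in Hx, Hy.
  assert (M1 := Rlt_le_trans _ _ _ Hu (Rmin_l _ _)).
  assert (M2 := Rlt_le_trans _ _ _ Hu (Rmin_r _ _)).
  assert (N1 := Rlt_le_trans _ _ _ M1 (Rmin_l _ _)).
  assert (N2 := Rlt_le_trans _ _ _ M1 (Rmin_r _ _)).
  assert (N3 := Rlt_le_trans _ _ _ N2 (Rmin_l _ _)).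
  assert (N4 := Rlt_le_trans _ _ _ N2 (Rmin_r _ _)).
  assert (N5 := Rlt_le_trans _ _ _ M2 (Rmin_l _ _)).
  assert (N6 := Rlt_le_trans _ _ _ M2 (Rmin_r _ _)).
  clear M1 M2 N2 Hu.
  specialize (H1 x ltac:(lra)). specialize (H2 y ltac:(lra)). specialize (H3 y ltac:(lra)).
  rewrite exp_0 in H1. rewrite sin_0 in H2. rewrite cos_0 in H3.
  assert (Hm1 := Rmin_l 1 (e / 8)). assert (Hm2 := Rmin_r 1 (e / 8)).
  set (q := Rmin 1 (e / 8)) in *.
  assert (Ax := Rabs_pos x). assert (Ay := Rabs_pos y).
  assert (K1 : Rabs (exp x - 1 - 1 * x) <= e / 8 * m) by nra.
  assert (K1' : Rabs (exp x - 1 - 1 * x) <= m) by nra.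
  assert (K2 : Rabs (sin y - 0 - 1 * y) <= e / 8 * m) by nra.
  assert (K3 : Rabs (cos y - 1 - 0 * y) <= e / 8 * m) by nra.
  assert (K4 : Rabs (exp x - 1) <= 2 * m).
  { replace (exp x - 1) with ((exp x - 1 - 1 * x) + x) by ring.
    eapply Rle_trans; [apply Rabs_triang|]. lra. }
  assert (K5 : Rabs (sin y) <= 2 * m).
  { replace (sin y) with ((sin y - 0 - 1 * y) + y) by ring.
    eapply Rle_trans; [apply Rabs_triang|]. nra. }
  assert (K6 : exp x <= 3).
  { assert (H := Rle_abs (exp x - 1)). lra. }
  eapply Rle_trans; [apply Cmod_le_abs|]. simpl.
  assert (P1 : Rabs (exp x * cos y + - (1) + - x) <= e / 2 * m).
  { replace (exp x * cos y + - (1) + - x)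
      with ((exp x - 1 - 1 * x) + exp x * (cos y - 1 - 0 * y)) by ring.
    eapply Rle_trans; [apply Rabs_triang|]. rewrite Rabs_mult.
    rewrite (Rabs_pos_eq (exp x)) by (left; apply exp_pos).
    assert (exp x * Rabs (cos y - 1 - 0 * y) <= 3 * (e / 8 * m)).
    { apply Rmult_le_compat; trivial; [left; apply exp_pos|apply Rabs_pos]. }
    lra. }
  assert (P2 : Rabs (exp x * sin y + - 0 + - y) <= e / 2 * m).
  { replace (exp x * sin y + - 0 + - y)
      with ((exp x - 1) * sin y + (sin y - 0 - 1 * y)) by ring.
    eapply Rle_trans; [apply Rabs_triang|]. rewrite Rabs_mult.
    assert (Rabs (exp x - 1) * Rabs (sin y) <= (2 * m) * (2 * m)).
    { apply Rmult_le_compat; trivial; apply Rabs_pos. }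
    nra. }
  lra.
Qed.

Lemma cdiff_Cexp (a : C) : cdiff Cexp a.
Proof.
  exists (fun z => if Ceq_dec z a then Cexp a else ((Cexp z - Cexp a) / (z - a))%C). split.
  - intros e He. set (A := Cmod (Cexp a)).
    assert (HA : 0 < A) by (unfold A; rewrite Cmod_Cexp; apply exp_pos).
    destruct (Cexp_slope_0 (e / (2 * A))) as [d [D H]]; [apply Rdiv_lt_0_compat; lra|].
    exists d. split; [exact D|]. intros z Hz.
    destruct (Ceq_dec a a) as [_|n]; [|now destruct n].
    destruct (Ceq_dec z a) as [E|E]; [rewrite Cmod_sub_diag; lra|].
    assert (Hp := Cmod_sub_pos _ _ E).
    assert (Hne : (z - a)%C <> 0) by (now apply Cmod_gt_0).
    specialize (H _ Hz).
    replace (Cexp z) with (Cexp a * Cexp (z - a))%C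
      by (rewrite <- Cexp_plus; f_equal; ring).
    replace ((Cexp a * Cexp (z - a) - Cexp a) / (z - a) - Cexp a)%C
      with (Cexp a * (Cexp (z - a) - 1 - (z - a)) / (z - a))%C by (field; exact Hne).
    rewrite Cmod_div, Cmod_mult by exact Hne. fold A.
    apply Rle_lt_trans with (e / 2); [|lra].
    apply Rmult_le_reg_r with (Cmod (z - a)); [exact Hp|].
    unfold Rdiv at 1. rewrite Rmult_assoc, Rinv_l by lra. rewrite Rmult_1_r.
    apply Rle_trans with (A * (e / (2 * A) * Cmod (z - a))).
    + apply Rmult_le_compat_l; lra.
    + right. field. lra.
  - intros z. destruct (Ceq_dec z a) as [E|E]; [subst; ring|].
    field. apply Cmod_gt_0. now apply Cmod_sub_pos.
Qed.

(** * Goursat's theorem *)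

(* Cousin's lemma for rectangles; it replaces compactness throughout. *)
Lemma rect_bisection (Q : R -> R -> R -> R -> Prop) (a b c d : R) :
  a <= b -> c <= d ->
  (forall a' b' c' d', a' <= b' -> c' <= d' ->
     Q a' ((a' + b') / 2) c' ((c' + d') / 2) ->
     Q ((a' + b') / 2) b' c' ((c' + d') / 2) ->
     Q a' ((a' + b') / 2) ((c' + d') / 2) d' ->
     Q ((a' + b') / 2) b' ((c' + d') / 2) d' -> Q a' b' c' d') ->
  (forall x y, a <= x <= b -> c <= y <= d -> exists del, 0 < del /\
     forall a' b' c' d', a <= a' <= x -> x <= b' <= b -> c <= c' <= y -> y <= d' <= d ->
       b' - a' < del -> d' - c' < del -> Q a' b' c' d') ->
  Q a b c d.
Proof.
  intros Hab Hcd Hsplit Hloc. apply NNPP. intros Hbad.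
  set (P := fun s : R * R * R * R => let '(a', b', c', d') := s in
    a <= a' /\ a' <= b' /\ b' <= b /\ c <= c' /\ c' <= d' /\ d' <= d /\ ~ Q a' b' c' d').
  set (T := fun s s' : R * R * R * R =>
    let '(a0, b0, c0, d0) := s in let '(a1, b1, c1, d1) := s' in
    a0 <= a1 /\ b1 <= b0 /\ c0 <= c1 /\ d1 <= d0 /\
    b1 - a1 = (b0 - a0) / 2 /\ d1 - c1 = (d0 - c0) / 2).
  assert (Hnext : forall s : sig P, {s' : sig P | T (proj1_sig s) (proj1_sig s')}).
  { intros [[[[a0 b0] c0] d0] Hs]. apply constructive_indefinite_description. simpl.
    destruct Hs as (h1 & h2 & h3 & h4 & h5 & h6 & h7).
    destruct (classic (Q a0 ((a0 + b0) / 2) c0 ((c0 + d0) / 2))) as [q1|q1].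
    2:{ unshelve eexists; [exists (a0, (a0+b0)/2, c0, (c0+d0)/2)|]; simpl; repeat split; trivial; lra. }
    destruct (classic (Q ((a0 + b0) / 2) b0 c0 ((c0 + d0) / 2))) as [q2|q2].
    2:{ unshelve eexists; [exists ((a0+b0)/2, b0, c0, (c0+d0)/2)|]; simpl; repeat split; trivial; lra. }
    destruct (classic (Q a0 ((a0 + b0) / 2) ((c0 + d0) / 2) d0)) as [q3|q3].
    2:{ unshelve eexists; [exists (a0, (a0+b0)/2, (c0+d0)/2, d0)|]; simpl; repeat split; trivial; lra. }
    destruct (classic (Q ((a0 + b0) / 2) b0 ((c0 + d0) / 2) d0)) as [q4|q4].
    2:{ unshelve eexists; [exists ((a0+b0)/2, b0, (c0+d0)/2, d0)|]; simpl; repeat split; trivial; lra. }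
    exfalso. apply h7. now apply Hsplit. }
  assert (H0 : P (a, b, c, d)) by (simpl; repeat split; trivial; lra).
  set (sq := fix sq n : sig P :=
    match n with O => exist P _ H0 | S k => proj1_sig (Hnext (sq k)) end).
  set (A := fun n => fst (fst (fst (proj1_sig (sq n))))).
  set (B := fun n => snd (fst (fst (proj1_sig (sq n))))).
  set (C0 := fun n => snd (fst (proj1_sig (sq n)))).
  set (D := fun n => snd (proj1_sig (sq n))).
  assert (HP : forall n, a <= A n /\ A n <= B n /\ B n <= b /\ c <= C0 n /\ C0 n <= D n
                /\ D n <= d /\ ~ Q (A n) (B n) (C0 n) (D n)).
  { intros n. unfold A, B, C0, D. destruct (sq n) as [[[[a0 b0] c0] d0] Hs]. exact Hs. }
  assert (HT : forall n, A n <= A (S n) /\ B (S n) <= B n /\ C0 n <= C0 (S n) /\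
     D (S n) <= D n /\ B (S n) - A (S n) = (B n - A n) / 2 /\
     D (S n) - C0 (S n) = (D n - C0 n) / 2).
  { intros n. unfold A, B, C0, D. simpl. destruct (Hnext (sq n)) as [s' Hs'].
    simpl. destruct (sq n) as [[[[a0 b0] c0] d0] Hs].
    destruct s' as [[[[a1 b1] c1] d1] Hs1]. exact Hs'. }
  clearbody A B C0 D. clear sq H0 Hnext T P.
  assert (Hmono : forall n m, (n <= m)%nat ->
     A n <= A m /\ B m <= B n /\ C0 n <= C0 m /\ D m <= D n).
  { intros n m Hnm. induction Hnm; [repeat split; lra|]. specialize (HT m). lra. }
  assert (Hcross : forall n m, A n <= B m /\ C0 n <= D m).
  { intros n m. destruct (Hmono n (max n m)) as (u1 & _ & u2 & _); [lia|].
    destruct (Hmono m (max n m)) as (_ & u3 & _ & u4); [lia|].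
    specialize (HP (max n m)). lra. }
  assert (Hsize : forall n, B n - A n = (B 0%nat - A 0%nat) * (/ 2) ^ n /\
                       D n - C0 n = (D 0%nat - C0 0%nat) * (/ 2) ^ n).
  { induction n; [simpl; lra|]. destruct (HT n) as (_ & _ & _ & _ & u & v). simpl. lra. }
  assert (Hx : exists x, forall n, A n <= x <= B n).
  { destruct (completeness (fun r => exists n, r = A n)) as [x [Hx1 Hx2]].
    - exists (B 0%nat). intros r [n ->]. apply Hcross.
    - exists (A 0%nat), 0%nat. reflexivity.
    - exists x. intros n. split; [apply Hx1; now exists n|].
      apply Hx2. intros r [m ->]. apply Hcross. }
  assert (Hy : exists y, forall n, C0 n <= y <= D n).
  { destruct (completeness (fun r => exists n, r = C0 n)) as [x [Hx1 Hx2]].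
    - exists (D 0%nat). intros r [n ->]. apply Hcross.
    - exists (C0 0%nat), 0%nat. reflexivity.
    - exists x. intros n. split; [apply Hx1; now exists n|].
      apply Hx2. intros r [m ->]. apply Hcross. }
  destruct Hx as [x Hx], Hy as [y Hy].
  destruct (Hloc x y) as [del [Hdel Hq]].
  { specialize (Hx 0%nat). specialize (HP 0%nat). lra. }
  { specialize (Hy 0%nat). specialize (HP 0%nat). lra. }
  set (M := 1 + (B 0%nat - A 0%nat) + (D 0%nat - C0 0%nat)).
  assert (HM : 1 <= M) by (unfold M; specialize (HP 0%nat); lra).
  destruct (pow_lt_1_zero (/ 2)) with (y := del / M) as [N HN].
  { rewrite Rabs_pos_eq; lra. }
  { apply Rdiv_lt_0_compat; lra. }
  specialize (HN N (le_n N)).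
  assert (Hpw : 0 < (/ 2) ^ N) by (apply pow_lt; lra).
  rewrite Rabs_pos_eq in HN by lra.
  assert (HN' : M * (/ 2) ^ N < del).
  { apply Rmult_lt_compat_l with (r := M) in HN; [|lra].
    replace (M * (del / M)) with del in HN by (field; lra). exact HN. }
  destruct (Hsize N) as [s1 s2]. specialize (Hx N). specialize (Hy N). specialize (HP N).
  assert (HP0 := Hmono 0%nat N ltac:(lia)).
  apply HP. assert (Hc0 := Hcross 0%nat 0%nat). apply Hq; try lra.
  - rewrite s1. unfold M in HN'. nra.
  - rewrite s2. unfold M in HN'. nra.
Qed.

Lemma continuous_of_local_Lipschitz (g : R -> R) (y M del : R) :
  0 < del -> (forall y', Rabs (y' - y) < del -> Rabs (g y' - g y) <= M * Rabs (y' - y)) ->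
  continuous g y.
Proof.
  intros Hd H. apply continuity_pt_filterlim. intros e He.
  assert (HM := Rabs_pos M).
  exists (Rmin del (e / (1 + Rabs M))). split.
  { apply Rmin_pos; [exact Hd|]. apply Rdiv_lt_0_compat; lra. }
  intros y' [_ Hy']. simpl in *. unfold R_dist in *.
  assert (h1 := Rlt_le_trans _ _ _ Hy' (Rmin_l _ _)).
  assert (h2 := Rlt_le_trans _ _ _ Hy' (Rmin_r _ _)).
  specialize (H y' h1). assert (h := Rabs_pos (y' - y)).
  apply Rle_lt_trans with ((1 + Rabs M) * Rabs (y' - y)).
  { assert (h3 := Rle_abs M). nra. }
  apply Rlt_le_trans with ((1 + Rabs M) * (e / (1 + Rabs M))).
  - apply Rmult_lt_compat_l; lra.
  - right. field. lra.
Qed.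

Lemma ex_RInt_continuous_on (g : R -> R) (u v : R) :
  u <= v -> (forall t, u <= t <= v -> continuous g t) -> ex_RInt g u v.
Proof.
  intros Huv H. apply (ex_RInt_continuous (V := R_CompleteNormedModule)).
  intros t. rewrite Rmin_left, Rmax_right by exact Huv. apply H.
Qed.

Lemma RInt_near_const (g : R -> R) (u v k e : R) :
  u <= v -> ex_RInt g u v -> (forall t, u <= t <= v -> Rabs (g t - k) <= e) ->
  Rabs (RInt g u v - k * (v - u)) <= e * (v - u).
Proof.
  intros Huv Hg H.
  assert (Hk : is_RInt (fun t => minus (g t) k) u v (minus (RInt g u v) (scal (v - u) k))).
  { apply @is_RInt_minus; [now apply (RInt_correct (V := R_CompleteNormedModule))|].
    apply @is_RInt_const. }
  replace (RInt g u v - k * (v - u)) with (RInt (fun t => g t - k) u v).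
  - rewrite (Rmult_comm e). apply abs_RInt_le_const; [exact Huv| |exact H].
    eexists; exact Hk.
  - apply (is_RInt_unique (V := R_CompleteNormedModule)) in Hk.
    change (RInt (fun t => g t - k) u v = RInt g u v - (v - u) * k) in Hk. lra.
Qed.

Section Goursat.

Variables (U V : R -> R -> R) (a b c d : R).
Hypothesis Hab : a <= b.
Hypothesis Hcd : c <= d.

(** The shared coefficient [l] is the Cauchy-Riemann equation [U_x = V_y], the one that makes the
    form [V dx + U dy] closed. *)
Hypothesis Hdiff : forall x y, a <= x <= b -> c <= y <= d ->
  exists l m n, forall eps, 0 < eps -> exists del, 0 < del /\
    forall x' y', Rabs (x' - x) < del -> Rabs (y' - y) < del ->
      Rabs (U x' y' - (U x y + l * (x' - x) + m * (y' - y)))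
        <= eps * (Rabs (x' - x) + Rabs (y' - y)) /\
      Rabs (V x' y' - (V x y + n * (x' - x) + l * (y' - y)))
        <= eps * (Rabs (x' - x) + Rabs (y' - y)).

(* The circulation of [V dx + U dy] around the rectangle. *)
Definition circulation (a' b' c' d' : R) : R :=
  RInt (fun y => U b' y - U a' y) c' d' + RInt (fun x => V x c' - V x d') a' b'.

Lemma Goursat_cont (x y : R) : a <= x <= b -> c <= y <= d ->
  continuous (U x) y /\ continuous (fun t => V t y) x.
Proof.
  intros Hx Hy. destruct (Hdiff x y Hx Hy) as (l & m & n & H).
  destruct (H 1 Rlt_0_1) as [del [Hd Hb]]. split.
  - apply (continuous_of_local_Lipschitz _ _ (1 + Rabs m) del Hd). intros y' h1.
    destruct (Hb x y') as [h3 _]; [rewrite Rminus_diag, Rabs_R0; lra|exact h1|].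
    rewrite Rminus_diag, Rabs_R0 in h3.
    replace (U x y' - U x y) with ((U x y' - (U x y + l * 0 + m * (y' - y))) + m * (y' - y)) by ring.
    eapply Rle_trans; [apply Rabs_triang|]. rewrite (Rabs_mult m). lra.
  - apply (continuous_of_local_Lipschitz _ _ (1 + Rabs n) del Hd). intros x' h1.
    destruct (Hb x' y) as [_ h3]; [exact h1|rewrite Rminus_diag, Rabs_R0; lra|].
    rewrite Rminus_diag, Rabs_R0 in h3.
    replace (V x' y - V x y) with ((V x' y - (V x y + n * (x' - x) + l * 0)) + n * (x' - x)) by ring.
    eapply Rle_trans; [apply Rabs_triang|]. rewrite (Rabs_mult n). lra.
Qed.

Lemma Goursat_ex_U (x u v : R) : a <= x <= b -> c <= u -> u <= v -> v <= d -> ex_RInt (U x) u v.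
Proof.
  intros. apply ex_RInt_continuous_on; [assumption|]. intros t Ht. apply Goursat_cont; lra.
Qed.

Lemma Goursat_ex_V (y u v : R) :
  c <= y <= d -> a <= u -> u <= v -> v <= b -> ex_RInt (fun t => V t y) u v.
Proof.
  intros. apply ex_RInt_continuous_on; [assumption|]. intros t Ht. apply Goursat_cont; lra.
Qed.

Lemma circulation_eq (a' b' c' d' : R) : a <= a' -> a' <= b' -> b' <= b -> c <= c' -> c' <= d' -> d' <= d ->
  circulation a' b' c' d' =
  RInt (U b') c' d' - RInt (U a') c' d' + (RInt (fun x => V x c') a' b' - RInt (fun x => V x d') a' b').
Proof.
  intros. unfold circulation. f_equal.
  - apply (RInt_minus (V := R_CompleteNormedModule)); apply Goursat_ex_U; lra.
  - apply (RInt_minus (V := R_CompleteNormedModule)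
             (fun x => V x c') (fun x => V x d')); apply Goursat_ex_V; lra.
Qed.

Lemma circulation_split (a' m b' c' n d' : R) :
  a <= a' -> a' <= m -> m <= b' -> b' <= b -> c <= c' -> c' <= n -> n <= d' -> d' <= d ->
  circulation a' b' c' d' =
  circulation a' m c' n + circulation m b' c' n + circulation a' m n d' + circulation m b' n d'.
Proof.
  intros. rewrite !circulation_eq by lra.
  assert (EU : forall x, a <= x <= b -> RInt (U x) c' d' = RInt (U x) c' n + RInt (U x) n d').
  { intros x Hx. symmetry.
    apply (RInt_Chasles (V := R_CompleteNormedModule)); apply Goursat_ex_U; lra. }
  assert (EV : forall y, c <= y <= d -> RInt (fun x => V x y) a' b' =
     RInt (fun x => V x y) a' m + RInt (fun x => V x y) m b').
  { intros y Hy. symmetry.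
    apply (RInt_Chasles (V := R_CompleteNormedModule)); apply Goursat_ex_V; lra. }
  rewrite !EU, !EV by lra. ring.
Qed.

(** The square of width plus height is reproduced exactly by the four halves of a rectangle, so the
    bound passes through bisection. On a small rectangle the linear parts of [U] and [V] contribute
    [l w h] and [- l h w], which cancel. *)
Lemma circulation_bound (e : R) : 0 < e ->
  Rabs (circulation a b c d) <= e * ((b - a) + (d - c)) ^ 2.
Proof.
  intros He.
  (* The splitting hypothesis of [rect_bisection] ranges over all rectangles; the guards restrict it
     to those inside the domain. *)
  cut ((fun a' b' c' d' => a <= a' -> b' <= b -> c <= c' -> d' <= d ->
    Rabs (circulation a' b' c' d') <= e * ((b' - a') + (d' - c')) ^ 2) a b c d).
  { intros H. apply H; lra. }
  apply rect_bisection; trivial.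
  - intros a' b' c' d' h1 h2 q1 q2 q3 q4 h3 h4 h5 h6.
    rewrite (circulation_split a' ((a' + b') / 2) b' c' ((c' + d') / 2) d') by lra.
    specialize (q1 ltac:(lra) ltac:(lra) ltac:(lra) ltac:(lra)).
    specialize (q2 ltac:(lra) ltac:(lra) ltac:(lra) ltac:(lra)).
    specialize (q3 ltac:(lra) ltac:(lra) ltac:(lra) ltac:(lra)).
    specialize (q4 ltac:(lra) ltac:(lra) ltac:(lra) ltac:(lra)).
    eapply Rle_trans; [apply Rabs_triang|].
    eapply Rle_trans; [apply Rplus_le_compat_r, Rabs_triang|].
    eapply Rle_trans; [apply Rplus_le_compat_r, Rplus_le_compat_r, Rabs_triang|].
    eapply Rle_trans; [repeat apply Rplus_le_compat; eassumption|].
    right. field.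
  - intros x y Hx Hy. destruct (Hdiff x y Hx Hy) as (l & m & n & H).
    (* Each integrand is a difference over two opposite sides, and each side contributes an error
       [e / 2]. *)
    destruct (H (e / 2)) as [del [Hd Hb]]; [lra|]. exists del. split; [exact Hd|].
    intros a' b' c' d' [h1 h2] [h3 h4] [h5 h6] [h7 h8] h9 h10 _ _ _ _.
    set (w := b' - a') in *. set (h := d' - c') in *.
    assert (E : forall x' y', a' <= x' <= b' -> c' <= y' <= d' ->
      Rabs (U x' y' - (U x y + l * (x' - x) + m * (y' - y))) <= e / 2 * (w + h) /\
      Rabs (V x' y' - (V x y + n * (x' - x) + l * (y' - y))) <= e / 2 * (w + h)).
    { intros x' y' Hx' Hy'.
      assert (k1 : Rabs (x' - x) <= w) by (apply Rabs_le; unfold w; lra).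
      assert (k2 : Rabs (y' - y) <= h) by (apply Rabs_le; unfold h; lra).
      destruct (Hb x' y') as [k3 k4]; [lra|lra|].
      assert (k5 : e / 2 * (Rabs (x' - x) + Rabs (y' - y)) <= e / 2 * (w + h)).
      { apply Rmult_le_compat_l; lra. }
      lra. }
    assert (I1 : Rabs (RInt (fun y => U b' y - U a' y) c' d' - l * w * h) <= e * (w + h) * h).
    { apply RInt_near_const; [lra| |].
      - apply (ex_RInt_minus (V := R_NormedModule)); apply Goursat_ex_U; lra.
      - intros t Ht. destruct (E a' t) as [k1 _]; [lra|lra|].
        destruct (E b' t) as [k2 _]; [lra|lra|].
        apply Rabs_le_between in k1. apply Rabs_le_between in k2.
        apply Rabs_le. unfold w in *. lra. }
    assert (I2 : Rabs (RInt (fun x => V x c' - V x d') a' b' - - (l * h) * w) <= e * (w + h) * w).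
    { apply RInt_near_const; [lra| |].
      - apply (ex_RInt_minus (V := R_NormedModule) (fun x => V x c') (fun x => V x d'));
          apply Goursat_ex_V; lra.
      - intros t Ht. destruct (E t c') as [_ k1]; [lra|lra|].
        destruct (E t d') as [_ k2]; [lra|lra|].
        apply Rabs_le_between in k1. apply Rabs_le_between in k2.
        apply Rabs_le. unfold h in *. lra. }
    unfold circulation.
    apply Rabs_le_between in I1. apply Rabs_le_between in I2. apply Rabs_le. lra.
Qed.

Lemma Goursat : circulation a b c d = 0.
Proof.
  assert (H : Rabs (circulation a b c d) <= 0).
  { apply le_epsilon. intros e He. rewrite Rplus_0_l.
    set (M := ((b - a) + (d - c)) ^ 2).
    assert (HM : 0 <= M) by apply pow2_ge_0.
    assert (B := circulation_bound (e / (M + 1)) ltac:(apply Rdiv_lt_0_compat; lra)).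
    fold M in B. apply Rle_trans with (1 := B).
    apply Rle_trans with (e / (M + 1) * (M + 1)).
    - apply Rmult_le_compat_l; [left; apply Rdiv_lt_0_compat; lra|lra].
    - right. field. lra. }
  apply Rabs_eq_0. apply Rle_antisym; [exact H|apply Rabs_pos].
Qed.

End Goursat.

(** * The mean value property and the maximum principle *)

Lemma Cmod_coord (x y x' y' : R) : Cmod ((x', y') - (x, y)) <= Rabs (x' - x) + Rabs (y' - y).
Proof. eapply Rle_trans; [apply Cmod_le_abs|]. simpl. apply Rle_refl. Qed.

Lemma circulation_holomorphic (G : C -> C) (a b c d : R) :
  a <= b -> c <= d ->
  (forall x y, a <= x <= b -> c <= y <= d -> cdiff G (x, y)) ->
  circulation (fun x y => Re (G (x, y))) (fun x y => Im (G (x, y))) a b c d = 0.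
Proof.
  intros Hab Hcd HG. apply Goursat; trivial. intros x y Hx Hy.
  destruct (HG x y Hx Hy) as [phi [Hc E]].
  exists (Re (phi (x, y))), (- Im (phi (x, y))), (Im (phi (x, y))).
  intros eps He. destruct (Hc eps He) as [del [Hd Hp]].
  exists (del / 2). split; [lra|]. intros x' y' Hx' Hy'.
  assert (Hm := Cmod_coord x y x' y').
  set (u := ((x', y') - (x, y))%C) in *.
  specialize (Hp (x', y') ltac:(fold u; lra)).
  set (p := (phi (x', y') - phi (x, y))%C) in *.
  assert (Hpu : Cmod (p * u) <= eps * (Rabs (x' - x) + Rabs (y' - y))).
  { rewrite Cmod_mult. apply Rmult_le_compat; try apply Cmod_ge_0; lra. }
  assert (E' : (G (x', y') - G (x, y) - phi (x, y) * u)%C = (p * u)%C).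
  { rewrite (E (x', y')). fold u. unfold p. ring. }
  rewrite <- E' in Hpu. split.
  - eapply Rle_trans; [|apply Hpu]. eapply Rle_trans; [|apply re_le_Cmod].
    right. f_equal. unfold u, Re, Im. simpl. ring.
  - eapply Rle_trans; [|apply Hpu]. eapply Rle_trans; [|apply Cmod_Im].
    right. f_equal. unfold u, Re, Im. simpl. ring.
Qed.

Lemma Cexp_2PI (x : R) : Cexp (x, 2 * PI) = Cexp (x, 0).
Proof. unfold Cexp; simpl. now rewrite cos_2PI, sin_2PI, cos_0, sin_0. Qed.

(** Composition with [a + Cexp z] turns circles around [a] into vertical segments of length [2 PI].
    Goursat on [[x, ln r] x [0, 2 PI]], whose horizontal sides cancel by periodicity, shows that the
    mean is independent of the radius; continuity at [a] then gives its value. *)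
Lemma mean_value (h : C -> C) (a : C) (r : R) : 0 < r ->
  (forall z, Cmod (z - a) <= r -> cdiff h z) ->
  is_RInt (fun t => Re (h (a + Cexp (ln r, t))%C)) 0 (2 * PI) (2 * PI * Re (h a)).
Proof.
  intros Hr Hh. set (G := fun z => h (a + Cexp z)%C).
  assert (HPI := PI_RGT_0).
  assert (HG : forall x y, x <= ln r -> cdiff G (x, y)).
  { intros x y Hx. unfold G. apply (cdiff_comp h (fun z => a + Cexp z)%C).
    - apply Hh. replace (a + Cexp (x, y) - a)%C with (Cexp (x, y)) by ring.
      rewrite Cmod_Cexp. simpl. rewrite <- (exp_ln r) by exact Hr.
      destruct Hx as [Hx | ->]; [left; now apply exp_increasing|apply Rle_refl].
    - apply cdiff_plus; [apply cdiff_const|apply cdiff_Cexp]. }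
  assert (Hcont : forall x y, x <= ln r -> continuous (fun t => Re (G (x, t))) y).
  { intros x y Hx. apply continuity_pt_filterlim. intros e He.
    destruct (cdiff_ccont _ _ (HG x y Hx) e He) as [d [Hd H]].
    exists d. split; [exact Hd|]. intros y' [_ Hy']. simpl in *. unfold R_dist in *.
    eapply Rle_lt_trans; [|apply (H (x, y'))].
    - eapply Rle_trans; [|apply re_le_Cmod]. apply Rle_refl.
    - eapply Rle_lt_trans; [apply Cmod_coord|]. rewrite Rminus_diag, Rabs_R0. lra. }
  assert (Hex : forall x, x <= ln r -> ex_RInt (fun t => Re (G (x, t))) 0 (2 * PI)).
  { intros x Hx. apply ex_RInt_continuous_on; [lra|]. intros t _. now apply Hcont. }
  assert (Hsame : forall x, x <= ln r ->
     RInt (fun t => Re (G (ln r, t))) 0 (2 * PI) = RInt (fun t => Re (G (x, t))) 0 (2 * PI)).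
  { intros x Hx.
    assert (H0 := circulation_holomorphic G x (ln r) 0 (2 * PI) Hx ltac:(lra)
      ltac:(intros; apply HG; lra)).
    unfold circulation in H0.
    rewrite (RInt_ext (fun x0 => Im (G (x0, 0)) - Im (G (x0, 2 * PI))) (fun _ => 0)) in H0.
    2:{ intros t _. unfold G. rewrite Cexp_2PI. exact (Rminus_diag_eq _ _ eq_refl). }
    rewrite RInt_const in H0. unfold scal in H0; simpl in H0. unfold mult in H0; simpl in H0.
    rewrite Rmult_0_r, Rplus_0_r in H0.
    rewrite (RInt_minus (V := R_CompleteNormedModule)
      (fun t => Re (G (ln r, t))) (fun t => Re (G (x, t)))) in H0
      by (apply Hex; lra).
    unfold minus, plus, opp in H0; simpl in H0. lra. }
  assert (Hval : RInt (fun t => Re (G (ln r, t))) 0 (2 * PI) = 2 * PI * Re (h a)).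
  { apply Rminus_diag_uniq, Rabs_eq_0, Rle_antisym; [|apply Rabs_pos].
    apply le_epsilon. intros e He. rewrite Rplus_0_l.
    assert (Ha : cdiff h a) by (apply Hh; rewrite Cmod_sub_diag; lra).
    destruct (cdiff_ccont _ _ Ha (e / (2 * PI))) as [d [Hd H]].
    { apply Rdiv_lt_0_compat; lra. }
    (* The [- 1] makes the radius [exp x] strictly smaller than [d]. *)
    set (x := Rmin (ln r) (ln d - 1)).
    rewrite (Hsame x) by apply Rmin_l.
    replace (2 * PI * Re (h a)) with (Re (h a) * (2 * PI - 0)) by ring.
    replace e with (e / (2 * PI) * (2 * PI - 0)) by (field; lra).
    apply RInt_near_const; [lra|apply Hex, Rmin_l|].
    intros t _. left. eapply Rle_lt_trans; [|apply (H (a + Cexp (x, t))%C)].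
    - eapply Rle_trans; [|apply re_le_Cmod]. apply Rle_refl.
    - replace (a + Cexp (x, t) - a)%C with (Cexp (x, t)) by ring.
      rewrite Cmod_Cexp. simpl. apply Rlt_le_trans with (exp (ln d)).
      + apply exp_increasing. assert (Hx := Rmin_r (ln r) (ln d - 1)). fold x in Hx. lra.
      + right. now apply exp_ln. }
  rewrite <- Hval. apply (RInt_correct (V := R_CompleteNormedModule)). apply Hex. lra.
Qed.

Lemma is_RInt_trig (k A B : R) :
  is_RInt (fun t => k - A * cos t - B * sin t) 0 (2 * PI) (2 * PI * k).
Proof.
  set (f := fun t => k * t - A * sin t + B * cos t).
  replace (2 * PI * k) with (minus (f (2 * PI)) (f 0)).
  - apply (is_RInt_derive (V := R_CompleteNormedModule) f).
    + intros x _. unfold f. auto_derive; [trivial|ring].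
    + intros x _. apply (ex_derive_continuous (V := R_NormedModule)). auto_derive. trivial.
  - unfold f, minus, plus, opp; simpl. rewrite cos_2PI, sin_2PI, cos_0, sin_0. ring.
Qed.

Lemma exists_rotation (z : C) : exists c, Cmod c = 1 /\ (c * z)%C = RtoC (Cmod z).
Proof.
  destruct (Ceq_dec z 0) as [->|Hz].
  - exists 1. rewrite Cmod_1, Cmod_0. split; [reflexivity|ring].
  - assert (Hm : Cmod z <> 0) by (apply Rgt_not_eq; now apply Cmod_gt_0).
    exists (Cconj z / RtoC (Cmod z))%C. split.
    + rewrite Cmod_div, Cmod_conj, Cmod_R, Rabs_pos_eq.
      * field. exact Hm.
      * apply Cmod_ge_0.
      * intros E. apply RtoC_inj in E. contradiction.
    + assert (Hm' : RtoC (Cmod z) <> 0) by (intros E; apply RtoC_inj in E; contradiction).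
      assert (E := Cmod2_conj z). rewrite RtoC_pow in E.
      replace (Cconj z / RtoC (Cmod z) * z)%C with (z * Cconj z / RtoC (Cmod z))%C
        by (field; exact Hm').
      rewrite <- E. field. exact Hm'.
Qed.

(* Adding [e |z|^2] makes the sub-mean-value inequality strict, so an interior maximum
   is impossible without analysing the case of equality. *)
Lemma no_penalized_max (h : C -> C) (a : C) (r e : R) : 0 < r -> 0 < e ->
  (forall z, Cmod (z - a) <= r -> cdiff h z) ->
  ~ (forall z, Cmod (z - a) <= r -> Cmod (h z) + e * Cmod z ^ 2 <= Cmod (h a) + e * Cmod a ^ 2).
Proof.
  intros Hr He Hh Hmax.
  (* After the rotation [Re (c * h)] equals [|h|] at the centre and is at most [|h|] elsewhere, so
     the mean value of a real part controls the modulus. *)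
  destruct (exists_rotation (h a)) as [c [Hc Eca]].
  assert (HI := mean_value (fun z => c * h z)%C a r Hr
    (fun z Hz => cdiff_mult _ _ _ (cdiff_const c z) (Hh z Hz))).
  cbv beta in HI. rewrite Eca in HI. simpl (Re (RtoC _)) in HI.
  (* On the circle [|z|^2 = |a|^2 + r^2 + 2 r (Re a cos t + Im a sin t)]. The supposed maximality
     bounds [|h|] by this trigonometric polynomial, whose mean is too small by [e r^2]. *)
  assert (HJ := is_RInt_trig (Cmod (h a) - e * r ^ 2) (2 * e * r * Re a) (2 * e * r * Im a)).
  assert (HPI := PI_RGT_0).
  assert (Hle : 2 * PI * Cmod (h a) <= 2 * PI * (Cmod (h a) - e * r ^ 2)).
  { apply (is_RInt_le _ _ 0 (2 * PI) _ _ ltac:(lra) HI HJ). intros t _.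
    set (z := (a + Cexp (ln r, t))%C).
    assert (Hz : Cmod (z - a) <= r).
    { unfold z. replace (a + Cexp (ln r, t) - a)%C with (Cexp (ln r, t)) by ring.
      rewrite Cmod_Cexp. simpl. rewrite exp_ln by exact Hr. apply Rle_refl. }
    specialize (Hmax z Hz).
    assert (H1 : Re (c * h z) <= Cmod (h z)).
    { eapply Rle_trans; [apply Rle_abs|]. eapply Rle_trans; [apply re_le_Cmod|].
      rewrite Cmod_mult, Hc. lra. }
    assert (Hn : Cmod z ^ 2 = Cmod a ^ 2 + r ^ 2 + 2 * r * (Re a * cos t + Im a * sin t)).
    { rewrite !Cmod_sqr. unfold z, Cexp, Re, Im. simpl fst. simpl snd. rewrite exp_ln by exact Hr.
      assert (T := sin2_cos2 t). unfold Rsqr in T.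
      replace (r ^ 2) with (r * r * (sin t * sin t + cos t * cos t)) by (rewrite T; ring).
      ring. }
    rewrite Hn in Hmax. eapply Rle_trans; [exact H1|]. lra. }
  assert (0 < 2 * PI * (e * r ^ 2)).
  { apply Rmult_lt_0_compat; [lra|]. apply Rmult_lt_0_compat; [lra|]. now apply pow_lt. }
  lra.
Qed.

(** If no maximum exists, every point of [X] is beaten by another one, and semicontinuity makes that
    one beat a whole neighbourhood. Bisection keeps the best of four such points, so one point of
    [X] beats all of [X], itself included. *)
Lemma usc_attains_max (X : C -> Prop) (u : C -> R) (M : R) (z0 : C) :
  (forall z, X z -> Cmod z <= M) ->
  (forall z, ~ X z -> exists r, 0 < r /\ forall w, Cmod (w - z) < r -> ~ X w) ->
  (forall z, X z -> forall e, 0 < e -> exists d, 0 < d /\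
     forall w, X w -> Cmod (w - z) < d -> u w < u z + e) ->
  X z0 -> exists z, X z /\ forall w, X w -> u w <= u z.
Proof.
  intros HM Hcl Hu Hz0. apply NNPP. intros Hno.
  assert (Hup : forall z, X z -> exists z', X z' /\ u z < u z').
  { intros z Hz. apply NNPP. intros H. apply Hno. exists z. split; [exact Hz|].
    intros w Hw. apply Rnot_lt_le. intros Hlt. apply H. now exists w. }
  assert (HM0 : 0 <= M).
  { eapply Rle_trans; [apply Cmod_ge_0|]. now apply (HM z0). }
  destruct (rect_bisection (fun a b c d => exists z, X z /\
    forall x y, a <= x <= b -> c <= y <= d -> X (x, y) -> u (x, y) < u z) (- M) M (- M) M)
    as [z [Hz H]]; try lra.
  - intros a b c d Hab Hcd (z1 & X1 & H1) (z2 & X2 & H2) (z3 & X3 & H3) (z4 & X4 & H4).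
    assert (Hmax : forall s t, X s -> X t -> exists p, X p /\ u s <= u p /\ u t <= u p).
    { intros s t Hs Ht. destruct (Rle_dec (u s) (u t)).
      - exists t. repeat split; trivial; lra.
      - exists s. repeat split; trivial; lra. }
    destruct (Hmax z1 z2 X1 X2) as (p & Xp & p1 & p2).
    destruct (Hmax z3 z4 X3 X4) as (q & Xq & q1 & q2).
    destruct (Hmax p q Xp Xq) as (s & Xs & s1 & s2).
    exists s. split; [exact Xs|]. intros x y Hx Hy Hxy.
    destruct (Rle_dec x ((a + b) / 2)), (Rle_dec y ((c + d) / 2)).
    + specialize (H1 x y ltac:(lra) ltac:(lra) Hxy). lra.
    + specialize (H3 x y ltac:(lra) ltac:(lra) Hxy). lra.
    + specialize (H2 x y ltac:(lra) ltac:(lra) Hxy). lra.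
    + specialize (H4 x y ltac:(lra) ltac:(lra) Hxy). lra.
  - intros x y _ _. destruct (classic (X (x, y))) as [Hxy|Hxy].
    + destruct (Hup _ Hxy) as (z' & Hz' & Hlt).
      destruct (Hu _ Hxy (u z' - u (x, y))) as [d [Hd H]]; [lra|].
      exists (d / 2). split; [lra|]. intros a' b' c' d' ? ? ? ? ? ?.
      exists z'. split; [exact Hz'|]. intros x' y' Hx' Hy' Hw.
      specialize (H _ Hw). apply Rlt_le_trans with (u (x, y) + (u z' - u (x, y))); [|lra].
      apply H. eapply Rle_lt_trans; [apply Cmod_coord|].
      assert (Rabs (x' - x) < d / 2) by (apply Rabs_lt_between; lra).
      assert (Rabs (y' - y) < d / 2) by (apply Rabs_lt_between; lra). lra.
    + destruct (Hcl _ Hxy) as [d [Hd H]].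
      exists (d / 2). split; [lra|]. intros a' b' c' d' ? ? ? ? ? ?.
      exists z0. split; [exact Hz0|]. intros x' y' Hx' Hy' Hw. exfalso.
      apply (H (x', y')); [|exact Hw].
      eapply Rle_lt_trans; [apply Cmod_coord|].
      assert (Rabs (x' - x) < d / 2) by (apply Rabs_lt_between; lra).
      assert (Rabs (y' - y) < d / 2) by (apply Rabs_lt_between; lra). lra.
  - destruct z as [x y]. apply (Rlt_irrefl (u (x, y))).
    assert (B := HM _ Hz). assert (B1 := re_le_Cmod (x, y)). assert (B2 := Cmod_Im (x, y)).
    simpl in B1, B2. apply H; trivial; apply Rabs_le_between; lra.
Qed.

Lemma maximum_principle (X : C -> Prop) (v : C -> R) (M m : R) :
  (forall z, X z -> Cmod z <= M) ->
  (forall z, ~ X z -> exists r, 0 < r /\ forall w, Cmod (w - z) < r -> ~ X w) ->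
  (forall z, X z -> forall e, 0 < e -> exists d, 0 < d /\
     forall w, X w -> Cmod (w - z) < d -> v w < v z + e) ->
  (forall z, X z -> v z <= m \/ exists h r, 0 < r /\
     forall w, Cmod (w - z) <= r -> X w /\ cdiff h w /\ v w = Cmod (h w)) ->
  forall z, X z -> v z <= m.
Proof.
  intros HM Hcl Hv Hloc z0 Hz0. apply Rnot_lt_le. intros Hlt.
  (* With [e M^2 < v z0 - m] the penalty cannot lift a point with [v z <= m] to the level of
     [z0]. *)
  set (e := (v z0 - m) / (2 * (M ^ 2 + 1))).
  assert (HM2 : 0 <= M ^ 2) by apply pow2_ge_0.
  assert (He : 0 < e) by (apply Rdiv_lt_0_compat; lra).
  destruct (usc_attains_max X (fun z => v z + e * Cmod z ^ 2) M z0) as [z [Hz Hmax]]; trivial.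
  { intros z Hz k Hk. destruct (Hv z Hz (k / 2)) as [d [Hd H]]; [lra|].
    set (A := Cmod z). assert (HA : 0 <= A) by apply Cmod_ge_0.
    exists (Rmin d (Rmin 1 (k / (2 * e * (2 * A + 1))))). split.
    { repeat apply Rmin_pos; trivial; [lra|]. apply Rdiv_lt_0_compat; [lra|].
      apply Rmult_lt_0_compat; lra. }
    intros w Hw Hwz.
    assert (h1 := Rlt_le_trans _ _ _ Hwz (Rmin_l _ _)).
    assert (h2 := Rlt_le_trans _ _ _ Hwz (Rmin_r _ _)).
    assert (h3 := Rlt_le_trans _ _ _ h2 (Rmin_l _ _)).
    assert (h4 := Rlt_le_trans _ _ _ h2 (Rmin_r _ _)).
    specialize (H w Hw h1).
    assert (h5 := Cmod_triangle_inv w z). fold A in h5 |- *.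
    set (t := Cmod (w - z)) in *.
    assert (ht : 0 <= t) by apply Cmod_ge_0.
    assert (h6 : Cmod w ^ 2 <= (A + t) ^ 2).
    { apply pow_incr. split; [apply Cmod_ge_0|lra]. }
    assert (h7 : t * (2 * e * (2 * A + 1)) < k).
    { apply Rmult_lt_compat_r with (r := 2 * e * (2 * A + 1)) in h4.
      - replace (k / (2 * e * (2 * A + 1)) * (2 * e * (2 * A + 1))) with k in h4
          by (field; lra). exact h4.
      - apply Rmult_lt_0_compat; lra. }
    assert (h8 : e * Cmod w ^ 2 <= e * (A + t) ^ 2) by (apply Rmult_le_compat_l; lra).
    assert (h9 : e * (A + t) ^ 2 <= e * A ^ 2 + e * (t * (2 * A + 1))).
    { rewrite <- Rmult_plus_distr_l. apply Rmult_le_compat_l; nra. }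
    lra. }
  assert (B : e * M ^ 2 < v z0 - m).
  { unfold e. apply Rmult_lt_reg_r with (2 * (M ^ 2 + 1)); [lra|].
    replace ((v z0 - m) / (2 * (M ^ 2 + 1)) * M ^ 2 * (2 * (M ^ 2 + 1)))
      with ((v z0 - m) * M ^ 2) by (field; lra). nra. }
  assert (Hz0' := Hmax z0 Hz0). simpl in Hz0'.
  assert (P0 : 0 <= e * Cmod z0 ^ 2) by (apply Rmult_le_pos; [lra|apply pow2_ge_0]).
  destruct (Hloc z Hz) as [Hle | (h & r & Hr & H)].
  - assert (Cmod z ^ 2 <= M ^ 2) by (apply pow_incr; split; [apply Cmod_ge_0|auto]).
    assert (e * Cmod z ^ 2 <= e * M ^ 2) by (apply Rmult_le_compat_l; lra). simpl in *. lra.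
  - apply (no_penalized_max h z r e Hr He); [intros w Hw; now apply H|].
    intros w Hw. destruct (H w Hw) as (Xw & _ & Ew).
    destruct (H z) as (_ & _ & Ez); [rewrite Cmod_sub_diag; lra|].
    rewrite <- Ew, <- Ez. now apply Hmax.
Qed.

(** * Maximum modulus and division by zeros *)

Definition rcont (f : C -> R) (a : C) : Prop :=
  forall eps, 0 < eps -> exists del, 0 < del /\
    forall z, Cmod (z - a) < del -> Rabs (f z - f a) < eps.

Lemma rcont_Re (f : C -> C) (a : C) : ccont f a -> rcont (fun z => Re (f z)) a.
Proof.
  intros H e He. destruct (H e He) as [d [Hd Hz]]. exists d. split; [exact Hd|].
  intros z Hza. eapply Rle_lt_trans; [|apply (Hz z Hza)].
  eapply Rle_trans; [|apply re_le_Cmod]. apply Rle_refl.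
Qed.

Lemma rcont_Cmod (f : C -> C) (a : C) : ccont f a -> rcont (fun z => Cmod (f z)) a.
Proof.
  intros H e He. destruct (H e He) as [d [Hd Hz]]. exists d. split; [exact Hd|].
  intros z Hza. specialize (Hz z Hza). apply Rabs_lt_between.
  assert (h1 := Cmod_triangle_inv (f z) (f a)).
  assert (h2 := Cmod_triangle_inv (f a) (f z)). rewrite Cmod_sub_sym in h2. lra.
Qed.

Lemma rcont_const (k : R) (a : C) : rcont (fun _ => k) a.
Proof. intros e He. exists 1. split; [lra|]. intros. rewrite Rminus_diag, Rabs_R0. lra. Qed.

Lemma rcont_minus (f g : C -> R) (a : C) : rcont f a -> rcont g a -> rcont (fun z => f z - g z) a.
Proof.
  intros Hf Hg e He. destruct (Hf (e / 2)) as [d1 [D1 H1]]; [lra|].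
  destruct (Hg (e / 2)) as [d2 [D2 H2]]; [lra|].
  exists (Rmin d1 d2). split; [now apply Rmin_pos|]. intros z Hz.
  specialize (H1 z (Rlt_le_trans _ _ _ Hz (Rmin_l _ _))).
  specialize (H2 z (Rlt_le_trans _ _ _ Hz (Rmin_r _ _))).
  apply Rabs_lt_between in H1. apply Rabs_lt_between in H2. apply Rabs_lt_between. lra.
Qed.

Lemma rcont_pos_locally (L : list (C -> R)) (a : C) :
  (forall phi, In phi L -> rcont phi a) -> (forall phi, In phi L -> 0 < phi a) ->
  exists r, 0 < r /\ forall z, Cmod (z - a) <= r -> forall phi, In phi L -> 0 < phi z.
Proof.
  induction L as [|phi L IH]; intros Hc Hp.
  - exists 1. split; [lra|]. intros z _ psi [].
  - destruct IH as [r [Hr H]].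
    { intros. apply Hc. now right. } { intros. apply Hp. now right. }
    destruct (Hc phi (or_introl eq_refl) (phi a)) as [d [Hd Hz]].
    { apply Hp. now left. }
    exists (Rmin r (d / 2)). split; [apply Rmin_pos; lra|].
    intros z Hza psi [<-|Hin].
    + assert (h := Rle_trans _ _ _ Hza (Rmin_r _ _)).
      specialize (Hz z ltac:(lra)). apply Rabs_lt_between in Hz. lra.
    + apply H; [|exact Hin]. eapply Rle_trans; [exact Hza|apply Rmin_l].
Qed.

(** The domain is given by finitely many continuous inequalities. A point where all are strict has a
    neighbourhood in the domain, so the boundary is replaced by the points where some constraint is
    tight. *)
Lemma maximum_modulus (L : list (C -> R)) (h : C -> C) (M m : R) :
  (forall z, (forall phi, In phi L -> 0 <= phi z) -> Cmod z <= M) ->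
  (forall phi, In phi L -> forall z, rcont phi z) ->
  (forall z, (forall phi, In phi L -> 0 <= phi z) -> cdiff h z) ->
  (forall z, (forall phi, In phi L -> 0 <= phi z) ->
     forall phi, In phi L -> phi z = 0 -> Cmod (h z) <= m) ->
  forall z, (forall phi, In phi L -> 0 <= phi z) -> Cmod (h z) <= m.
Proof.
  intros HM Hc Hh Hb.
  apply (maximum_principle (fun z => forall phi, In phi L -> 0 <= phi z)
           (fun z => Cmod (h z)) M m); trivial.
  - intros z Hz. apply not_all_ex_not in Hz. destruct Hz as [phi Hphi].
    apply imply_to_and in Hphi. destruct Hphi as [Hin Hlt]. apply Rnot_le_lt in Hlt.
    destruct (Hc phi Hin z (- phi z)) as [d [Hd H]]; [lra|].
    exists d. split; [exact Hd|]. intros w Hw Habs. specialize (Habs phi Hin).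
    specialize (H w Hw). apply Rabs_lt_between in H. lra.
  - intros z Hz e He.
    destruct (rcont_Cmod h z (cdiff_ccont _ _ (Hh z Hz)) e He) as [d [Hd H]].
    exists d. split; [exact Hd|]. intros w _ Hw. specialize (H w Hw).
    apply Rabs_lt_between in H. lra.
  - intros z Hz. destruct (classic (exists phi, In phi L /\ phi z = 0)) as [(phi & Hin & E)|Hn].
    + left. now apply (Hb z Hz phi).
    + right. destruct (rcont_pos_locally L z) as [r [Hr H]].
      * intros phi Hin. now apply Hc.
      * intros phi Hin. destruct (Hz phi Hin) as [Hlt|E]; [exact Hlt|].
        exfalso. apply Hn. exists phi. now split.
      * exists h, r. split; [exact Hr|]. intros w Hw.
        assert (Xw : forall phi, In phi L -> 0 <= phi w) by (intros; left; now apply H).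
        split; [exact Xw|]. split; [now apply Hh|reflexivity].
Qed.

(** Divisibility instead of exact order: it passes to quotients and through charts without keeping
    track of where the cofactor vanishes. *)
Definition divides_at (f : C -> C) (a : C) (m : nat) : Prop :=
  exists g r, 0 < r /\ forall z, Cmod (z - a) < r ->
    cdiff g z /\ f z = (Defs.Cpow (z - a) m * g z)%C.

Lemma Cmod_Cpow (z : C) (m : nat) : Cmod (Defs.Cpow z m) = Cmod z ^ m.
Proof.
  induction m as [|m IH]; simpl; [apply Cmod_1|]. now rewrite Cmod_mult, IH.
Qed.

Lemma Cpow_neq0 (z : C) (m : nat) : z <> 0 -> Defs.Cpow z m <> 0.
Proof.
  intros Hz. apply Cmod_gt_0. rewrite Cmod_Cpow. apply pow_lt. now apply Cmod_gt_0.
Qed.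

Lemma Csub_neq0 (a b : C) : a <> b -> (a - b)%C <> 0.
Proof. intros H. apply Cmod_gt_0. now apply Cmod_sub_pos. Qed.

(** The map [A] moves the zeros. With the identity and with a reflection it yields the two
    polynomials whose quotient is a Blaschke product. *)
Definition lprod (A : C -> C) (s : list (C * nat)) (z : C) : C :=
  fold_right (fun zm acc => Cmult (Defs.Cpow (z - A (fst zm)) (snd zm)) acc) (RtoC 1) s.

Lemma cdiff_sub_pow (a z : C) (m : nat) : cdiff (fun w => Defs.Cpow (w - a) m) z.
Proof.
  apply (cdiff_pow (fun w => w - a)%C). apply cdiff_minus; [apply cdiff_id|apply cdiff_const].
Qed.

Lemma cdiff_lprod (A : C -> C) (s : list (C * nat)) (z : C) : cdiff (lprod A s) z.
Proof.
  induction s as [|[a m] s IH]; simpl; [apply cdiff_const|].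
  apply (cdiff_mult (fun w => Defs.Cpow (w - A a) m)); [apply cdiff_sub_pow|exact IH].
Qed.

(** The zeros are divided out one at a time, the quotient being completed at [a] by the local
    cofactor. Distinctness preserves the remaining ones: near [b <> a] the factor [(z - a)^m] is
    invertible. *)
Lemma factor_zeros (U : C -> Prop) (s : list (C * nat)) : forall f : C -> C,
  (forall z, U z -> cdiff f z) -> NoDup (map fst s) ->
  (forall zm, In zm s -> divides_at f (fst zm) (snd zm)) ->
  exists G, (forall z, U z -> cdiff G z) /\ forall z, f z = (lprod (fun a => a) s z * G z)%C.
Proof.
  induction s as [|[a m] s IH]; intros f Hf Hnd Hz.
  - exists f. split; [exact Hf|]. intros z. simpl. ring.
  - destruct (Hz (a, m) (or_introl eq_refl)) as (g & r & Hr & Hg). simpl in Hg.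
    set (f1 := fun z => if Ceq_dec z a then g a else (f z / Defs.Cpow (z - a) m)%C).
    assert (E1 : forall z, f z = (Defs.Cpow (z - a) m * f1 z)%C).
    { intros z. unfold f1. destruct (Ceq_dec z a) as [->|E].
      - apply Hg. rewrite Cmod_sub_diag. exact Hr.
      - field. now apply Cpow_neq0, Csub_neq0. }
    assert (Hf1 : forall z, U z -> cdiff f1 z).
    { intros z Uz. destruct (Ceq_dec z a) as [->|E].
      - apply (cdiff_ext_loc g f1 a r Hr); [|apply Hg; rewrite Cmod_sub_diag; exact Hr].
        intros w Hw. unfold f1. destruct (Ceq_dec w a) as [->|E]; [reflexivity|].
        destruct (Hg w Hw) as [_ ->]. field. now apply Cpow_neq0, Csub_neq0.
      - apply (cdiff_ext_loc (fun w => f w / Defs.Cpow (w - a) m)%C f1 z (Cmod (z - a))).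
        + now apply Cmod_sub_pos.
        + intros w Hw. unfold f1. destruct (Ceq_dec w a) as [->|_]; [|reflexivity].
          rewrite Cmod_sub_sym in Hw. lra.
        + apply (cdiff_div f (fun w => Defs.Cpow (w - a) m)); [|now apply Hf|apply cdiff_sub_pow].
          now apply Cpow_neq0, Csub_neq0. }
    inversion Hnd as [|? ? Hnin Hnd']; subst.
    destruct (IH f1 Hf1 Hnd') as (G & HG & EG).
    { intros [b k] Hin. destruct (Hz (b, k) (or_intror Hin)) as (gb & rb & Hrb & Hgb).
      simpl in *. assert (Eab : b <> a).
      { intros ->. apply Hnin. now apply (in_map fst) in Hin. }
      exists (fun w => gb w / Defs.Cpow (w - a) m)%C, (Rmin rb (Cmod (b - a))).
      split; [apply Rmin_pos; [exact Hrb|now apply Cmod_sub_pos]|].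
      intros z Hzb. assert (h1 := Rlt_le_trans _ _ _ Hzb (Rmin_l _ _)).
      assert (h2 := Rlt_le_trans _ _ _ Hzb (Rmin_r _ _)).
      assert (Eza : z <> a) by (intros ->; rewrite Cmod_sub_sym in h2; lra).
      destruct (Hgb z h1) as [hd he]. split.
      - apply (cdiff_div gb (fun w => Defs.Cpow (w - a) m)); [|exact hd|apply cdiff_sub_pow].
        now apply Cpow_neq0, Csub_neq0.
      - unfold f1. destruct (Ceq_dec z a) as [E|_]; [contradiction|].
        rewrite he. field. now apply Cpow_neq0, Csub_neq0. }
    exists G. split; [exact HG|]. intros z. rewrite E1, EG. simpl. ring.
Qed.

Lemma zsum_cons (w : C -> R) (a : C) (m : nat) (s : list (C * nat)) :
  zsum w ((a, m) :: s) = INR m * w a + zsum w s.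
Proof. reflexivity. Qed.

Lemma zsum_le (w w' : C -> R) (s : list (C * nat)) :
  (forall zm, In zm s -> w (fst zm) <= w' (fst zm)) -> zsum w s <= zsum w' s.
Proof.
  induction s as [|[a m] s IH]; intros H; [simpl; lra|]. rewrite !zsum_cons.
  apply Rplus_le_compat.
  - apply Rmult_le_compat_l; [apply pos_INR|]. apply (H (a, m)). now left.
  - apply IH. intros. apply H. now right.
Qed.

Lemma zsum_scal (k : R) (w : C -> R) (s : list (C * nat)) :
  zsum (fun z => k * w z) s = k * zsum w s.
Proof. induction s as [|[a m] s IH]; [simpl; ring|]. rewrite !zsum_cons, IH. ring. Qed.

Lemma zsum_nonneg (w : C -> R) (s : list (C * nat)) :
  (forall zm, In zm s -> 0 <= w (fst zm)) -> 0 <= zsum w s.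
Proof.
  induction s as [|[a m] s IH]; intros H; [simpl; lra|]. rewrite zsum_cons.
  apply Rplus_le_le_0_compat.
  - apply Rmult_le_pos; [apply pos_INR|]. apply (H (a, m)). now left.
  - apply IH. intros. apply H. now right.
Qed.

Lemma exp_INR_mult (m : nat) (x : R) : exp (INR m * x) = exp x ^ m.
Proof.
  induction m as [|m IH]; [simpl; rewrite Rmult_0_l; apply exp_0|].
  rewrite S_INR. simpl. rewrite <- IH, <- exp_plus. f_equal. ring.
Qed.

(** The logarithmic form of the comparison turns a product of Blaschke factors into a [zsum]. *)
Lemma lprod_le (A B : C -> C) (E : C -> R) (s : list (C * nat)) (z : C) :
  (forall zm, In zm s ->
     Cmod (z - A (fst zm)) <= Cmod (z - B (fst zm)) * exp (E (fst zm))) ->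
  Cmod (lprod A s z) <= Cmod (lprod B s z) * exp (zsum E s).
Proof.
  induction s as [|[a m] s IH]; intros H.
  - simpl. rewrite Cmod_1, exp_0. lra.
  - rewrite zsum_cons. simpl. rewrite !Cmod_mult, !Cmod_Cpow, exp_plus, exp_INR_mult.
    replace (Cmod (z - B a) ^ m * Cmod (lprod B s z) * (exp (E a) ^ m * exp (zsum E s)))
      with ((Cmod (z - B a) * exp (E a)) ^ m * (Cmod (lprod B s z) * exp (zsum E s)))
      by (rewrite Rpow_mult_distr; ring).
    apply Rmult_le_compat; try apply Cmod_ge_0; [apply pow_le, Cmod_ge_0| |].
    + apply pow_incr. split; [apply Cmod_ge_0|]. apply (H (a, m)). now left.
    + apply IH. intros. apply H. now right.
Qed.

(** * Zeros in a half-disc: one dyadic class *)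

Lemma exp_ge_1_plus (x : R) : 1 + x <= exp x.
Proof.
  destruct (Req_dec x 0) as [->|H]; [rewrite exp_0; lra|].
  left. now apply exp_ineq1.
Qed.

Lemma exp_monotone (x y : R) : x <= y -> exp x <= exp y.
Proof. intros [H | ->]; [left; now apply exp_increasing|apply Rle_refl]. Qed.

Lemma exp_monotone_inv (x y : R) : exp x <= exp y -> x <= y.
Proof.
  intros H. apply Rnot_lt_le. intros Hlt. apply exp_increasing in Hlt. lra.
Qed.

Lemma exp_half_le (x : R) : 0 <= x <= 1 -> exp (x / 2) <= 1 + x.
Proof.
  intros Hx. assert (H := exp_ge_1_plus (- (x / 2))). rewrite exp_Ropp in H.
  assert (Hp := exp_pos (x / 2)). set (y := exp (x / 2)) in *.
  assert (H1 : (1 - x / 2) * y <= 1).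
  { apply Rmult_le_reg_r with (/ y); [now apply Rinv_0_lt_compat|].
    rewrite Rmult_assoc, Rinv_r by lra. lra. }
  nra.
Qed.

(** In the coordinate [w = i exp z] the branch of [(- i w)^(-kappa)] is simply [exp (- kappa z)],
    with no cut to respect. *)
Lemma half_plane_polar (w : C) : 0 < Im w ->
  exists th, - (PI / 2) < th < PI / 2 /\ w = (Ci * Cexp (ln (Cmod w), th))%C.
Proof.
  intros Hw. set (t := Re w / Im w). exists (- atan t).
  assert (Hb := atan_bound t). split; [lra|].
  assert (Hm : 0 < Cmod w).
  { apply Rlt_le_trans with (1 := Hw). eapply Rle_trans; [apply Rle_abs|apply Cmod_Im]. }
  assert (Es : sqrt (1 + t²) = Cmod w / Im w).
  { apply sqrt_lem_1.
    - assert (h := Rle_0_sqr t). lra.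
    - left. now apply Rdiv_lt_0_compat.
    - assert (E := Cmod_sqr w). unfold t, Rsqr, Rdiv.
      replace (Cmod w * / Im w * (Cmod w * / Im w)) with (Cmod w ^ 2 * / Im w * / Im w) by ring.
      rewrite E. field. lra. }
  unfold Cexp, Cmult, Ci. simpl.
  rewrite cos_neg, sin_neg, cos_atan, sin_atan, Es, exp_ln by exact Hm.
  unfold t. destruct w as [x y]. unfold Re, Im in *. simpl in *.
  f_equal; field; lra.
Qed.

Lemma Im_ICexp (z : C) : Im (Ci * Cexp z) = exp (Re z) * cos (Im z).
Proof. unfold Cexp, Re, Im. simpl. ring. Qed.

Lemma Cmod_ICexp (z : C) : Cmod (Ci * Cexp z) = exp (Re z).
Proof. rewrite Cmod_mult, Cmod_Ci, Cmod_Cexp. ring. Qed.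

(** For [k < 1] the left side is positive; this keeps the real part of [(- i w)^(-k)] comparable to
    [|w|^(-k)] in the whole half-plane. *)
Lemma cos_mono_half (k th : R) : 0 <= k <= 1 -> Rabs th <= PI / 2 -> cos (k * PI / 2) <= cos (k * th).
Proof.
  intros Hk Hth. assert (HPI := PI_RGT_0).
  assert (E : cos (k * th) = cos (k * Rabs th)).
  { unfold Rabs. destruct (Rcase_abs th); [|reflexivity].
    replace (k * - th) with (- (k * th)) by ring. now rewrite cos_neg. }
  rewrite E. assert (h := Rabs_pos th).
  destruct (Rle_lt_or_eq_dec (k * Rabs th) (k * PI / 2)) as [Hlt|Heq].
  - unfold Rdiv. rewrite Rmult_assoc. apply Rmult_le_compat_l; lra.
  - left. apply cos_decreasing_1; nra.
  - rewrite Heq. lra.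
Qed.

Definition mirror (del : R) (a : C) : C := (Re a, 2 * del - Im a).

(* The Blaschke quotient of the half-plane [Im >= del] at [a]: squared, it is
   [1 + 4 (Im w - del) (Im a - del) / |w - a|^2]. *)
Lemma reflected_sqr (w a : C) (del : R) :
  Cmod (w - mirror del a) ^ 2 =
  Cmod (w - a) ^ 2 + 4 * (Im w - del) * (Im a - del).
Proof.
  rewrite !Cmod_sqr. destruct w as [x y], a as [u v]. unfold mirror, Re, Im. simpl. ring.
Qed.

Lemma le_mult_exp (x y e : R) : 0 <= y -> x ^ 2 <= y ^ 2 * (1 + 2 * e) -> x <= y * exp e.
Proof.
  intros Hy H. apply Rsqr_incr_0_var; [|apply Rmult_le_pos; [exact Hy|left; apply exp_pos]].
  unfold Rsqr. replace (y * exp e * (y * exp e)) with (y ^ 2 * (exp e * exp e)) by ring.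
  rewrite <- exp_plus. replace (x * x) with (x ^ 2) by ring.
  eapply Rle_trans; [exact H|]. apply Rmult_le_compat_l; [apply pow2_ge_0|].
  assert (h := exp_ge_1_plus (e + e)). lra.
Qed.

Lemma mult_exp_le (x y e : R) : 0 <= x -> 0 <= e <= / 4 ->
  x ^ 2 * (1 + 4 * e) <= y ^ 2 -> 0 <= y -> x * exp e <= y.
Proof.
  intros Hx He H Hy. apply Rsqr_incr_0_var; [|exact Hy].
  unfold Rsqr. replace (x * exp e * (x * exp e)) with (x ^ 2 * (exp e * exp e)) by ring.
  rewrite <- exp_plus. replace (y * y) with (y ^ 2) by ring.
  eapply Rle_trans; [|exact H]. apply Rmult_le_compat_l; [apply pow2_ge_0|].
  assert (h := exp_half_le (4 * e) ltac:(lra)).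
  replace (4 * e / 2) with (e + e) in h by field. lra.
Qed.

(** The correction needed on the two arcs is proportional to the unknown sum [S] itself. The
    argument closes because at [w0] the gain from reflecting the zeros, also linear in [S], has the
    larger coefficient. *)
Lemma half_disc_class_bound (kap : R) : 0 <= kap < 1 -> exists c, 0 < c /\
  forall (F : C -> C) (w0 : C) (del rho Kd K'' : R) (s : list (C * nat)),
  0 < del <= / 16 -> 0 < rho <= 1 -> 0 <= Kd -> 0 <= K'' ->
  (forall w, 0 < Im w -> Cmod w < 20 -> cdiff F w) ->
  (forall w, del <= Im w -> rho <= Cmod w <= 16 ->
     Cmod (F w) <= exp (Kd * exp (- kap * ln (Cmod w)))) ->
  1 <= Cmod w0 <= 2 -> Cmod w0 / 2 <= Im w0 -> exp (- K'') <= Cmod (F w0) ->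
  NoDup (map fst s) ->
  (forall zm, In zm s -> 2 * del <= Im (fst zm) /\ 9 * rho <= Cmod (fst zm) < / 8 /\
     divides_at F (fst zm) (snd zm)) ->
  zsum Im s <= c * (K'' + Kd).
Proof.
  intros Hkap.
  assert (HPI := PI_RGT_0).
  assert (Hcos : 0 < cos (kap * PI / 2)) by (apply cos_gt_0; nra).
  set (c0 := / cos (kap * PI / 2)).
  assert (Hc0 : 0 < c0) by (now apply Rinv_0_lt_compat).
  (* [1 / 40] is the net coefficient of [S] at [w0], and [1 + c0] covers both [K''] and
     [c0 * Kd]. *)
  exists (40 * (1 + c0)). split; [lra|].
  intros F w0 del rho Kd K'' s Hdel Hrho HKd HK HF HB Hw0 Hw0' HFw0 Hnd Hs.
  destruct (factor_zeros (fun w => 0 < Im w /\ Cmod w < 20) s F) as (G & HG & EF); trivial.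
  { intros w [h1 h2]. now apply HF. } { intros. now apply Hs. }
  set (S := zsum Im s).
  assert (HS : 0 <= S).
  { apply zsum_nonneg. intros zm Hin. destruct (Hs zm Hin) as [h _]. lra. }
  set (refl := mirror del).
  set (W := fun z : C => (Ci * Cexp z)%C).
  (* [T w * Im a] bounds the logarithmic cost of reflecting [a], as seen from an arc. On [|w| = 16]
     one has [|w - a|^2 >= 200], which accounts for the first term; on [|w| = rho] one has
     [|w - a| >= 8 rho], because [|a| >= 9 rho], which accounts for the second. *)
  set (T := fun w : C => Im w / 100 + Im w / (32 * Cmod w ^ 2)).
  (* A holomorphic function whose real part is minus the majorant of [log |F|] minus [S * T]; both
     terms of [T] are harmonic, being real parts of multiples of [i w] and [i / w]. *)
  set (mult := fun z : C => (RtoC (- (c0 * Kd)) * Cexp (RtoC (- kap) * z)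
      + Ci * RtoC (S / 100) * W z + Ci * RtoC (- (S / 32)) / W z)%C).
  set (h := fun z : C => (lprod refl s (W z) * G (W z) * Cexp (mult z))%C).
  assert (HW0 : forall z, W z <> 0).
  { intros z. apply Cmod_gt_0. unfold W. rewrite Cmod_ICexp. apply exp_pos. }
  assert (Hmult : forall z, Re (mult z) =
    - (c0 * Kd * (exp (- kap * Re z) * cos (kap * Im z))) - S * T (W z)).
  { intros z. assert (E := Cmod_ICexp z). fold (W z) in E.
    assert (Hp : 0 < Cmod (W z)) by (apply Cmod_gt_0, HW0).
    assert (E2 := Cmod_sqr (W z)).
    unfold mult, T. rewrite E2. assert (E3 : 0 < Re (W z) ^ 2 + Im (W z) ^ 2) by (rewrite <- E2; now apply pow_lt).
    set (w := W z) in *. clearbody w. destruct z as [x y], w as [u v].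
    unfold Cexp, Cdiv, Cinv, Cmult, Cplus, RtoC, Re, Im in *. simpl in *.
    rewrite !Rmult_0_l, !Rminus_0_r, !Rplus_0_r.
    replace (- kap * y) with (- (kap * y)) by ring. rewrite cos_neg.
    field. lra. }
  assert (Hcdiff : forall z, del <= Im (W z) -> Cmod (W z) <= 16 -> cdiff h z).
  { intros z h1 h2.
    assert (dW : forall y, cdiff W y).
    { intros y. apply cdiff_mult; [apply cdiff_const|apply cdiff_Cexp]. }
    unfold h. apply cdiff_mult; [apply cdiff_mult|].
    - apply (cdiff_comp (lprod refl s) W); [apply cdiff_lprod|apply dW].
    - apply (cdiff_comp G W); [apply HG; split; lra|apply dW].
    - apply (cdiff_comp Cexp mult); [apply cdiff_Cexp|]. unfold mult.
      apply cdiff_plus; [apply cdiff_plus|].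
      + apply cdiff_mult; [apply cdiff_const|].
        apply (cdiff_comp Cexp (fun z => RtoC (- kap) * z)%C); [apply cdiff_Cexp|].
        apply cdiff_mult; [apply cdiff_const|apply cdiff_id].
      + apply cdiff_mult; [apply cdiff_const|apply dW].
      + apply cdiff_div; [apply HW0|apply cdiff_const|apply dW]. }
  (* The first two constraints select one period of the exponential and make the domain bounded.
     They are never tight, since [cos] vanishes there while [Im w >= del]. *)
  set (L := (fun z : C => Re (RtoC (PI / 2) + Ci * z)%C) :: (fun z : C => Re (RtoC (PI / 2) + (- Ci) * z)%C)
        :: (fun z : C => Re (z + RtoC (- ln rho))%C) :: (fun z : C => Re (RtoC (ln 16) + - (1) * z)%C)
        :: (fun z : C => Re (Cexp z + RtoC (- del))%C) :: nil).
  assert (HX : forall z, (forall phi, In phi L -> 0 <= phi z) <->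
     (- (PI / 2) <= Im z <= PI / 2 /\ ln rho <= Re z <= ln 16 /\ del <= Im (W z))).
  { intros z. unfold W. rewrite Im_ICexp. destruct z as [x y]. unfold L. split.
    - intros H.
      assert (a1 := H _ (or_introl eq_refl)).
      assert (a2 := H _ (or_intror (or_introl eq_refl))).
      assert (a3 := H _ (or_intror (or_intror (or_introl eq_refl)))).
      assert (a4 := H _ (or_intror (or_intror (or_intror (or_introl eq_refl))))).
      assert (a5 := H _ (or_intror (or_intror (or_intror (or_intror (or_introl eq_refl)))))).
      unfold Re, Im in *. simpl in *. lra.
    - intros H phi Hin. unfold Re, Im in *. simpl in *.
      destruct Hin as [<-|[<-|[<-|[<-|[<-|[]]]]]]; simpl; lra. }
  assert (HXW : forall z, (forall phi, In phi L -> 0 <= phi z) ->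
     del <= Im (W z) /\ rho <= Cmod (W z) <= 16).
  { intros z Hz. apply HX in Hz. destruct Hz as (_ & [h1 h2] & h3).
    split; [exact h3|]. unfold W. rewrite Cmod_ICexp.
    rewrite <- (exp_ln rho) at 1 by lra. rewrite <- (exp_ln 16) by lra.
    split; apply exp_monotone; assumption. }
  assert (Hmax : forall z, (forall phi, In phi L -> 0 <= phi z) -> Cmod (h z) <= 1).
  { apply (maximum_modulus L h (PI / 2 + Rabs (ln rho) + Rabs (ln 16)) 1).
    - intros z Hz. apply HX in Hz. destruct Hz as (h1 & h2 & _).
      eapply Rle_trans; [apply Cmod_le_abs|].
      assert (Rabs (Im z) <= PI / 2) by (apply Rabs_le; lra).
      assert (Rabs (Re z) <= Rabs (ln rho) + Rabs (ln 16)).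
      { apply Rabs_le. assert (k1 := Rle_abs (ln 16)). assert (k2 := Rle_abs (- ln rho)).
        rewrite Rabs_Ropp in k2. assert (k3 := Rabs_pos (ln 16)). assert (k4 := Rabs_pos (ln rho)). lra. }
      lra.
    - intros phi Hin z. unfold L in Hin. cbn [In] in Hin.
      destruct Hin as [<-|[<-|[<-|[<-|[<-|[]]]]]]; apply rcont_Re; apply ccont_plus;
        try apply ccont_const; try (apply ccont_mult; [apply ccont_const|apply ccont_id]).
      + apply ccont_id.
      + apply cdiff_ccont, cdiff_Cexp.
    - intros z Hz. apply HXW in Hz. apply Hcdiff; apply Hz.
    - intros z Hz phi Hin Hphi. assert (Hz' := HXW z Hz). apply HX in Hz.
      destruct Hz' as [h1 h2]. destruct Hz as (h3 & h4 & _).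
      assert (Hbd : Im (W z) = del \/ Cmod (W z) = 16 \/ Cmod (W z) = rho).
      { unfold L in Hin. cbn [In] in Hin. unfold W in h1 |- *. rewrite Im_ICexp in h1 |- *.
        rewrite Cmod_ICexp.
        destruct z as [x y]. unfold Re, Im in *. simpl in h1, h3, h4 |- *.
        assert (Hc2 : cos y = 0 -> False) by (intros E; rewrite E in h1; lra).
        destruct Hin as [<-|[<-|[<-|[<-|[<-|[]]]]]]; simpl in Hphi.
        - exfalso. apply Hc2. replace y with (PI / 2) by lra. apply cos_PI2.
        - exfalso. apply Hc2. replace y with (- (PI / 2)) by lra. rewrite cos_neg. apply cos_PI2.
        - right. right. replace x with (ln rho) by lra. apply exp_ln. lra.
        - right. left. replace x with (ln 16) by lra. apply exp_ln. lra.
        - left. lra. }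
      set (w := W z) in *.
      assert (Hwp : 0 < Cmod w) by lra.
      assert (HTp : 0 <= T w).
      { unfold T. apply Rplus_le_le_0_compat; apply Rdiv_le_0_compat; try lra.
        apply Rmult_lt_0_compat; [lra|now apply pow_lt]. }
      assert (Hrefl : Cmod (lprod refl s w) <= Cmod (lprod (fun a => a) s w) * exp (zsum (fun a => T w * Im a) s)).
      { apply lprod_le. intros [a m] Hin'. cbn [fst snd]. destruct (Hs _ Hin') as (k1 & k2 & _). simpl in k1, k2.
        apply le_mult_exp; [apply Cmod_ge_0|]. unfold refl. rewrite reflected_sqr.
        assert (Ha := Cmod_triangle_inv w a).
        assert (Hb := Cmod_triangle_inv a w). rewrite Cmod_sub_sym in Hb.
        cut (4 * (Im w - del) * (Im a - del) <= Cmod (w - a) ^ 2 * (2 * (T w * Im a))); [lra|].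
        assert (Hia : 0 <= Im a) by lra.
        assert (Hprod : (Im w - del) * (Im a - del) <= Im w * Im a) by nra.
        destruct Hbd as [E|[E|E]].
        - rewrite E, Rminus_diag, Rmult_0_r, Rmult_0_l.
          apply Rmult_le_pos; [apply pow2_ge_0|]. assert (0 <= T w * Im a) by now apply Rmult_le_pos. lra.
        - assert (q1 : 200 <= Cmod (w - a) ^ 2) by (rewrite E in Ha; nra).
          assert (q2 : Im w / 100 <= T w).
          { unfold T. assert (0 <= Im w / (32 * Cmod w ^ 2)); [|lra].
            apply Rdiv_le_0_compat; [lra|]. apply Rmult_lt_0_compat; [lra|now apply pow_lt]. }
          assert (q3 : Im w / 100 * Im a <= T w * Im a) by now apply Rmult_le_compat_r.
          assert (q4 : 200 * (2 * (T w * Im a)) <= Cmod (w - a) ^ 2 * (2 * (T w * Im a))).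
          { apply Rmult_le_compat_r; [|exact q1]. assert (0 <= T w * Im a) by now apply Rmult_le_pos. lra. }
          lra.
        - assert (q1 : 64 * rho ^ 2 <= Cmod (w - a) ^ 2).
          { assert (8 * rho <= Cmod (w - a)) by lra. nra. }
          assert (q2 : Im w / (32 * rho ^ 2) <= T w).
          { unfold T. rewrite E. lra. }
          assert (Hr2 : 0 < rho ^ 2) by (apply pow_lt; lra).
          assert (q3 : Im w / (32 * rho ^ 2) * Im a <= T w * Im a) by now apply Rmult_le_compat_r.
          assert (q4 : 64 * rho ^ 2 * (2 * (T w * Im a)) <= Cmod (w - a) ^ 2 * (2 * (T w * Im a))).
          { apply Rmult_le_compat_r; [|exact q1]. assert (0 <= T w * Im a) by now apply Rmult_le_pos. lra. }
          assert (q5 : 64 * rho ^ 2 * (2 * (Im w / (32 * rho ^ 2) * Im a)) <= 64 * rho ^ 2 * (2 * (T w * Im a))).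
          { apply Rmult_le_compat_l; lra. }
          replace (64 * rho ^ 2 * (2 * (Im w / (32 * rho ^ 2) * Im a))) with (4 * (Im w * Im a)) in q5
            by (field; lra).
          lra. }
      rewrite zsum_scal in Hrefl. fold S in Hrefl.
      unfold h. fold w. rewrite !Cmod_mult, Cmod_Cexp, Hmult. fold w.
      assert (HFb := HB w h1 h2). rewrite EF, Cmod_mult in HFb.
      assert (Hexp : exp (- kap * ln (Cmod w)) = exp (- kap * Re z)).
      { unfold w, W. rewrite Cmod_ICexp, ln_exp. reflexivity. }
      rewrite Hexp in HFb.
      set (e0 := exp (- kap * Re z)) in *. assert (He0 : 0 < e0) by apply exp_pos.
      assert (Hcs : 1 <= c0 * cos (kap * Im z)).
      { apply Rmult_le_reg_l with (cos (kap * PI / 2)); [exact Hcos|].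
        unfold c0. rewrite <- Rmult_assoc, Rinv_r by lra. rewrite Rmult_1_r, Rmult_1_l.
        apply cos_mono_half; [lra|]. apply Rabs_le. lra. }
      apply Rle_trans with (Cmod (lprod (fun a : C => a) s w) * exp (T w * S) * Cmod (G w) *
           exp (- (c0 * Kd * (e0 * cos (kap * Im z))) - S * T w)).
      { apply Rmult_le_compat_r; [left; apply exp_pos|]. apply Rmult_le_compat_r; [apply Cmod_ge_0|exact Hrefl]. }
      replace (Cmod (lprod (fun a : C => a) s w) * exp (T w * S) * Cmod (G w) *
           exp (- (c0 * Kd * (e0 * cos (kap * Im z))) - S * T w))
        with (Cmod (lprod (fun a : C => a) s w) * Cmod (G w) * (exp (T w * S) *
           exp (- (c0 * Kd * (e0 * cos (kap * Im z))) - S * T w))) by ring.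
      rewrite <- exp_plus.
      apply Rle_trans with (exp (Kd * e0) * exp (T w * S + (- (c0 * Kd * (e0 * cos (kap * Im z))) - S * T w))).
      { apply Rmult_le_compat_r; [left; apply exp_pos|exact HFb]. }
      rewrite <- exp_plus, <- exp_0. apply exp_monotone.
      assert (0 <= Kd * e0) by (apply Rmult_le_pos; lra).
      assert (Kd * e0 * 1 <= Kd * e0 * (c0 * cos (kap * Im z))) by (apply Rmult_le_compat_l; assumption).
      lra. }
  assert (Hi0 : 0 < Im w0) by lra.
  destruct (half_plane_polar w0 Hi0) as (th & Hth & Ew0).
  set (z0 := (ln (Cmod w0), th)) in *. fold (W z0) in Ew0.
  assert (Hz0 : Cmod (h z0) <= 1).
  { apply Hmax. apply HX. rewrite <- Ew0. unfold z0. unfold Re, Im. simpl.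
    split; [lra|]. split.
    - split; apply ln_le; lra.
    - fold (Im w0). lra. }
  unfold h in Hz0. rewrite !Cmod_mult, Cmod_Cexp, Hmult, <- Ew0 in Hz0.
  set (q := Cmod w0) in *.
  (* The constant 3 comes from [|w0 - a| <= 9/8 q], [Im w0 - del >= 7/8 Im w0] and
     [Im a - del >= Im a / 2]: it suffices that [81/64 * 1/3 = 27/64] be at most [7/16 = 28/64]. *)
  assert (Hlow : Cmod (lprod (fun a => a) s w0) * exp (zsum (fun a => Im w0 / (3 * q ^ 2) * Im a) s)
                 <= Cmod (lprod refl s w0)).
  { assert (Hopp : Cmod (lprod (fun a => a) s w0) <= Cmod (lprod refl s w0) *
        exp (zsum (fun a => (- 1) * (Im w0 / (3 * q ^ 2) * Im a)) s)).
    { apply lprod_le. intros [a m] Hin'. cbn [fst snd]. destruct (Hs _ Hin') as (k1 & k2 & _). simpl in k1, k2.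
      set (e := Im w0 / (3 * q ^ 2) * Im a).
      replace (-1 * e) with (- e) by ring. rewrite exp_Ropp.
      apply Rmult_le_reg_r with (exp e); [apply exp_pos|].
      rewrite Rmult_assoc, Rinv_l, Rmult_1_r by (apply Rgt_not_eq, exp_pos).
      assert (Hia : Im a <= / 8).
      { left. eapply Rle_lt_trans; [apply Rle_abs|]. eapply Rle_lt_trans; [apply Cmod_Im|apply k2]. }
      assert (Hiq : Im w0 <= q) by (eapply Rle_trans; [apply Rle_abs|apply Cmod_Im]).
      assert (Hq2 : 1 <= q ^ 2) by nra.
      assert (He : e * (3 * q ^ 2) = Im w0 * Im a) by (unfold e; field; lra).
      assert (He0 : 0 <= e).
      { unfold e. apply Rmult_le_pos; [|lra]. apply Rdiv_le_0_compat; lra. }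
      apply mult_exp_le; try apply Cmod_ge_0.
      - split; [exact He0|]. assert (Im w0 * Im a <= q * (/ 8)) by (apply Rmult_le_compat; lra). nra.
      - unfold refl. rewrite reflected_sqr.
        assert (Ha : Cmod (w0 - a) <= 9 / 8 * q).
        { assert (Ht := Cmod_triangle w0 (- a)). rewrite Cmod_opp in Ht. fold q in Ht.
          replace (w0 + - a)%C with (w0 - a)%C in Ht by ring. lra. }
        assert (Ha0 := Cmod_ge_0 (w0 - a)).
        assert (Ha2 : Cmod (w0 - a) ^ 2 <= 81 / 64 * q ^ 2) by nra.
        assert (h1 : 7 / 8 * Im w0 <= Im w0 - del) by lra.
        assert (h2 : Im a / 2 <= Im a - del) by lra.
        assert (h3 : 7 / 8 * Im w0 * (Im a / 2) <= (Im w0 - del) * (Im a - del)).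
        { apply Rmult_le_compat; lra. }
        assert (h4 : Cmod (w0 - a) ^ 2 * e <= 81 / 64 * q ^ 2 * e) by (apply Rmult_le_compat_r; assumption).
        assert (h5 : 0 <= Im w0 * Im a) by (apply Rmult_le_pos; lra).
        lra. }
    rewrite zsum_scal in Hopp.
    replace (-1 * zsum (fun a : C => Im w0 / (3 * q ^ 2) * Im a) s)
      with (- zsum (fun a : C => Im w0 / (3 * q ^ 2) * Im a) s) in Hopp by ring.
    rewrite exp_Ropp in Hopp.
    apply Rmult_le_compat_r with (r := exp (zsum (fun a : C => Im w0 / (3 * q ^ 2) * Im a) s)) in Hopp;
      [|left; apply exp_pos].
    rewrite Rmult_assoc, Rinv_l, Rmult_1_r in Hopp by (apply Rgt_not_eq, exp_pos). exact Hopp. }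
  rewrite zsum_scal in Hlow. fold S in Hlow.
  rewrite EF, Cmod_mult in HFw0.
  set (e0 := exp (- kap * Re z0)) in *.
  assert (He0 : e0 <= 1).
  { unfold e0. rewrite <- exp_0. apply exp_monotone. unfold z0, Re. simpl.
    assert (0 <= ln q) by (rewrite <- ln_1; apply ln_le; lra). nra. }
  assert (He0p : 0 < e0) by apply exp_pos.
  assert (Hcs := COS_bound (kap * Im z0)). set (cs := cos (kap * Im z0)) in *.
  assert (Hfin : exp (- K'' + Im w0 / (3 * q ^ 2) * S + (- (c0 * Kd * (e0 * cs)) - S * T w0)) <= exp 0).
  { rewrite !exp_plus, exp_0. eapply Rle_trans; [|exact Hz0].
    apply Rmult_le_compat_r; [left; apply exp_pos|].
    apply Rle_trans with (Cmod (lprod (fun a => a) s w0) * Cmod (G w0) * exp (Im w0 / (3 * q ^ 2) * S)).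
    - apply Rmult_le_compat_r; [left; apply exp_pos|exact HFw0].
    - replace (Cmod (lprod (fun a => a) s w0) * Cmod (G w0) * exp (Im w0 / (3 * q ^ 2) * S))
        with (Cmod (lprod (fun a => a) s w0) * exp (Im w0 / (3 * q ^ 2) * S) * Cmod (G w0)) by ring.
      apply Rmult_le_compat_r; [apply Cmod_ge_0|exact Hlow]. }
  apply exp_monotone_inv in Hfin.
  assert (Hecs : c0 * Kd * (e0 * cs) <= c0 * Kd).
  { assert (0 <= c0 * Kd) by (apply Rmult_le_pos; lra).
    assert (e0 * cs <= 1) by nra. nra. }
  assert (Hq2 : 1 <= q ^ 2 <= 4) by nra.
  (* Gain minus cost at the reference point, where [Im w0 >= 1/2] and [q^2 <= 4]. *)
  assert (Hnet : / 40 <= Im w0 / (3 * q ^ 2) - T w0).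
  { unfold T. fold q. replace (Im w0 / (3 * q ^ 2) - (Im w0 / 100 + Im w0 / (32 * q ^ 2)))
      with (Im w0 * ((1 / 3 - 1 / 32) * / q ^ 2 - / 100)) by (field; lra).
    assert (/ 4 <= / q ^ 2) by (apply Rinv_le_contravar; lra).
    nra. }
  assert (/ 40 * S <= (Im w0 / (3 * q ^ 2) - T w0) * S) by (apply Rmult_le_compat_r; lra).
  assert (0 <= c0 * K'') by (apply Rmult_le_pos; lra).
  fold S. lra.
Qed.

(** * Zeros in a half-disc: summation over dyadic classes *)

Lemma NoDup_map_filter {A B : Type} (g : A -> B) (f : A -> bool) (s : list A) :
  NoDup (map g s) -> NoDup (map g (filter f s)).
Proof.
  induction s as [|x s IH]; simpl; intros H; [constructor|].
  inversion H as [|? ? Hn Hd]; subst. destruct (f x); [|now apply IH].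
  simpl. constructor; [|now apply IH]. intros Hin. apply Hn.
  apply in_map_iff in Hin. destruct Hin as (y & E & Hy). apply filter_In in Hy.
  rewrite <- E. now apply in_map.
Qed.

Lemma zsum_filter_split (w : C -> R) (f : C * nat -> bool) (s : list (C * nat)) :
  zsum w s = zsum w (filter f s) + zsum w (filter (fun x => negb (f x)) s).
Proof.
  induction s as [|[a m] s IH]; [simpl; ring|].
  cbn [filter]. destruct (f (a, m)); cbn [negb]; rewrite !zsum_cons, IH; ring.
Qed.

Lemma zsum_filter_le (w : C -> R) (f : C * nat -> bool) (s : list (C * nat)) :
  (forall zm, In zm s -> 0 <= w (fst zm)) -> zsum w (filter f s) <= zsum w s.
Proof.
  intros H. rewrite (zsum_filter_split w f s).
  assert (0 <= zsum w (filter (fun x => negb (f x)) s)); [|lra].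
  apply zsum_nonneg. intros zm Hin. apply filter_In in Hin. now apply H.
Qed.

Lemma filter_comm {A : Type} (f g : A -> bool) (s : list A) :
  filter f (filter g s) = filter g (filter f s).
Proof.
  induction s as [|x s IH]; [reflexivity|]. simpl.
  destruct (f x) eqn:Ef, (g x) eqn:Eg; simpl; rewrite ?Ef, ?Eg, IH; reflexivity.
Qed.

(** The classes need only cover [s]: each is removed before the others are summed, so overlaps are
    harmless, and a finite list meets finitely many of them. This permits dyadic classes closed at
    both ends. *)
Lemma zsum_geometric (w : C -> R) (cls : nat -> C * nat -> bool) (A r : R) (s : list (C * nat)) :
  0 <= A -> 0 <= r < 1 -> (forall zm, In zm s -> 0 <= w (fst zm)) ->
  (forall zm, In zm s -> exists k, cls k zm = true) ->
  (forall k, zsum w (filter (cls k) s) <= A * r ^ k) ->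
  zsum w s <= A / (1 - r).
Proof.
  intros HA Hr Hw Hcls Hk.
  assert (Hind : forall N s', (forall zm, In zm s' -> 0 <= w (fst zm)) ->
    (forall zm, In zm s' -> exists k, (k < N)%nat /\ cls k zm = true) ->
    (forall k, zsum w (filter (cls k) s') <= A * r ^ k) ->
    zsum w s' <= A * (1 - r ^ N) / (1 - r)).
  { induction N as [|N IH]; intros s' Hw' Hc' Hk'.
    - destruct s' as [|x s'].
      + simpl. right. field. lra.
      + destruct (Hc' x (or_introl eq_refl)) as (k & Hlt & _). lia.
    - rewrite (zsum_filter_split w (cls N) s').
      assert (H1 := Hk' N).
      assert (H2 : zsum w (filter (fun x => negb (cls N x)) s') <= A * (1 - r ^ N) / (1 - r)).
      { apply IH.
        - intros zm Hin. apply filter_In in Hin. now apply Hw'.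
        - intros zm Hin. apply filter_In in Hin. destruct Hin as [Hin Hneg].
          destruct (Hc' zm Hin) as (k & Hlt & E). exists k. split; [|exact E].
          assert (k <> N); [|lia]. intros ->. rewrite E in Hneg. discriminate.
        - intros k. rewrite filter_comm. eapply Rle_trans; [|apply (Hk' k)].
          apply zsum_filter_le. intros zm Hin. apply filter_In in Hin. now apply Hw'. }
      replace (A * (1 - r ^ S N) / (1 - r)) with (A * r ^ N + A * (1 - r ^ N) / (1 - r))
        by (simpl; field; lra).
      lra. }
  assert (HN : exists N, forall zm, In zm s -> exists k, (k < N)%nat /\ cls k zm = true).
  { clear Hw Hk Hind. induction s as [|x s IH].
    - exists 0%nat. intros zm [].
    - destruct IH as [N HN]. { intros. apply Hcls. now right. }
      destruct (Hcls x (or_introl eq_refl)) as [k Hk]. exists (Nat.max N (S k)).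
      intros zm [<-|Hin]; [exists k; split; [lia|exact Hk]|].
      destruct (HN zm Hin) as (j & Hj & E). exists j. split; [lia|exact E]. }
  destruct HN as [N HN]. eapply Rle_trans; [apply (Hind N s Hw HN Hk)|].
  apply Rmult_le_compat_r; [left; apply Rinv_0_lt_compat; lra|].
  assert (0 <= r ^ N) by (apply pow_le; lra). nra.
Qed.

Definition dyadic (k : nat) (x : R) : bool :=
  if Rle_dec ((/ 2) ^ S k) x then (if Rle_dec x ((/ 2) ^ k) then true else false) else false.

Lemma dyadic_spec (k : nat) (x : R) :
  dyadic k x = true <-> (/ 2) ^ S k <= x <= (/ 2) ^ k.
Proof.
  unfold dyadic. destruct (Rle_dec ((/ 2) ^ S k) x), (Rle_dec x ((/ 2) ^ k));
    split; intros H; try discriminate; try tauto.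
Qed.

Lemma dyadic_exists (x : R) : 0 < x <= 1 -> exists k, dyadic k x = true.
Proof.
  intros Hx. destruct (pow_lt_1_zero (/ 2)) with (y := x) as [N HN];
    [rewrite Rabs_pos_eq; lra|lra|].
  specialize (HN N (le_n N)). rewrite Rabs_pos_eq in HN by (apply pow_le; lra).
  assert (H : forall n, (/ 2) ^ n < x -> exists k, dyadic k x = true).
  { induction n as [|n IH]; intros Hn; [simpl in Hn; lra|].
    destruct (Rlt_dec ((/ 2) ^ n) x) as [Hlt|Hge]; [now apply IH|].
    exists n. apply dyadic_spec. split; lra. }
  now apply (H N).
Qed.

Lemma Rpower_pos (x y : R) : 0 < Rpower x y.
Proof. apply exp_pos. Qed.

Lemma Rpower_le_l (a x y : R) : 0 <= a -> 0 < x <= y -> Rpower x a <= Rpower y a.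
Proof. intros Ha [Hx Hxy]. now apply Rle_Rpower_l. Qed.

Lemma Rpower_le_1 (x a : R) : 0 < x <= 1 -> 0 <= a -> Rpower x a <= 1.
Proof.
  intros Hx Ha. replace 1 with (Rpower 1 a).
  - apply Rpower_le_l; lra.
  - unfold Rpower. now rewrite ln_1, Rmult_0_r, exp_0.
Qed.

Lemma Rpower_pow_l (x a : R) (k : nat) : 0 < x -> Rpower (x ^ k) a = Rpower x a ^ k.
Proof.
  intros Hx. rewrite <- (Rpower_pow k x) by exact Hx.
  rewrite <- (Rpower_pow k (Rpower x a)) by apply Rpower_pos.
  rewrite !Rpower_mult. f_equal. ring.
Qed.

Lemma posp_nonneg (x : R) : 0 <= posp x.
Proof. apply Rmax_r. Qed.

(** On a class [Im w ~ x], [|w| ~ y] the sum of [m Im w] is of order [x^(-p) y^(-t)]. The remaining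
    weight is at most a constant times [x^(p + eps/2) y^(t + eps/2)], using [Im w <= |w|] for half
    of [eps], so both sums are geometric with ratio [2^(-eps/2)]. *)
Lemma half_disc_zeros (p q eps : R) : 0 <= p -> 0 <= q -> 0 < eps < 1 ->
  exists c, 0 < c /\
  forall (F : C -> C) (w0 : C) (K K'' : R) (s : list (C * nat)),
  0 <= K -> 0 <= K'' ->
  (forall w, 0 < Im w -> Cmod w < 20 -> cdiff F w /\
     Cmod (F w) <= exp (K / (Rpower (Im w) p * Rpower (Cmod w) q))) ->
  1 <= Cmod w0 <= 2 -> Cmod w0 / 2 <= Im w0 -> exp (- K'') <= Cmod (F w0) ->
  NoDup (map fst s) ->
  (forall zm, In zm s -> 0 < Im (fst zm) /\ Cmod (fst zm) < / 8 /\
     divides_at F (fst zm) (snd zm)) ->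
  zsum (fun w => Rpower (Im w) (p + 1 + eps) * Rpower (Cmod w) (posp (q - 1 + eps))) s
    <= c * (K + K'').
Proof.
  intros Hp Hq Heps.
  set (t := posp (q - 1 + eps)). assert (Ht : 0 <= t) by apply posp_nonneg.
  (* This is [q] when [t = 0], hence at most [1 - eps], and [1 - eps] otherwise. *)
  set (kap := q - t).
  assert (Hkap : 0 <= kap < 1).
  { unfold kap, t, posp, Rmax. destruct (Rle_dec (q - 1 + eps) 0); lra. }
  destruct (half_disc_class_bound kap Hkap) as (c & Hc & HA).
  set (r := Rpower (/ 2) (eps / 2)).
  assert (Hr : 0 <= r < 1).
  { split; [left; apply Rpower_pos|]. unfold r, Rpower. rewrite <- exp_0. apply exp_increasing.
    rewrite ln_Rinv by lra. assert (h := ln_lt_2). nra. }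
  (* 4 and 18 are the ratios of the upper ends [x / 4] and [y] of a class to the cuts [x / 16] and
     [y / 18] made for it. *)
  set (D := Rpower 4 p * Rpower 18 t).
  assert (HD : 0 < D) by (apply Rmult_lt_0_compat; apply Rpower_pos).
  exists (c * D / (1 - r) / (1 - r)). split.
  { apply Rdiv_lt_0_compat; [|lra]. apply Rdiv_lt_0_compat; [|lra]. now apply Rmult_lt_0_compat. }
  intros F w0 K K'' s HK HK'' HF Hw0 Hw0' HFw0 Hnd Hs.
  set (w := fun w => Rpower (Im w) (p + 1 + eps) * Rpower (Cmod w) t).
  assert (Hw : forall z, 0 <= w z).
  { intros z. left. apply Rmult_lt_0_compat; apply Rpower_pos. }
  set (A := c * D * (K + K'')).
  assert (HA0 : 0 <= A).
  { unfold A. apply Rmult_le_pos; [|lra]. left. now apply Rmult_lt_0_compat. }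
  replace (c * D / (1 - r) / (1 - r) * (K + K'')) with (A / (1 - r) / (1 - r))
    by (unfold A; field; lra).
  assert (Hin : forall zm, In zm s -> 0 < 4 * Im (fst zm) <= 1 /\ 0 < Cmod (fst zm) <= 1).
  { intros zm Hzm. destruct (Hs zm Hzm) as (h1 & h2 & _).
    assert (h3 := Rle_trans _ _ _ (Rle_abs _) (Cmod_Im (fst zm))). lra. }
  apply (zsum_geometric w (fun k zm => dyadic k (4 * Im (fst zm)))); trivial.
  { apply Rdiv_le_0_compat; lra. }
  { intros zm Hzm. apply dyadic_exists. now apply Hin. }
  intros k. replace (A / (1 - r) * r ^ k) with (A * r ^ k / (1 - r)) by (field; lra).
  apply (zsum_geometric w (fun j zm => dyadic j (Cmod (fst zm)))); trivial.
  { apply Rmult_le_pos; [exact HA0|]. apply pow_le. lra. }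
  { intros zm Hzm. apply filter_In in Hzm. apply dyadic_exists. now apply Hin. }
  intros j.
  set (s' := filter _ (filter _ s)).
  assert (Hs' : forall zm, In zm s' -> In zm s /\
     (/ 2) ^ S k <= 4 * Im (fst zm) <= (/ 2) ^ k /\ (/ 2) ^ S j <= Cmod (fst zm) <= (/ 2) ^ j).
  { intros zm Hzm. unfold s' in Hzm. apply filter_In in Hzm. destruct Hzm as [Hzm h1].
    apply filter_In in Hzm. destruct Hzm as [Hzm h2].
    rewrite dyadic_spec in h1, h2. now repeat split. }
  assert (Hnd' : NoDup (map fst s')) by (unfold s'; now repeat apply NoDup_map_filter).
  assert (Hk1 : 0 < (/ 2) ^ k <= 1).
  { split; [apply pow_lt; lra|]. rewrite <- (pow1 k). apply pow_incr. lra. }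
  assert (Hj1 : 0 < (/ 2) ^ j <= 1).
  { split; [apply pow_lt; lra|]. rewrite <- (pow1 j). apply pow_incr. lra. }
  simpl in Hs'.
  set (x := (/ 2) ^ k) in *. set (y := (/ 2) ^ j) in *.
  (* In this class [Im >= x / 8], twice the cut [del = x / 16], and [|w| >= y / 2], nine times
     [rho = y / 18]. Taking the classes in [4 * Im] keeps [del] below [1/16]. *)
  set (Kd := K / (Rpower (x / 16) p * Rpower (y / 18) t)).
  assert (Pp := Rpower_pos (x / 16) p). assert (Pt := Rpower_pos (y / 18) t).
  assert (HKd : 0 <= Kd) by (apply Rdiv_le_0_compat; [exact HK|now apply Rmult_lt_0_compat]).
  assert (HImS : zsum Im s' <= c * (K'' + Kd)).
  { apply (HA F w0 (x / 16) (y / 18) Kd K'' s'); trivial; try lra.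
    - intros z h1 h2. now apply HF.
    - intros z h1 h2. eapply Rle_trans; [apply HF; lra|]. apply exp_monotone.
      unfold Kd, Rdiv. rewrite Rmult_assoc. apply Rmult_le_compat_l; [exact HK|].
      replace q with (t + kap) by (unfold kap; ring).
      rewrite Rpower_plus. fold (Rpower (Cmod z) (- kap)). rewrite Rpower_Ropp.
      assert (P1 := Rpower_pos (Cmod z) kap).
      assert (P2 : Rpower (x / 16) p <= Rpower (Im z) p) by (apply Rpower_le_l; lra).
      assert (P3 : Rpower (y / 18) t <= Rpower (Cmod z) t) by (apply Rpower_le_l; lra).
      rewrite <- Rinv_mult.
      apply Rinv_le_contravar.
      + apply Rmult_lt_0_compat; [now apply Rmult_lt_0_compat|exact P1].
      + rewrite <- Rmult_assoc. apply Rmult_le_compat_r; [lra|].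
        apply Rmult_le_compat; lra.
    - intros zm Hzm. destruct (Hs' zm Hzm) as (h1 & h2 & h3). destruct (Hs zm h1) as (h4 & h5 & h6).
      repeat split; trivial; lra. }
  set (B := Rpower (x / 4) (p + eps / 2) * Rpower y (t + eps / 2)).
  assert (HB : 0 < B) by (apply Rmult_lt_0_compat; apply Rpower_pos).
  apply Rle_trans with (zsum (fun z => B * Im z) s').
  { apply zsum_le. intros zm Hzm. destruct (Hs' zm Hzm) as (h1 & h2 & h3).
    destruct (Hs zm h1) as (h4 & h5 & _). unfold w, B. set (z := fst zm) in *.
    assert (h6 := Rle_trans _ _ _ (Rle_abs _) (Cmod_Im z)).
    replace (p + 1 + eps) with (1 + ((p + eps / 2) + eps / 2)) by field.
    rewrite Rpower_plus, Rpower_1, Rpower_plus, (Rpower_plus t) by exact h4.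
    assert (k1 : Rpower (Im z) (p + eps / 2) <= Rpower (x / 4) (p + eps / 2)) by (apply Rpower_le_l; lra).
    assert (k2 : Rpower (Im z) (eps / 2) <= Rpower y (eps / 2)) by (apply Rpower_le_l; lra).
    assert (k3 : Rpower (Cmod z) t <= Rpower y t) by (apply Rpower_le_l; lra).
    assert (n1 := Rpower_pos (Im z) (p + eps / 2)). assert (n2 := Rpower_pos (Im z) (eps / 2)).
    assert (n3 := Rpower_pos (Cmod z) t).
    rewrite (Rmult_comm _ (Im z)). rewrite (Rmult_assoc (Im z)). apply Rmult_le_compat_l; [lra|].
    rewrite (Rmult_assoc (Rpower (Im z) (p + eps / 2))).
    apply Rmult_le_compat; trivial; try lra.
    - left. now apply Rmult_lt_0_compat.
    - rewrite (Rmult_comm (Rpower y t)). apply Rmult_le_compat; lra. }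
  rewrite zsum_scal.
  assert (Hq1 : Rpower (x / 16) p <= 1) by (apply Rpower_le_1; lra).
  assert (Hq2 : Rpower (y / 18) t <= 1) by (apply Rpower_le_1; lra).
  assert (HKK : K'' + Kd <= (K + K'') / (Rpower (x / 16) p * Rpower (y / 18) t)).
  { unfold Kd. replace ((K + K'') / (Rpower (x / 16) p * Rpower (y / 18) t)) with
      (K'' / (Rpower (x / 16) p * Rpower (y / 18) t) + K / (Rpower (x / 16) p * Rpower (y / 18) t))
      by (field; split; lra).
    apply Rplus_le_compat_r. rewrite <- (Rmult_1_r K'') at 1. apply Rmult_le_compat_l; [exact HK''|].
    rewrite <- Rinv_1. apply Rinv_le_contravar; [now apply Rmult_lt_0_compat|].
    rewrite <- (Rmult_1_r 1). apply Rmult_le_compat; lra. }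
  apply Rle_trans with (B * (c * ((K + K'') / (Rpower (x / 16) p * Rpower (y / 18) t)))).
  { apply Rmult_le_compat_l; [lra|]. eapply Rle_trans; [exact HImS|].
    apply Rmult_le_compat_l; lra. }
  assert (E1 : Rpower (x / 4) p = Rpower 4 p * Rpower (x / 16) p).
  { rewrite Rpower_mult_distr by lra. f_equal. field. }
  assert (E2 : Rpower y t = Rpower 18 t * Rpower (y / 18) t).
  { rewrite Rpower_mult_distr by lra. f_equal. field. }
  assert (E3 : Rpower (x / 4) (eps / 2) <= r ^ k).
  { unfold r. rewrite <- Rpower_pow_l by lra. apply Rpower_le_l; fold x; lra. }
  assert (E4 : Rpower y (eps / 2) = r ^ j) by (unfold y; rewrite Rpower_pow_l by lra; reflexivity).
  unfold B. rewrite !Rpower_plus, E1, E2, E4.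
  replace (Rpower 4 p * Rpower (x / 16) p * Rpower (x / 4) (eps / 2) *
     (Rpower 18 t * Rpower (y / 18) t * r ^ j) *
     (c * ((K + K'') / (Rpower (x / 16) p * Rpower (y / 18) t))))
    with (A * r ^ j * Rpower (x / 4) (eps / 2)) by (unfold A, D; field; split; lra).
  rewrite (Rmult_assoc A (r ^ k)), (Rmult_comm (r ^ k)), <- Rmult_assoc.
  apply Rmult_le_compat_l; [|exact E3]. apply Rmult_le_pos; [exact HA0|]. apply pow_le; lra.
Qed.

(** * Bands, and lower bounds away from them *)

Lemma Re_Poisson (u v : C) : (u - v)%C <> 0 ->
  Re ((u + v) / (u - v))%C = (Cmod u ^ 2 - Cmod v ^ 2) / Cmod (u - v) ^ 2.
Proof.
  intros H. assert (Hp : 0 < Cmod (u - v) ^ 2) by (apply pow_lt; now apply Cmod_gt_0).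
  rewrite !Cmod_sqr in *. destruct u as [a b], v as [x y].
  unfold Cdiv, Cinv, Cmult, Re, Im in *. simpl in *. field. lra.
Qed.

(* If [|F| < exp (- M)] near [c], multiplying [F] by the exponential of a multiple of the
   Poisson kernel with pole [c] would push [F z0] below [exp (- K'')]. *)
Lemma lower_bound_propagates (F : C -> C) (z0 c : C) (rho K' K'' : R) :
  0 < rho <= Cmod (c - z0) -> 0 <= K' -> 0 < K' + K'' ->
  (forall z, Cmod (z - z0) <= Cmod (c - z0) -> cdiff F z /\ Cmod (F z) <= exp K') ->
  exp (- K'') <= Cmod (F z0) ->
  exists z, Cmod (z - z0) <= Cmod (c - z0) /\ Cmod (z - c) <= rho /\
    exp (- (4 * Cmod (c - z0) / rho * (K' + K''))) <= Cmod (F z).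
Proof.
  intros Hrho HK' HKK HF HF0. set (r := Cmod (c - z0)) in *.
  set (M := 4 * r / rho * (K' + K'')).
  assert (Hr : 0 < r) by lra.
  assert (HM : 0 < M) by (apply Rmult_lt_0_compat; [apply Rdiv_lt_0_compat; lra|exact HKK]).
  apply NNPP. intros Hno.
  assert (Hsmall : forall z, Cmod (z - z0) <= r -> Cmod (z - c) <= rho -> Cmod (F z) <= exp (- M)).
  { intros z h1 h2. left. apply Rnot_le_lt. intros h3. apply Hno. now exists z. }
  (* On [|z - c| = rho] the Poisson kernel is at most [2 r / rho], so [k] times it is at most [M].
     At [z0] the kernel is 1, and [k = 2 (K' + K'')] exceeds the [K' + K''] that the maximum
     principle allows. *)
  set (k := M * rho / (2 * r)).
  assert (Hk : 0 < k).
  { apply Rdiv_lt_0_compat; [apply Rmult_lt_0_compat|]; lra. }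
  set (P := fun z : C => (((c - z0) + (z - z0)) / ((c - z0) - (z - z0)))%C).
  set (h := fun z => (F z * Cexp (RtoC k * P z))%C).
  assert (Hden : forall z, ((c - z0) - (z - z0))%C = (c - z)%C) by (intros; ring).
  assert (HP : forall z, rho <= Cmod (z - c) -> ((c - z0) - (z - z0))%C <> 0).
  { intros z Hz. rewrite Hden. apply Cmod_gt_0. rewrite Cmod_sub_sym. lra. }
  assert (Hmodh : forall z, rho <= Cmod (z - c) ->
     Cmod (h z) = Cmod (F z) * exp (k * ((r ^ 2 - Cmod (z - z0) ^ 2) / Cmod (z - c) ^ 2))).
  { intros z Hz. unfold h. rewrite Cmod_mult, Cmod_Cexp. do 2 f_equal.
    assert (EP := Re_Poisson _ _ (HP z Hz)). fold r in EP.
    rewrite (Cmod_sub_sym z c), <- (Hden z), <- EP.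
    unfold P. set (t := (_ / _)%C). unfold Re. simpl. ring. }
  set (L := (fun z : C => r - Cmod (z - z0)) :: (fun z : C => Cmod (z - c) - rho) :: nil).
  assert (HX : forall z, (forall phi, In phi L -> 0 <= phi z) <->
      (Cmod (z - z0) <= r /\ rho <= Cmod (z - c))).
  { intros z. unfold L. split.
    - intros H. assert (a1 := H _ (or_introl eq_refl)).
      assert (a2 := H _ (or_intror (or_introl eq_refl))). simpl in a1, a2. lra.
    - intros H phi Hin. cbn [In] in Hin. destruct Hin as [<-|[<-|[]]]; lra. }
  assert (Hmax : Cmod (h z0) <= exp K').
  { apply (maximum_modulus L h (Cmod z0 + r)).
    - intros z Hz. apply HX in Hz. assert (t := Cmod_triangle_inv z z0). lra.
    - intros phi Hin z. unfold L in Hin. cbn [In] in Hin.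
      destruct Hin as [<-|[<-|[]]]; apply rcont_minus; try apply rcont_const;
        apply rcont_Cmod, cdiff_ccont, cdiff_minus; solve [apply cdiff_id | apply cdiff_const].
    - intros z Hz. apply HX in Hz. destruct Hz as [h1 h2]. unfold h. apply cdiff_mult.
      + now apply HF.
      + apply (cdiff_comp Cexp (fun z => RtoC k * P z)%C); [apply cdiff_Cexp|].
        apply cdiff_mult; [apply cdiff_const|]. unfold P.
        assert (Hd : cdiff (fun z => z - z0)%C z)
          by (apply cdiff_minus; [apply cdiff_id|apply cdiff_const]).
        apply (cdiff_div (fun z => (c - z0) + (z - z0))%C (fun z => (c - z0) - (z - z0))%C);
          [now apply HP|apply cdiff_plus|apply cdiff_minus]; trivial; apply cdiff_const.
    - intros z Hz phi Hin Hphi. apply HX in Hz. destruct Hz as [h1 h2].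
      rewrite Hmodh by exact h2. unfold L in Hin. cbn [In] in Hin.
      destruct Hin as [<-|[<-|[]]].
      + replace (Cmod (z - z0)) with r by lra. rewrite Rminus_diag. unfold Rdiv.
        rewrite Rmult_0_l, Rmult_0_r, exp_0, Rmult_1_r. now apply HF.
      + assert (E : Cmod (z - c) = rho) by lra.
        assert (Ht : r - Cmod (z - z0) <= rho).
        { assert (t := Cmod_sub_triangle c z z0). fold r in t. rewrite (Cmod_sub_sym c z) in t. lra. }
        assert (Hz0 := Cmod_ge_0 (z - z0)). set (d := Cmod (z - z0)) in *.
        assert (Hfz : Cmod (F z) <= exp (- M)) by (apply Hsmall; [exact h1|lra]).
        apply Rle_trans with (exp (- M) * exp M).
        * apply Rmult_le_compat; trivial; [apply Cmod_ge_0|left; apply exp_pos|].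
          apply exp_monotone. rewrite E.
          assert (Hq : (r ^ 2 - d ^ 2) / rho ^ 2 <= 2 * r / rho).
          { apply Rmult_le_reg_r with (rho ^ 2); [apply pow_lt; lra|].
            replace ((r ^ 2 - d ^ 2) / rho ^ 2 * rho ^ 2) with ((r - d) * (r + d)) by (field; lra).
            replace (2 * r / rho * rho ^ 2) with (rho * (2 * r)) by (field; lra).
            apply Rmult_le_compat; lra. }
          apply Rle_trans with (k * (2 * r / rho)).
          { apply Rmult_le_compat_l; lra. }
          right. unfold k. field. lra.
        * rewrite <- exp_plus, Rplus_opp_l. now apply exp_monotone.
    - apply HX. rewrite Cmod_sub_diag, Cmod_sub_sym. fold r. lra. }
  rewrite Hmodh in Hmax by (rewrite Cmod_sub_sym; fold r; lra).
  rewrite Cmod_sub_diag, (Cmod_sub_sym z0 c) in Hmax. fold r in Hmax.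
  replace ((r ^ 2 - 0 ^ 2) / r ^ 2) with 1 in Hmax by (field; lra).
  assert (H : exp (- K'' + k * 1) <= exp K').
  { rewrite exp_plus. eapply Rle_trans; [|exact Hmax].
    apply Rmult_le_compat_r; [left; apply exp_pos|exact HF0]. }
  apply exp_monotone_inv in H.
  assert (Ek : k = 2 * (K' + K'')) by (unfold k, M; field; lra). lra.
Qed.

(** A point of [M] makes the infimum finite; for an empty set [real] would return the default 0. *)
Lemma dist_set_glb (lam : C) (M : C -> Prop) (z : C) : M z ->
  is_glb_Rbar (fun r => exists z, M z /\ r = Cmod (lam - z)) (dist_set lam M).
Proof.
  intros Hz. unfold dist_set. set (E := fun r => _).
  assert (H := Glb_Rbar_correct E). destruct H as [H1 H2].
  assert (h1 : Rbar_le (Glb_Rbar E) (Cmod (lam - z))) by (apply H1; now exists z).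
  assert (h2 : Rbar_le 0 (Glb_Rbar E)).
  { apply H2. intros x (w & _ & ->). simpl. apply Cmod_ge_0. }
  destruct (Glb_Rbar E) as [l| |]; simpl in *; try contradiction. now split.
Qed.

Lemma dist_set_le (lam : C) (M : C -> Prop) (z : C) : M z -> dist_set lam M <= Cmod (lam - z).
Proof.
  intros Hz. destruct (dist_set_glb lam M z Hz) as [H _].
  apply (H (Cmod (lam - z))). now exists z.
Qed.

Lemma dist_set_ge (lam : C) (M : C -> Prop) (d : R) :
  (exists z, M z) -> (forall z, M z -> d <= Cmod (lam - z)) -> d <= dist_set lam M.
Proof.
  intros [z Hz] Hd. destruct (dist_set_glb lam M z Hz) as [_ H].
  apply (H (Finite d)). intros x (w & Hw & ->). simpl. now apply Hd.
Qed.

Section Bands.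

Variables (n : nat) (alpha beta : nat -> R).
Hypothesis Hadm : admissible n alpha beta.

Definition dist_bands (z : C) : R := dist_set z (frak_e n alpha beta).
Definition dist_ends (z : C) : R := dist_set z (endpoints n alpha beta).

Lemma alpha_lt_beta (j : nat) : (j <= n)%nat -> alpha j < beta j.
Proof. intros. now apply Hadm. Qed.

Lemma bands_ordered (i j : nat) : (i < j)%nat -> (j <= n)%nat -> beta i < alpha j.
Proof.
  intros Hij. induction Hij as [|j Hij IH]; intros Hj.
  - now apply Hadm.
  - specialize (IH ltac:(lia)). destruct Hadm as [H1 H2].
    specialize (H1 j ltac:(lia)). specialize (H2 j ltac:(lia)). lra.
Qed.

Lemma endpoint_in_band (z : C) : endpoints n alpha beta z -> frak_e n alpha beta z.
Proof.
  intros (j & Hj & [-> | ->]); split; trivial; exists j; simpl;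
    assert (h := alpha_lt_beta j Hj); repeat split; trivial; lra.
Qed.

Lemma endpoints_nonempty : exists z, endpoints n alpha beta z.
Proof. exists (RtoC (alpha 0%nat)), 0%nat. split; [lia|now left]. Qed.

Lemma bands_nonempty : exists z, frak_e n alpha beta z.
Proof. destruct endpoints_nonempty as [z Hz]. exists z. now apply endpoint_in_band. Qed.

Lemma dist_bands_ge (z : C) (d : R) : (forall w, frak_e n alpha beta w -> d <= Cmod (z - w)) -> d <= dist_bands z.
Proof. apply dist_set_ge, bands_nonempty. Qed.

Lemma dist_ends_ge (z : C) (d : R) : (forall w, endpoints n alpha beta w -> d <= Cmod (z - w)) -> d <= dist_ends z.
Proof. apply dist_set_ge, endpoints_nonempty. Qed.

Lemma dist_bands_le_dist_ends (z : C) : dist_bands z <= dist_ends z.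
Proof.
  apply dist_ends_ge. intros w Hw. apply dist_set_le. now apply endpoint_in_band.
Qed.

Lemma dist_bands_ge_Im (z : C) : Rabs (Im z) <= dist_bands z.
Proof.
  apply dist_bands_ge. intros w [Hw _]. eapply Rle_trans; [|apply Cmod_Im].
  right. f_equal. destruct z, w. simpl in *. subst. ring.
Qed.

Lemma bands_bounded : exists R0, 0 < R0 /\ forall z, frak_e n alpha beta z -> Cmod z <= R0.
Proof.
  assert (H : forall N, exists R0, 0 < R0 /\ forall j x, (j <= N)%nat ->
     alpha j <= x <= beta j -> Rabs x <= R0).
  { induction N as [|N (R0 & HR0 & IH)].
    - exists (1 + Rabs (alpha 0%nat) + Rabs (beta 0%nat)).
      assert (h1 := Rabs_pos (alpha 0%nat)). assert (h2 := Rabs_pos (beta 0%nat)).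
      split; [lra|]. intros j x Hj Hx. replace j with 0%nat in Hx by lia.
      assert (h3 := Rle_abs (beta 0%nat)). assert (h4 := Rle_abs (- alpha 0%nat)).
      rewrite Rabs_Ropp in h4. apply Rabs_le. lra.
    - set (a := alpha (S N)) in *. set (b := beta (S N)) in *.
      exists (R0 + Rabs a + Rabs b).
      assert (h1 := Rabs_pos a). assert (h2 := Rabs_pos b).
      split; [lra|]. intros j x Hj Hx.
      destruct (Nat.eq_dec j (S N)) as [->|Hne].
      + fold a b in Hx. assert (h3 := Rle_abs b). assert (h4 := Rle_abs (- a)).
        rewrite Rabs_Ropp in h4. apply Rabs_le. lra.
      + assert (h := IH j x ltac:(lia) Hx). lra. }
  destruct (H n) as (R0 & HR0 & HR). exists R0. split; [exact HR0|].
  intros [x y] [Hy (j & Hj & Hx)]. simpl in *. subst y.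
  change (Cmod (RtoC x) <= R0). rewrite Cmod_R. now apply (HR j).
Qed.

(** The predicate [P] serves two cases: all bands, for a real point in a gap, and all bands but one,
    for a point of that band. *)
Lemma bands_separated (x : R) (P : nat -> Prop) :
  (forall j, (j <= n)%nat -> P j -> ~ alpha j <= x <= beta j) ->
  exists d, 0 < d /\ forall j y, (j <= n)%nat -> P j -> alpha j <= y <= beta j -> d <= Rabs (x - y).
Proof.
  intros HP.
  assert (H : forall N, (N <= n)%nat -> exists d, 0 < d /\ forall j y, (j <= N)%nat -> P j ->
     alpha j <= y <= beta j -> d <= Rabs (x - y)).
  { assert (H1 : forall j, (j <= n)%nat -> exists d, 0 < d /\ forall y, P j ->
       alpha j <= y <= beta j -> d <= Rabs (x - y)).
    { intros j Hj. destruct (classic (P j)) as [Hp|Hp].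
      2:{ exists 1. split; [lra|]. intros; contradiction. }
      assert (H := HP j Hj Hp). destruct (Rlt_dec x (alpha j)) as [Hlt|Hge].
      - exists (alpha j - x). split; [lra|]. intros y _ Hy. rewrite Rabs_minus_sym.
        eapply Rle_trans; [|apply Rle_abs]. lra.
      - exists (x - beta j). split; [lra|]. intros y _ Hy.
        eapply Rle_trans; [|apply Rle_abs]. lra. }
    induction N as [|N IH]; intros HN.
    - destruct (H1 0%nat HN) as (d & Hd & H). exists d. split; [exact Hd|].
      intros j y Hj. replace j with 0%nat by lia. apply H.
    - destruct (H1 (S N) HN) as (d & Hd & H). destruct (IH ltac:(lia)) as (d' & Hd' & H').
      exists (Rmin d d'). split; [now apply Rmin_pos|]. intros j y Hj Hp Hy.
      destruct (Nat.eq_dec j (S N)) as [->|Hne].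
      + eapply Rle_trans; [apply Rmin_l|now apply H].
      + eapply Rle_trans; [apply Rmin_r|apply (H' j); trivial; lia]. }
  now apply H.
Qed.

Lemma dist_bands_pos (z : C) : ~ frak_e n alpha beta z -> 0 < dist_bands z.
Proof.
  intros Hz. destruct (Req_dec (Im z) 0) as [E|E].
  - destruct (bands_separated (Re z) (fun _ => True)) as (d & Hd & H).
    { intros j Hj _ Hx. apply Hz. split; [exact E|]. now exists j. }
    apply Rlt_le_trans with (1 := Hd). apply dist_bands_ge. intros w [Hw (j & Hj & Hx)].
    eapply Rle_trans; [apply (H j (Re w) Hj I Hx)|].
    eapply Rle_trans; [|apply re_le_Cmod]. apply Rle_refl.
  - eapply Rlt_le_trans; [|apply dist_bands_ge_Im]. now apply Rabs_pos_lt.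
Qed.

Lemma off_axis (z : C) : Im z <> 0 -> ~ frak_e n alpha beta z.
Proof. intros H [H' _]. contradiction. Qed.

Variables (p q : R).
Hypothesis Hp : 0 <= p.
Hypothesis Hq : 0 <= q.

Definition finf_ext (f : C -> C) (finf : C) (w : C) : C :=
  if Ceq_dec w 0 then finf else f (/ w)%C.

(** The hypotheses on [f] in working form. Bounding [|f|] instead of its logarithm avoids a special
    case at the zeros. *)
Definition tame (f : C -> C) (finf : C) (K : R) : Prop :=
  0 < K /\
  (forall z, ~ frak_e n alpha beta z -> cdiff f z) /\
  cdiff (finf_ext f finf) 0 /\ Cmod finf = 1 /\
  (forall z, ~ frak_e n alpha beta z ->
     Cmod (f z) <= exp (K / (Rpower (dist_bands z) p * Rpower (dist_ends z) q))).

Lemma tame_intro (f : C -> C) (finf : C) (K : R) :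
  0 < K ->
  (forall z, ~ frak_e n alpha beta z -> @ex_derive C_AbsRing C_NormedModule f z) ->
  analytic_at_infty f finf -> Cmod finf = 1 ->
  (forall lam, ~ frak_e n alpha beta lam ->
     ln (Cmod (f lam)) <= K / (Rpower (dist_bands lam) p * Rpower (dist_ends lam) q)) ->
  tame f finf K.
Proof.
  intros HK Hf (g & r & Hr & Hg0 & Hg & Hgf) Hfi Hln. split; [exact HK|]. split.
  { intros z Hz. now apply cdiff_of_ex_derive, Hf. }
  split; [|split; [exact Hfi|]].
  - apply (cdiff_ext_loc g _ 0 r Hr).
    + intros w Hw. unfold finf_ext. destruct (Ceq_dec w 0) as [->|E]; [exact Hg0|].
      apply Hgf. replace (w - 0)%C with w in Hw by ring. split; [now apply Cmod_gt_0|exact Hw].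
    + apply cdiff_of_ex_derive, Hg. rewrite Cmod_0. exact Hr.
  (* At a zero [ln 0] is the default 0 and says nothing, but the exponential bound is then
     trivial. *)
  - intros z Hz. destruct (Cmod_ge_0 (f z)) as [Hpos|E].
    + rewrite <- (exp_ln (Cmod (f z))) by exact Hpos. apply exp_monotone. now apply Hln.
    + rewrite <- E. left. apply exp_pos.
Qed.

Lemma tame_bound (f : C -> C) (finf : C) (K : R) (z : C) (d : R) : tame f finf K ->
  ~ frak_e n alpha beta z -> 0 < d -> d <= dist_bands z ->
  Cmod (f z) <= exp (/ (Rpower d p * Rpower d q) * K).
Proof.
  intros (HK & _ & _ & _ & Hf) Hz Hd Hdz. eapply Rle_trans; [now apply Hf|].
  apply exp_monotone. unfold Rdiv. rewrite Rmult_comm. apply Rmult_le_compat_r; [lra|].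
  assert (Hde := dist_bands_le_dist_ends z).
  apply Rinv_le_contravar; [apply Rmult_lt_0_compat; apply Rpower_pos|].
  apply Rmult_le_compat; try (left; apply Rpower_pos); apply Rpower_le_l; lra.
Qed.

(** The condition on [w] puts [1 / w] at distance at least 1 from the bands, where the bound reduces
    to [exp K] whatever [p] and [q] are. *)
Lemma tame_at_infty (R0 : R) (f : C -> C) (finf : C) (K : R) (w : C) :
  (forall z, frak_e n alpha beta z -> Cmod z <= R0) ->
  tame f finf K -> Cmod w * (R0 + 1) <= 1 -> 
  cdiff (finf_ext f finf) w /\ Cmod (finf_ext f finf w) <= exp K.
Proof.
  intros HR Ht Hw. assert (Ht' := Ht). destruct Ht' as (HK & Hf & H0 & H1 & Hb).
  destruct (Ceq_dec w 0) as [->|E].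
  - split; [exact H0|]. unfold finf_ext. destruct (Ceq_dec 0 0) as [_|N]; [|now destruct N].
    rewrite H1, <- exp_0. apply exp_monotone. lra.
  - assert (Hwp : 0 < Cmod w) by now apply Cmod_gt_0.
    assert (Hinv : R0 + 1 <= Cmod (/ w)).
    { rewrite Cmod_inv by exact E. apply Rmult_le_reg_l with (Cmod w); [exact Hwp|].
      rewrite Rinv_r; lra. }
    assert (Hd : 1 <= dist_bands (/ w)%C).
    { apply dist_bands_ge. intros v Hv. assert (h := Cmod_triangle_inv (/ w) v).
      specialize (HR v Hv). lra. }
    assert (Hni : ~ frak_e n alpha beta (/ w)%C).
    { intros Hin. specialize (HR _ Hin). lra. }
    split.
    + apply (cdiff_ext_loc (fun w => f (/ w)%C) _ w (Cmod w) Hwp).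
      * intros z Hz. unfold finf_ext. destruct (Ceq_dec z 0) as [->|_]; [|reflexivity].
        exfalso. replace (0 - w)%C with (- w)%C in Hz by ring. rewrite Cmod_opp in Hz. lra.
      * apply (cdiff_comp f Cinv); [now apply Hf|now apply cdiff_inv].
    + unfold finf_ext. destruct (Ceq_dec w 0) as [|_]; [contradiction|].
      eapply Rle_trans; [apply (tame_bound f finf K _ 1 Ht Hni ltac:(lra) Hd)|].
      apply exp_monotone. unfold Rpower. rewrite ln_1, !Rmult_0_r, exp_0. lra.
Qed.

(* Two steps: from infinity to a point near [i Y] (or [- i Y]), and from there to [c]
   inside a disc that stays in the half-plane of [c]. *)
Lemma tame_lower_bound (c : C) (rho : R) : Im c <> 0 -> 0 < rho ->
  exists A, 0 < A /\ forall f finf K, tame f finf K ->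
    exists z, Cmod (z - c) <= rho /\ exp (- (A * K)) <= Cmod (f z).
Proof.
  intros Hc Hrho. destruct bands_bounded as (R0 & HR0 & HR).
  assert (Hsig : exists sg y, (sg = 1 \/ sg = -1) /\ 0 < y /\ Im c = sg * y).
  { destruct (Rlt_dec 0 (Im c)).
    - exists 1, (Im c). repeat split; [now left|assumption|ring].
    - exists (-1), (- Im c). repeat split; [now right|lra|ring]. }
  destruct Hsig as (sg & y & Hsg & Hy & Ec).
  assert (Hsg2 : sg * sg = 1) by (destruct Hsg; subst; ring).
  set (x := Re c). assert (Ecc : c = (x, sg * y)).
  { destruct c as [u v]. unfold x, Im in *. simpl in *. now subst. }
  (* [R0 + 1] lets the disc [|w| <= 1 / Y] be handled by [tame_at_infty]. The other terms give
     [|c - zs| <= Y - 3/4 y], the last one paying for the horizontal offset [x]. *)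
  set (Y := R0 + 1 + 2 * y + 2 * x ^ 2 / y).
  assert (Hx2 : 0 <= x ^ 2 / y) by (apply Rdiv_le_0_compat; [apply pow2_ge_0|exact Hy]).
  assert (HY : R0 + 1 + 2 * y <= Y) by (unfold Y; lra).
  set (zs := (0, sg * Y) : C).
  assert (Hzs : Cmod zs = Y).
  { unfold Cmod, zs. simpl. replace (0 * (0 * 1) + sg * Y * (sg * Y * 1)) with (sg * sg * (Y * Y)) by ring.
    rewrite Hsg2, Rmult_1_l. apply sqrt_square. lra. }
  assert (Hzs0 : zs <> 0) by (apply Cmod_gt_0; lra).
  (* The first step reaches some [w1] within [tau / Y] of [1 / zs]. The bound [1/2] keeps [w1] away
     from 0, and the other one puts [1 / w1] within [y / 8] of [zs]. *)
  set (tau := Rmin (/ 2) (y / (16 * Y))).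
  assert (Htau : 0 < tau) by (apply Rmin_pos; [lra|apply Rdiv_lt_0_compat; lra]).
  assert (Htau1 : tau <= / 2) by apply Rmin_l.
  assert (Htau2 : tau * (16 * Y) <= y).
  { apply Rle_trans with (y / (16 * Y) * (16 * Y)); [|right; field; lra].
    apply Rmult_le_compat_r; [lra|apply Rmin_r]. }
  assert (Hczs : Cmod (c - zs) <= Y - 3 / 4 * y).
  { apply Rsqr_incr_0_var; [|lra]. unfold Rsqr.
    replace (Cmod (c - zs) * Cmod (c - zs)) with (Cmod (c - zs) ^ 2) by ring.
    rewrite Cmod_sqr, Ecc. unfold zs, Re, Im. simpl.
    replace ((sg * y + - (sg * Y)) * ((sg * y + - (sg * Y)) * 1)) with (sg * sg * ((y - Y) * (y - Y))) by ring.
    rewrite Hsg2.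
    assert (Hxx : x ^ 2 = x ^ 2 / y * y) by (field; lra).
    assert (x * x <= (Y - y) * y / 2).
    { replace (x * x) with (x ^ 2) by ring. rewrite Hxx. unfold Y. nra. }
    nra. }
  set (rho2 := Rmin rho (y / 8)).
  assert (Hrho2 : 0 < rho2) by (apply Rmin_pos; lra).
  set (B2 := / (Rpower (y / 2) p * Rpower (y / 2) q)).
  assert (HB2 : 0 < B2).
  { apply Rinv_0_lt_compat, Rmult_lt_0_compat; apply Rpower_pos. }
  exists (4 * Y / rho2 * (B2 + 4 / tau)). split.
  { apply Rmult_lt_0_compat; [apply Rdiv_lt_0_compat; lra|].
    apply Rplus_lt_0_compat; [exact HB2|apply Rdiv_lt_0_compat; lra]. }
  intros f finf K Ht. assert (HK : 0 < K) by apply Ht.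
  destruct (lower_bound_propagates (finf_ext f finf) 0 (/ zs)%C (tau / Y) K 0)
    as (w1 & h1 & h2 & h3); try lra.
  { replace (/ zs - 0)%C with (/ zs)%C by ring. rewrite Cmod_inv, Hzs by exact Hzs0.
    split; [apply Rdiv_lt_0_compat; lra|]. rewrite <- (Rmult_1_l (/ Y)).
    apply Rmult_le_compat_r; [left; apply Rinv_0_lt_compat; lra|lra]. }
  { intros z Hz. apply (tame_at_infty R0); trivial.
    replace (z - 0)%C with z in Hz by ring. replace (/ zs - 0)%C with (/ zs)%C in Hz by ring.
    rewrite Cmod_inv, Hzs in Hz by exact Hzs0.
    apply Rle_trans with (/ Y * Y); [|right; field; lra].
    apply Rmult_le_compat; try lra. apply Cmod_ge_0. }
  { unfold finf_ext. destruct (Ceq_dec 0 0) as [_|N]; [|now destruct N].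
    destruct Ht as (_ & _ & _ & -> & _). rewrite Ropp_0, exp_0. lra. }
  replace (/ zs - 0)%C with (/ zs)%C in h1, h3 by ring. replace (w1 - 0)%C with w1 in h1 by ring.
  rewrite Cmod_inv, Hzs in h1, h3 by exact Hzs0.
  replace (4 * / Y / (tau / Y) * (K + 0)) with (4 / tau * K) in h3 by (field; lra).
  assert (Hw1 : / (2 * Y) <= Cmod w1).
  { assert (t := Cmod_triangle_inv (/ zs) w1). rewrite Cmod_sub_sym in t.
    rewrite Cmod_inv, Hzs in t by exact Hzs0.
    assert (tau / Y <= / 2 * / Y) by (apply Rmult_le_compat_r; [left; apply Rinv_0_lt_compat; lra|lra]).
    replace (/ (2 * Y)) with (/ Y - / 2 * / Y) by (field; lra). lra. }
  assert (HiY : 0 < / (2 * Y)) by (apply Rinv_0_lt_compat; lra).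
  assert (Hw10 : w1 <> 0) by (apply Cmod_gt_0; lra).
  unfold finf_ext in h3. destruct (Ceq_dec w1 0) as [|_]; [contradiction|].
  set (z1 := (/ w1)%C) in *.
  assert (Hz1 : Cmod (z1 - zs) <= y / 8).
  { replace (z1 - zs)%C with (- ((w1 - / zs) * (zs / w1)))%C by (unfold z1; field; now split).
    rewrite Cmod_opp, Cmod_mult, Cmod_div, Hzs by exact Hw10.
    apply Rle_trans with (tau / Y * (Y * (2 * Y))).
    - apply Rmult_le_compat; try apply Cmod_ge_0; [|exact h2|].
      + apply Rdiv_le_0_compat; lra.
      + apply Rmult_le_compat_l; [lra|]. rewrite <- (Rinv_inv (2 * Y)).
        now apply Rinv_le_contravar.
    - replace (tau / Y * (Y * (2 * Y))) with (2 * (tau * Y)) by (field; lra). lra. }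
  assert (Hr2 : y / 8 <= Cmod (c - z1) <= Y).
  { assert (t1 := Cmod_sub_triangle c z1 zs). assert (t2 := Cmod_sub_triangle c zs z1).
    rewrite (Cmod_sub_sym zs z1) in t2. split; [|lra].
    assert (t3 := Cmod_Im (c - zs)). rewrite Ecc in t3 at 1. unfold zs in t3 at 1. simpl in t3.
    replace (sg * y + - (sg * Y)) with (sg * (y - Y)) in t3 by ring.
    rewrite Rabs_mult in t3. replace (Rabs sg) with 1 in t3
      by (destruct Hsg as [->| ->]; [now rewrite Rabs_R1|rewrite Rabs_left; lra]).
    rewrite Rabs_left in t3 by lra. lra. }
  destruct (lower_bound_propagates f z1 c rho2 (B2 * K) (4 / tau * K))
    as (z2 & k1 & k2 & k3).
  { split; [exact Hrho2|]. eapply Rle_trans; [apply Rmin_r|apply Hr2]. }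
  { apply Rmult_le_pos; lra. }
  { assert (0 < B2 * K) by now apply Rmult_lt_0_compat.
    assert (0 < 4 / tau * K) by (apply Rmult_lt_0_compat; [apply Rdiv_lt_0_compat; lra|exact HK]). lra. }
  { intros z Hz.
    (* Of the margin [3/4 y], two displacements of the centre by [y / 8] leave [y / 2]. *)
    assert (Him : y / 2 <= sg * Im z).
    { assert (t1 := Cmod_sub_triangle z z1 zs). assert (t2 := Cmod_sub_triangle c zs z1).
      rewrite (Cmod_sub_sym zs z1) in t2.
      assert (t3 := Cmod_Im (z - zs)). unfold zs in t3 at 1. simpl in t3. fold (Im z) in t3.
      assert (t4 : Y - sg * Im z <= Cmod (z - zs)).
      { eapply Rle_trans; [|exact t3].
        replace (Y - sg * Im z) with (- (sg * (Im z + - (sg * Y)))).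
        - eapply Rle_trans; [apply Rle_abs|]. rewrite Rabs_Ropp, Rabs_mult.
          destruct Hsg as [->| ->]; [rewrite Rabs_R1|rewrite (Rabs_left (-1)) by lra]; lra.
        - rewrite Rmult_plus_distr_l. replace (sg * - (sg * Y)) with (- (sg * sg * Y)) by ring.
          rewrite Hsg2. ring. }
      lra. }
    assert (Habs : y / 2 <= Rabs (Im z)).
    { destruct Hsg as [->| ->].
      - eapply Rle_trans; [|apply Rle_abs]. lra.
      - rewrite <- Rabs_Ropp. eapply Rle_trans; [|apply Rle_abs]. lra. }
    assert (Hni : ~ frak_e n alpha beta z).
    { apply off_axis. intros E. rewrite E, Rabs_R0 in Habs. lra. }
    split; [now apply Ht|].
    apply (tame_bound f finf K z (y / 2) Ht Hni ltac:(lra)).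
    eapply Rle_trans; [exact Habs|apply dist_bands_ge_Im]. }
  { exact h3. }
  exists z2. split; [eapply Rle_trans; [exact k2|apply Rmin_l]|].
  eapply Rle_trans; [|exact k3]. apply exp_monotone. apply Ropp_le_contravar.
  replace (B2 * K + 4 / tau * K) with ((B2 + 4 / tau) * K) by ring.
  rewrite <- Rmult_assoc. apply Rmult_le_compat_r; [lra|].
  apply Rmult_le_compat_r.
  { left. apply Rplus_lt_0_compat; [exact HB2|apply Rdiv_lt_0_compat; lra]. }
  apply Rmult_le_compat_r; [left; now apply Rinv_0_lt_compat|lra].
Qed.

End Bands.

(** * Charts; zeros away from the bands *)

Lemma choice_fun {A B : Type} (R : A -> B -> Prop) :
  (forall x, exists y, R x y) -> exists f, forall x, R x (f x).
Proof.
  intros H. exists (fun x => proj1_sig (constructive_indefinite_description _ (H x))).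
  intros x. apply (proj2_sig (constructive_indefinite_description _ (H x))).
Qed.

Lemma zsum_map (W : C -> R) (g : C -> C) (s : list (C * nat)) :
  zsum W (map (fun zm => (g (fst zm), snd zm)) s) = zsum (fun z => W (g z)) s.
Proof. induction s as [|[a m] s IH]; [reflexivity|]. cbn [map fst snd]. now rewrite !zsum_cons, IH. Qed.

(** The exponents [a_exp] and [b_exp] may have either sign, so the power may be largest at either
    end of the interval. *)
Lemma Rpower_bounded (l u a : R) : 0 < l -> exists B, 0 < B /\ forall x, l <= x <= u -> Rpower x a <= B.
Proof.
  intros Hl. exists (Rpower l a + Rpower u a).
  assert (h1 := Rpower_pos l a). assert (h2 := Rpower_pos u a). split; [lra|].
  intros x Hx. destruct (Rle_dec 0 a).
  - assert (Rpower x a <= Rpower u a) by (apply Rpower_le_l; lra). lra.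
  - assert (Rpower x a <= Rpower l a); [|lra].
    replace a with (- - a) by ring. rewrite !(Rpower_Ropp _ (- a)).
    apply Rinv_le_contravar; [apply Rpower_pos|]. apply Rpower_le_l; lra.
Qed.

Lemma Rpower_0_r (x : R) : Rpower x 0 = 1.
Proof. unfold Rpower. now rewrite Rmult_0_l, exp_0. Qed.

(** In a chart with [q' = 0] the factor [|w|] disappears from the weight. *)
Lemma posp_eps (eps : R) : eps < 1 -> posp (0 - 1 + eps) = 0.
Proof. intros H. unfold posp. apply Rmax_right. lra. Qed.

(** The inverse of the slit-opening chart off the half-line [[0, +oo)]. The last two identities are
    the half-angle formulas from which distances to the band are read off. *)
Lemma upper_sqrt (om : C) : Im om <> 0 \/ Re om < 0 ->
  exists w, (w * w)%C = om /\ 0 < Im w /\ 2 * Im w ^ 2 = Cmod om - Re om /\ Cmod w ^ 2 = Cmod om.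
Proof.
  intros H.
  assert (Hpos : Re om < Cmod om).
  { destruct H as [H|H].
    - apply Rnot_le_lt. intros Hle. assert (E := Cmod_sqr om). assert (h := Cmod_ge_0 om).
      assert (0 < Im om ^ 2) by (apply pow2_gt_0; exact H). nra.
    - eapply Rlt_le_trans; [exact H|apply Cmod_ge_0]. }
  set (y := sqrt ((Cmod om - Re om) / 2)).
  assert (Hy : 0 < y) by (apply sqrt_lt_R0; lra).
  assert (Ey : y * y = (Cmod om - Re om) / 2) by (apply sqrt_sqrt; lra).
  set (x := Im om / (2 * y)). exists (x, y).
  assert (Ew : ((x, y) * (x, y))%C = om).
  { unfold x. assert (E := Cmod_sqr om). destruct om as [a b]. unfold Cmult. simpl in *. f_equal; [|field; lra].
    set (m := Cmod (a, b)) in *.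
    apply Rmult_eq_reg_r with (4 * (y * y)); [|nra].
    replace ((b / (2 * y) * (b / (2 * y)) - y * y) * (4 * (y * y)))
      with (b ^ 2 - 4 * (y * y) * (y * y)) by (field; lra).
    rewrite Ey. assert (E' : b ^ 2 = m ^ 2 - a ^ 2) by lra. rewrite E'. field. }
  repeat split; trivial.
  - simpl. replace (2 * (y * (y * 1))) with (2 * (y * y)) by ring. rewrite Ey. field.
  - rewrite <- Ew, Cmod_mult. ring.
Qed.

Definition iR (y : R) : C := (0, y).

Lemma iR_plus (x y : R) : (iR x + iR y)%C = iR (x + y).
Proof. unfold iR, Cplus. simpl. f_equal. ring. Qed.

Lemma Cmod_iR (y : R) : Cmod (iR y) = Rabs y.
Proof.
  unfold Cmod, iR. simpl. replace (0 * (0 * 1) + y * (y * 1)) with (y²) by (unfold Rsqr; ring).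
  apply sqrt_Rsqr_abs.
Qed.

Lemma Im_sub_iR (w : C) (y : R) : Rabs (Im w - y) <= Cmod (w - iR y).
Proof. eapply Rle_trans; [|apply Cmod_Im]. apply Rle_refl. Qed.

(** For a quadratic [psi] the factor [psi w - psi v = (w - v) (b1 + b2 (w + v))] is explicit. One
    polynomial form covers the affine charts and the square chart. *)
Lemma divides_at_chart (f : C -> C) (c0 b1 b2 v : C) (m : nat) :
  divides_at f (c0 + b1 * v + b2 * (v * v)) m ->
  divides_at (fun w => f (c0 + b1 * w + b2 * (w * w))%C) v m.
Proof.
  intros (g & r & Hr & Hg).
  set (psi := fun w : C => (c0 + b1 * w + b2 * (w * w))%C). fold (psi v) in Hg.
  assert (dpsi : forall w, cdiff psi w).
  { intros w. unfold psi. apply cdiff_plus; [apply cdiff_plus|]; try apply cdiff_const;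
      apply cdiff_mult; try apply cdiff_const; try apply cdiff_id.
    apply cdiff_mult; apply cdiff_id. }
  destruct (cdiff_ccont _ _ (dpsi v) r Hr) as (d & Hd & H).
  exists (fun w => Defs.Cpow (b1 + b2 * (w + v)) m * g (psi w))%C, d. split; [exact Hd|].
  intros w Hw. destruct (Hg (psi w) (H w Hw)) as [h1 h2]. split.
  - apply cdiff_mult.
    + apply (cdiff_pow (fun w => b1 + b2 * (w + v))%C). apply cdiff_plus; [apply cdiff_const|].
      apply cdiff_mult; [apply cdiff_const|]. apply cdiff_plus; [apply cdiff_id|apply cdiff_const].
    + apply (cdiff_comp g psi); [exact h1|apply dpsi].
  - fold (psi w). rewrite h2.
    replace (psi w - psi v)%C with ((w - v) * (b1 + b2 * (w + v)))%C by (unfold psi; ring).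
    rewrite Cmult_assoc. f_equal. clear. induction m as [|m IH]; simpl; [ring|]. rewrite IH. ring.
Qed.

Lemma affine_chart_target (c : C) (sg mu : R) (w1 : R) : sg * sg = 1 -> 0 < mu ->
  forall z, Cmod (z - (c + RtoC (sg * mu) * iR w1)) <= mu / 4 ->
  exists w, (c + RtoC (sg * mu) * w)%C = z /\ Cmod (w - iR w1) <= / 4.
Proof.
  intros Hsg Hmu z Hz.
  assert (Hs0 : sg <> 0) by (intros ->; lra).
  assert (Hsm : RtoC (sg * mu) <> 0).
  { intros E. apply RtoC_inj in E. apply Rmult_integral in E. lra. }
  assert (Hm : Cmod (RtoC (sg * mu)) = mu).
  { rewrite Cmod_R. rewrite Rabs_mult, (Rabs_pos_eq mu) by lra.
    assert (Rabs sg = 1); [|nra].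
    assert (h := Rabs_pos sg). assert (Rabs sg * Rabs sg = 1); [|nra].
    rewrite <- Rabs_mult, Hsg. apply Rabs_R1. }
  exists ((z - c) / RtoC (sg * mu))%C. split; [field; exact Hsm|].
  replace ((z - c) / RtoC (sg * mu) - iR w1)%C
    with ((z - (c + RtoC (sg * mu) * iR w1)) / RtoC (sg * mu))%C by (field; exact Hsm).
  rewrite Cmod_div, Hm by exact Hsm.
  apply Rmult_le_reg_r with mu; [exact Hmu|]. unfold Rdiv.
  rewrite Rmult_assoc, Rinv_l by lra. lra.
Qed.

(** [tame_lower_bound] locates its point only up to a small error, so a whole disc of admissible
    reference points is required. *)
Lemma near_3i2 (w : C) : Cmod (w - iR (3 / 2)) <= / 4 -> 1 <= Cmod w <= 2 /\ Cmod w / 2 <= Im w.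
Proof.
  intros H. assert (Hv : Cmod (iR (3 / 2)) = 3 / 2) by (rewrite Cmod_iR; apply Rabs_pos_eq; lra).
  assert (t1 := Cmod_triangle_inv w (iR (3 / 2))). assert (t2 := Cmod_triangle_inv (iR (3 / 2)) w).
  rewrite Cmod_sub_sym in t2. assert (t3 := Im_sub_iR w (3 / 2)).
  assert (t4 := Rle_abs (- (Im w - 3 / 2))).
  rewrite Rabs_Ropp in t4. lra.
Qed.

Section Charts.

Variables (n : nat) (alpha beta : nat -> R).
Hypothesis Hadm : admissible n alpha beta.
Variables (p q eps : R).
Hypothesis Hp : 0 <= p.
Hypothesis Hq : 0 <= q.
Hypothesis Heps : 0 < eps < 1.

Local Notation inE := (frak_e n alpha beta).
Local Notation dE := (dist_bands n alpha beta).
Local Notation de := (dist_ends n alpha beta).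
Local Notation tame := (tame n alpha beta p q).

Definition zero_weight (z : C) : R :=
  Rpower (dE z) (p + 1 + eps) * Rpower (de z) (a_exp p q eps) * Rpower (1 + Cmod z) (b_exp p q eps).

Lemma zero_weight_nonneg (z : C) : 0 <= zero_weight z.
Proof. left. repeat apply Rmult_lt_0_compat; apply Rpower_pos. Qed.

(** One constant for all [f] and all finite lists, linear in [K]: under finite covers the constants
    simply add, which makes the property accessible to bisection. *)
Definition summable_on (P : C -> Prop) : Prop :=
  exists A, 0 < A /\ forall f finf K s, tame f finf K -> NoDup (map fst s) ->
    (forall zm, In zm s -> ~ inE (fst zm) /\ divides_at f (fst zm) (snd zm) /\ P (fst zm)) ->
    zsum zero_weight s <= A * K.

Lemma summable_on_cover (P Q R : C -> Prop) :
  summable_on P -> summable_on Q -> (forall z, ~ inE z -> R z -> P z \/ Q z) -> summable_on R.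
Proof.
  intros (A & HA & H) (B & HB & H') Hcov. exists (A + B). split; [lra|].
  intros f finf K s Ht Hnd Hs.
  set (b := fun zm : C * nat => if excluded_middle_informative (P (fst zm)) then true else false).
  rewrite (zsum_filter_split zero_weight b s), Rmult_plus_distr_r. apply Rplus_le_compat.
  - apply (H f finf); trivial; [now apply NoDup_map_filter|]. intros zm Hin.
    apply filter_In in Hin. destruct Hin as [Hin Hb]. unfold b in Hb.
    destruct (excluded_middle_informative (P (fst zm))); [|discriminate].
    destruct (Hs zm Hin) as (h1 & h2 & _). now repeat split.
  - apply (H' f finf); trivial; [now apply NoDup_map_filter|]. intros zm Hin.
    apply filter_In in Hin. destruct Hin as [Hin Hb]. unfold b in Hb.
    destruct (excluded_middle_informative (P (fst zm))); [discriminate|].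
    destruct (Hs zm Hin) as (h1 & h2 & h3). destruct (Hcov (fst zm) h1 h3); [contradiction|now repeat split].
Qed.

Lemma dist_bands_mem (z : C) : inE z -> dE z <= 0.
Proof. intros H. rewrite <- (Cmod_sub_diag z). now apply dist_set_le. Qed.

(** Isolates what depends on the point of the plane: the growth bound in the half-disc, a disc
    around [c1] of images of reference points, and preimages of the zeros with comparable weights.
    [c1] is off the axis so that [tame_lower_bound] applies. *)
Lemma summable_on_chart (c0 b1 b2 c1 : C) (p0 q0 B0 B1 rho1 : R) (P : C -> Prop) :
  0 <= p0 -> 0 <= q0 -> 0 < B0 -> 0 < B1 -> Im c1 <> 0 -> 0 < rho1 ->
  let psi := fun w : C => (c0 + b1 * w + b2 * (w * w))%C in
  (forall w, 0 < Im w -> Cmod w < 20 -> ~ inE (psi w) /\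
     Rpower (Im w) p0 * Rpower (Cmod w) q0 <= B0 * (Rpower (dE (psi w)) p * Rpower (de (psi w)) q)) ->
  (forall z, Cmod (z - c1) <= rho1 -> exists w, psi w = z /\ 1 <= Cmod w <= 2 /\ Cmod w / 2 <= Im w) ->
  (forall z, ~ inE z -> P z -> exists w, psi w = z /\ 0 < Im w /\ Cmod w < / 8 /\
     zero_weight z <= B1 * (Rpower (Im w) (p0 + 1 + eps) * Rpower (Cmod w) (posp (q0 - 1 + eps)))) ->
  summable_on P.
Proof.
  intros Hp0 Hq0 HB0 HB1 Hc1 Hrho1 psi Hchart Htarget HP.
  destruct (half_disc_zeros p0 q0 eps Hp0 Hq0 Heps) as (c & Hc & HZ).
  destruct (tame_lower_bound n alpha beta Hadm p q Hp Hq c1 rho1 Hc1 Hrho1) as (A & HA & Hlow).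
  exists (B1 * (c * (B0 + A))). split.
  { repeat apply Rmult_lt_0_compat; lra. }
  intros f finf K s Ht Hnd Hs. assert (HK : 0 < K) by apply Ht.
  destruct (Hlow f finf K Ht) as (z0 & Hz0 & Hf0).
  destruct (Htarget z0 Hz0) as (w0 & Ew0 & Hw0 & Hw0').
  destruct (choice_fun (fun z w => ~ inE z -> P z -> psi w = z /\ 0 < Im w /\ Cmod w < / 8 /\
     zero_weight z <= B1 * (Rpower (Im w) (p0 + 1 + eps) * Rpower (Cmod w) (posp (q0 - 1 + eps))))) as (g & Hg).
  { intros z. destruct (classic (~ inE z /\ P z)) as [[h1 h2]|h].
    - destruct (HP z h1 h2) as (w & Hw). now exists w.
    - exists (RtoC 0). intros h1 h2. exfalso. now apply h. }
  assert (Hsg : forall zm, In zm s -> psi (g (fst zm)) = fst zm /\ 0 < Im (g (fst zm)) /\ Cmod (g (fst zm)) < / 8 /\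
     zero_weight (fst zm) <= B1 * (Rpower (Im (g (fst zm))) (p0 + 1 + eps) * Rpower (Cmod (g (fst zm))) (posp (q0 - 1 + eps)))).
  { intros zm Hin. destruct (Hs zm Hin) as (h1 & _ & h2). now apply Hg. }
  set (s' := map (fun zm : C * nat => (g (fst zm), snd zm)) s).
  set (W := fun w => Rpower (Im w) (p0 + 1 + eps) * Rpower (Cmod w) (posp (q0 - 1 + eps))).
  apply Rle_trans with (zsum (fun z => B1 * W (g z)) s).
  { apply zsum_le. intros zm Hin. now apply Hsg. }
  rewrite (zsum_scal B1 (fun z => W (g z))), <- zsum_map. fold s'.
  rewrite !Rmult_assoc. apply Rmult_le_compat_l; [lra|].
  replace ((B0 + A) * K) with (B0 * K + A * K) by ring.
  apply (HZ (fun w => f (psi w)) w0 (B0 * K) (A * K) s'); trivial.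
  - apply Rmult_le_pos; lra.
  - apply Rmult_le_pos; lra.
  - intros w Hw1 Hw2. destruct (Hchart w Hw1 Hw2) as [h1 h2].
    destruct Ht as (_ & Hhol & _ & _ & Hb). split.
    + apply (cdiff_comp f psi); [now apply Hhol|].
      unfold psi. apply cdiff_plus; [apply cdiff_plus|]; try apply cdiff_const;
        apply cdiff_mult; try apply cdiff_const; try apply cdiff_id.
      apply cdiff_mult; apply cdiff_id.
    + eapply Rle_trans; [apply Hb, h1|]. apply exp_monotone.
      set (D := Rpower (dE (psi w)) p * Rpower (de (psi w)) q) in *.
      set (N := Rpower (Im w) p0 * Rpower (Cmod w) q0) in *.
      assert (HD : 0 < D) by (apply Rmult_lt_0_compat; apply Rpower_pos).
      assert (HN : 0 < N) by (apply Rmult_lt_0_compat; apply Rpower_pos).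
      apply Rmult_le_reg_r with (N * D); [now apply Rmult_lt_0_compat|].
      replace (K / D * (N * D)) with (K * N) by (field; lra).
      replace (B0 * K / N * (N * D)) with (K * (B0 * D)) by (field; lra).
      apply Rmult_le_compat_l; lra.
  - cbv beta. rewrite Ew0. exact Hf0.
  (* [psi] is a left inverse of the choice [g] on the zeros, so distinct zeros have distinct
     preimages. *)
  - apply (NoDup_map_inv psi). unfold s'. rewrite !map_map.
    replace (map (fun x : C * nat => psi (fst (g (fst x), snd x))) s) with (map fst s); [exact Hnd|].
    apply map_ext_in. intros zm Hin. symmetry. now apply Hsg.
  - intros zm Hin. unfold s' in Hin. apply in_map_iff in Hin. destruct Hin as (zm0 & <- & Hin).
    cbn [fst snd]. destruct (Hsg zm0 Hin) as (h1 & h2 & h3 & _). repeat split; trivial.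
    unfold psi. apply divides_at_chart. fold (psi (g (fst zm0))). rewrite h1. now apply Hs.
Qed.

Lemma dist_bands_Lipschitz (c z : C) : dE c - Cmod (z - c) <= dE z.
Proof.
  apply dist_bands_ge; [exact Hadm|]. intros w Hw. assert (t := Cmod_sub_triangle c z w).
  rewrite (Cmod_sub_sym c z) in t. assert (h := dist_set_le c inE w Hw). unfold dist_bands. lra.
Qed.

(** The half-disc estimate is reused with [p0 = q0 = 0]: the chart lies well inside the domain and
    [c] sits at [w = i / 16], away from the diameter. *)
Lemma summable_off_bands (c : C) : ~ inE c -> exists r, 0 < r /\ summable_on (fun z => Cmod (z - c) < r).
Proof.
  intros Hc. set (d := dE c). assert (Hd : 0 < d) by (apply dist_bands_pos; assumption).
  (* The chart stays within [mu (20 + 1/16) <= 21 mu = d / 2] of [c]. *)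
  set (mu := d / 42). assert (Hmu : 0 < mu) by (unfold mu; lra).
  exists (mu / 32). split; [lra|].
  (* The chart points away from the real axis, so the reference point, shifted by [23/16 mu] from
     [c], cannot be real. *)
  assert (Hsig : exists sg, (sg = 1 \/ sg = -1) /\ 0 <= sg * Im c).
  { destruct (Rle_dec 0 (Im c)); [exists 1|exists (-1)]; (split; [tauto|lra]). }
  destruct Hsig as (sg & Hsg & Hsgc).
  assert (Hsg2 : sg * sg = 1) by (destruct Hsg; subst; ring).
  assert (Hsa : Rabs sg = 1) by (destruct Hsg as [->| ->]; [apply Rabs_R1|rewrite Rabs_left; lra]).
  set (c0 := (c + RtoC (sg * mu) * iR (- / 16))%C).
  assert (Hm : Cmod (RtoC (sg * mu)) = mu).
  { rewrite Cmod_R, Rabs_mult, Hsa, Rabs_pos_eq; lra. }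
  destruct (Rpower_bounded (d / 2) (2 * d + Cmod c + 1 + Rabs (alpha 0%nat)) (p + 1 + eps)) as (M1 & HM1 & H1); [lra|].
  destruct (Rpower_bounded (d / 2) (2 * d + Cmod c + 1 + Rabs (alpha 0%nat)) (a_exp p q eps)) as (M2 & HM2 & H2); [lra|].
  destruct (Rpower_bounded 1 (2 * d + Cmod c + 1 + Rabs (alpha 0%nat)) (b_exp p q eps)) as (M3 & HM3 & H3); [lra|].
  assert (Hi16 : Cmod (iR (- / 16)) = / 16) by (rewrite Cmod_iR, Rabs_Ropp; apply Rabs_pos_eq; lra).
  set (Bd := Rpower (d / 2) p * Rpower (d / 2) q).
  assert (HBd : 0 < Bd) by (apply Rmult_lt_0_compat; apply Rpower_pos).
  apply (summable_on_chart c0 (RtoC (sg * mu)) 0 (c0 + RtoC (sg * mu) * iR (3 / 2))%C 0 0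
           (/ Bd) (M1 * M2 * M3 / Rpower (/ 32) (1 + eps)) (mu / 4)); try lra.
  - now apply Rinv_0_lt_compat.
  - apply Rdiv_lt_0_compat; [|apply Rpower_pos]. repeat apply Rmult_lt_0_compat; assumption.
  - unfold c0. destruct c as [x y]. simpl in *. intros E.
    assert (E' : sg * y = - (sg * sg * mu * (23 / 16))) by (replace (sg * y) with (sg * (y + (sg * mu * - / 16 + 0 * 0) + (sg * mu * (3 / 2) + 0 * 0)) - sg * sg * mu * (23 / 16)) by field; rewrite E; ring).
    rewrite Hsg2 in E'. lra.
  - intros w Hw1 Hw2.
    assert (Hnear : Cmod (c0 + RtoC (sg * mu) * w + 0 * (w * w) - c) <= d / 2).
    { unfold c0. replace (c + RtoC (sg * mu) * iR (- / 16) + RtoC (sg * mu) * w + 0 * (w * w) - c)%C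
        with (RtoC (sg * mu) * (iR (- / 16) + w))%C by ring.
      rewrite Cmod_mult, Hm. assert (t := Cmod_triangle (iR (- / 16)) w). rewrite Hi16 in t.
      apply Rle_trans with (mu * 21); [apply Rmult_le_compat_l; lra|unfold mu; lra]. }
    set (z := (c0 + RtoC (sg * mu) * w + 0 * (w * w))%C) in *.
    assert (HdE : d / 2 <= dE z) by (assert (t := dist_bands_Lipschitz c z); fold d in t; lra).
    assert (Hde := dist_bands_le_dist_ends n alpha beta Hadm z). split.
    + intros Hin. apply dist_bands_mem in Hin. lra.
    + rewrite !Rpower_0_r, Rmult_1_r.
      apply Rmult_le_reg_l with Bd; [exact HBd|]. rewrite <- Rmult_assoc, Rinv_r, Rmult_1_r, Rmult_1_l by lra.
      unfold Bd. apply Rmult_le_compat; try (left; apply Rpower_pos); apply Rpower_le_l; lra.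
  - intros z Hz. destruct (affine_chart_target c0 sg mu (3 / 2) Hsg2 Hmu z Hz) as (w & Ew & Hw).
    exists w. split; [rewrite <- Ew; ring|]. now apply near_3i2.
  - intros z Hz Hzc. destruct (affine_chart_target c0 sg mu (/ 16) Hsg2 Hmu z) as (w & Ew & _).
    { replace (c0 + RtoC (sg * mu) * iR (/ 16))%C with c; [lra|]. unfold c0.
      rewrite <- Cplus_assoc, <- Cmult_plus_distr_l.
      rewrite iR_plus, Rplus_opp_l. change (iR 0) with (RtoC 0). ring. }
    exists w. split; [rewrite <- Ew; ring|].
    assert (Hw : mu * Cmod (w - iR (/ 16)) < mu * / 32).
    { rewrite <- Hm at 1. rewrite <- Cmod_mult.
      replace (RtoC (sg * mu) * (w - iR (/ 16)))%C with (z - c)%C; [lra|]. rewrite <- Ew. unfold c0.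
      replace (iR (- / 16)) with (- iR (/ 16))%C by (unfold iR, Copp; simpl; f_equal; ring). ring. }
    apply Rmult_lt_reg_l in Hw; [|exact Hmu].
    assert (Hv : Cmod (iR (/ 16)) = / 16) by (rewrite Cmod_iR; apply Rabs_pos_eq; lra).
    assert (t1 := Cmod_triangle_inv w (iR (/ 16))). assert (t3 := Im_sub_iR w (/ 16)).
    assert (t4 := Rle_abs (- (Im w - / 16))). rewrite Rabs_Ropp in t4.
    split; [lra|]. split; [lra|].
    rewrite posp_eps, Rpower_0_r, Rmult_1_r by lra. rewrite Rplus_0_l.
    assert (HdE : d / 2 <= dE z) by (assert (t := dist_bands_Lipschitz c z); fold d in t; unfold mu in Hzc; lra).
    assert (Hde := dist_bands_le_dist_ends n alpha beta Hadm z).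
    assert (Hzc' : Cmod z <= Cmod c + d) by (assert (t := Cmod_triangle_inv z c); unfold mu in Hzc; lra).
    assert (Hdeu : de z <= Cmod z + Rabs (alpha 0%nat)).
    { eapply Rle_trans; [apply (dist_set_le z _ (RtoC (alpha 0%nat)))|].
      - exists 0%nat. split; [lia|now left].
      - eapply Rle_trans; [apply Cmod_triangle|]. rewrite Cmod_opp, Cmod_R. apply Rle_refl. }
    assert (Hzpos := Cmod_ge_0 z). assert (Hap := Rabs_pos (alpha 0%nat)).
    apply Rle_trans with (M1 * M2 * M3).
    + unfold zero_weight. apply Rmult_le_compat; try (left; apply Rpower_pos).
      * left. apply Rmult_lt_0_compat; apply Rpower_pos.
      * apply Rmult_le_compat; try (left; apply Rpower_pos); [apply H1|apply H2]; lra.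
      * apply H3; lra.
    + assert (P32 := Rpower_pos (/ 32) (1 + eps)).
      assert (Hle : Rpower (/ 32) (1 + eps) <= Rpower (Im w) (1 + eps)) by (apply Rpower_le_l; lra).
      assert (0 < M1 * M2 * M3) by (repeat apply Rmult_lt_0_compat; assumption).
      apply Rle_trans with (M1 * M2 * M3 / Rpower (/ 32) (1 + eps) * Rpower (/ 32) (1 + eps)).
      * right. field. lra.
      * apply Rmult_le_compat_l; [|exact Hle]. left. now apply Rdiv_lt_0_compat.
Qed.

End Charts.

(** * Zeros near the bands *)

Section BandCharts.

Variables (n : nat) (alpha beta : nat -> R).
Hypothesis Hadm : admissible n alpha beta.
Variables (p q eps : R).
Hypothesis Hp : 0 <= p.
Hypothesis Hq : 0 <= q.
Hypothesis Heps : 0 < eps < 1.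

Local Notation inE := (frak_e n alpha beta).
Local Notation ends := (endpoints n alpha beta).
Local Notation dE := (dist_bands n alpha beta).
Local Notation de := (dist_ends n alpha beta).
Local Notation wt := (zero_weight n alpha beta p q eps).
Local Notation summable_on := (summable_on n alpha beta p q eps).

Lemma on_axis (w : C) : Im w = 0 -> w = RtoC (Re w).
Proof. destruct w as [x y]. simpl. intros ->. reflexivity. Qed.

Lemma ends_on_axis (w : C) : ends w -> w = RtoC (Re w).
Proof. intros Hw. apply on_axis. apply (endpoint_in_band n alpha beta Hadm w Hw). Qed.

Lemma dist_ends_upper (z : C) : de z <= Cmod z + Rabs (alpha 0%nat).
Proof.
  eapply Rle_trans; [apply (dist_set_le z _ (RtoC (alpha 0%nat)))|].
  - exists 0%nat. split; [lia|now left].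
  - eapply Rle_trans; [apply Cmod_triangle|]. rewrite Cmod_opp, Cmod_R. apply Rle_refl.
Qed.

(** Near an interior point the distance to the bands is exactly [mu Im w] on the side [sg], while
    the distance to the endpoints stays between positive constants; hence exponents [p] and 0 in the
    chart. *)
Lemma summable_half_band (j : nat) (x sg : R) : (j <= n)%nat -> alpha j < x < beta j ->
  sg = 1 \/ sg = -1 ->
  exists r, 0 < r /\ summable_on (fun z => Cmod (z - RtoC x) < r /\ 0 < sg * Im z).
Proof.
  intros Hj Hx Hsg.
  assert (Hsg2 : sg * sg = 1) by (destruct Hsg; subst; ring).
  assert (Hsa : Rabs sg = 1) by (destruct Hsg as [->| ->]; [apply Rabs_R1|rewrite Rabs_left; lra]).
  destruct (bands_separated n alpha beta x (fun i => i <> j)) as (d1 & Hd1 & Hsep).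
  { intros i Hi Hij Hxi. destruct (Nat.lt_total i j) as [h|[h|h]]; [|contradiction|].
    - assert (b := bands_ordered n alpha beta Hadm i j h Hj). lra.
    - assert (b := bands_ordered n alpha beta Hadm j i h Hi). lra. }
  set (d := Rmin d1 (Rmin (x - alpha j) (beta j - x))).
  assert (Hd : 0 < d) by (repeat apply Rmin_pos; lra).
  assert (Hdd1 : d <= d1) by apply Rmin_l.
  assert (Hda : d <= x - alpha j) by (eapply Rle_trans; [apply Rmin_r|apply Rmin_l]).
  assert (Hdb : d <= beta j - x) by (eapply Rle_trans; [apply Rmin_r|apply Rmin_r]).
  assert (Hends : forall w, ends w -> d <= Cmod (RtoC x - w)).
  { intros w Hw. rewrite (ends_on_axis w Hw), <- RtoC_minus, Cmod_R.
    destruct Hw as (i & Hi & Hw). destruct (Nat.eq_dec i j) as [->|Hne].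
    - destruct Hw as [-> | ->]; simpl.
      + eapply Rle_trans; [exact Hda|apply Rle_abs].
      + rewrite Rabs_minus_sym. eapply Rle_trans; [exact Hdb|apply Rle_abs].
    - eapply Rle_trans; [exact Hdd1|]. apply (Hsep i); trivial.
      assert (h := alpha_lt_beta n alpha beta Hadm i Hi). destruct Hw as [-> | ->]; simpl; lra. }
  set (mu := d / 42). assert (Hmu : 0 < mu) by (unfold mu; lra).
  exists (mu / 8). split; [lra|].
  assert (Hm : Cmod (RtoC (sg * mu)) = mu) by (rewrite Cmod_R, Rabs_mult, Hsa, Rabs_pos_eq; lra).
  assert (HIm : forall w, Im (RtoC x + RtoC (sg * mu) * w + 0 * (w * w))%C = sg * (mu * Im w)).
  { intros w. destruct w as [u v]. simpl. ring. }
  assert (Hnear : forall z, Cmod (z - RtoC x) <= d / 2 -> d / 2 <= de z).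
  { intros z Hz. apply dist_ends_ge. intros w Hw. specialize (Hends w Hw).
    assert (t := Cmod_sub_triangle x z w). rewrite (Cmod_sub_sym x z) in t. lra. }
  set (U := Rabs x + d + 1 + Rabs (alpha 0%nat)).
  assert (Hap := Rabs_pos (alpha 0%nat)). assert (Hxp := Rabs_pos x).
  destruct (Rpower_bounded (d / 2) U (a_exp p q eps)) as (M2 & HM2 & H2); [lra|].
  destruct (Rpower_bounded 1 U (b_exp p q eps)) as (M3 & HM3 & H3); [lra|].
  set (Bd := Rpower mu p * Rpower (d / 2) q).
  assert (HBd : 0 < Bd) by (apply Rmult_lt_0_compat; apply Rpower_pos).
  assert (Hmue := Rpower_pos mu (p + 1 + eps)).
  apply (summable_on_chart n alpha beta Hadm p q eps Hp Hq Heps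
           (RtoC x) (RtoC (sg * mu)) 0 (RtoC x + RtoC (sg * mu) * iR (3 / 2))%C p 0
           (/ Bd) (Rpower mu (p + 1 + eps) * M2 * M3) (mu / 4)); try lra.
  - now apply Rinv_0_lt_compat.
  - repeat apply Rmult_lt_0_compat; assumption.
  - simpl. intros E. replace (0 + (sg * mu * (3 / 2) + 0 * 0)) with (sg * (3 / 2 * mu)) in E by ring.
    apply Rmult_integral in E. destruct E as [E|E]; [rewrite E in Hsg2; lra|lra].
  - intros w Hw1 Hw2. specialize (HIm w).
    assert (Hn : Cmod (RtoC x + RtoC (sg * mu) * w + 0 * (w * w) - RtoC x) <= d / 2).
    { replace (RtoC x + RtoC (sg * mu) * w + 0 * (w * w) - RtoC x)%C with (RtoC (sg * mu) * w)%C by ring.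
      rewrite Cmod_mult, Hm. apply Rle_trans with (mu * 20); [apply Rmult_le_compat_l; lra|unfold mu; lra]. }
    set (z := (RtoC x + RtoC (sg * mu) * w + 0 * (w * w))%C) in *.
    assert (Hmw : 0 < mu * Im w) by now apply Rmult_lt_0_compat.
    assert (HdE : mu * Im w <= dE z).
    { eapply Rle_trans; [|now apply dist_bands_ge_Im]. rewrite HIm, Rabs_mult, Hsa.
      rewrite Rabs_pos_eq; lra. }
    split.
    + intros Hin. apply (dist_bands_mem n alpha beta) in Hin. lra.
    + rewrite Rpower_0_r, Rmult_1_r.
      apply Rmult_le_reg_l with Bd; [exact HBd|]. rewrite <- Rmult_assoc, Rinv_r, Rmult_1_l by lra.
      unfold Bd. replace (Rpower mu p * Rpower (d / 2) q * Rpower (Im w) p)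
        with (Rpower (mu * Im w) p * Rpower (d / 2) q) by (rewrite <- Rpower_mult_distr by assumption; ring).
      apply Rmult_le_compat; try (left; apply Rpower_pos); apply Rpower_le_l; try lra.
      split; [lra|]. now apply Hnear.
  - intros z Hz. destruct (affine_chart_target (RtoC x) sg mu (3 / 2) Hsg2 Hmu z Hz) as (w & Ew & Hw).
    exists w. split; [rewrite <- Ew; ring|]. now apply near_3i2.
  - intros z Hz [Hzx Hzs].
    assert (Hsm : RtoC (sg * mu) <> 0) by (apply Cmod_gt_0; lra).
    exists ((z - RtoC x) / RtoC (sg * mu))%C. set (w := ((z - RtoC x) / RtoC (sg * mu))%C).
    assert (Ew : (RtoC x + RtoC (sg * mu) * w + 0 * (w * w))%C = z) by (unfold w; field; exact Hsm).
    assert (HI := HIm w). rewrite Ew in HI.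
    assert (HIw : sg * Im z = mu * Im w) by (rewrite HI, <- Rmult_assoc, Hsg2; ring).
    assert (Hiw : 0 < Im w) by (rewrite HIw in Hzs; apply Rmult_lt_reg_l with mu; lra).
    split; [exact Ew|]. split; [exact Hiw|]. split.
    { unfold w. rewrite Cmod_div, Hm by exact Hsm. apply Rmult_lt_reg_r with mu; [exact Hmu|].
      unfold Rdiv. rewrite Rmult_assoc, Rinv_l by lra. lra. }
    rewrite posp_eps, Rpower_0_r, Rmult_1_r by lra.
    assert (Hde : d / 2 <= de z) by (apply Hnear; unfold mu in Hzx; lra).
    assert (HdEp : 0 < dE z) by now apply dist_bands_pos.
    assert (Hre : Rabs (Re z - x) <= d).
    { assert (t := re_le_Cmod (z - RtoC x)). unfold Re in *. simpl in t.
      replace (fst z + - x) with (fst z - x) in t by ring. unfold mu in Hzx. lra. }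
    apply Rabs_le_between in Hre.
    assert (HdE : dE z <= mu * Im w).
    { eapply Rle_trans; [apply (dist_set_le z _ (RtoC (Re z)))|].
      - split; [reflexivity|]. exists j. split; [exact Hj|]. simpl. lra.
      - eapply Rle_trans; [apply Cmod_le_abs|]. rewrite <- HIw. unfold Re, Im in *. simpl.
        replace (fst z + - fst z) with 0 by ring. rewrite Rabs_R0.
        replace (snd z + - 0) with (snd z) by ring.
        rewrite <- (Rabs_pos_eq (sg * snd z)) by lra. rewrite Rabs_mult, Hsa. lra. }
    assert (Hzb : Cmod z <= Rabs x + d).
    { assert (t := Cmod_triangle_inv z (RtoC x)). rewrite Cmod_R in t. unfold mu in Hzx. lra. }
    assert (Hdu := dist_ends_upper z). assert (Hz0 := Cmod_ge_0 z).
    unfold zero_weight.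
    replace (Rpower mu (p + 1 + eps) * M2 * M3 * Rpower (Im w) (p + 1 + eps))
      with (Rpower (mu * Im w) (p + 1 + eps) * M2 * M3)
      by (rewrite <- Rpower_mult_distr by assumption; ring).
    apply Rmult_le_compat; try (left; apply Rpower_pos).
    + left. apply Rmult_lt_0_compat; apply Rpower_pos.
    + apply Rmult_le_compat; try (left; apply Rpower_pos).
      * apply Rpower_le_l; lra.
      * apply H2. unfold U. lra.
    + apply H3. unfold U. lra.
Qed.

Lemma summable_inside_band (j : nat) (x : R) : (j <= n)%nat -> alpha j < x < beta j ->
  exists r, 0 < r /\ summable_on (fun z => Cmod (z - RtoC x) < r).
Proof.
  intros Hj Hx.
  destruct (summable_half_band j x 1 Hj Hx (or_introl eq_refl)) as (r1 & Hr1 & S1).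
  destruct (summable_half_band j x (-1) Hj Hx (or_intror eq_refl)) as (r2 & Hr2 & S2).
  (* The last two radii place the nearby real points in the band, so every zero lies on one of the
     two sides. *)
  exists (Rmin (Rmin r1 r2) (Rmin (x - alpha j) (beta j - x))).
  split; [repeat apply Rmin_pos; lra|].
  apply (summable_on_cover n alpha beta p q eps _ _ _ S1 S2). intros z Hz Hzx.
  assert (h1 := Rlt_le_trans _ _ _ Hzx (Rmin_l _ _)). assert (h2 := Rlt_le_trans _ _ _ Hzx (Rmin_r _ _)).
  assert (k1 := Rlt_le_trans _ _ _ h1 (Rmin_l _ _)). assert (k2 := Rlt_le_trans _ _ _ h1 (Rmin_r _ _)).
  assert (k3 := Rlt_le_trans _ _ _ h2 (Rmin_l _ _)). assert (k4 := Rlt_le_trans _ _ _ h2 (Rmin_r _ _)).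
  destruct (Rlt_dec 0 (Im z)) as [Hp'|Hn]; [left; split; lra|].
  destruct (Rlt_dec (Im z) 0) as [Hm'|Hn']; [right; split; lra|].
  exfalso. apply Hz. split; [lra|]. exists j. split; [exact Hj|].
  assert (t := re_le_Cmod (z - RtoC x)). unfold Re in *. simpl in t.
  assert (t' : Rabs (fst z + - x) <= Rmin (x - alpha j) (beta j - x)) by lra.
  apply Rabs_le_between in t'.
  assert (g1 := Rmin_l (x - alpha j) (beta j - x)). assert (g2 := Rmin_r (x - alpha j) (beta j - x)). lra.
Qed.

Lemma sub_Re (w : C) : (w - RtoC (Re w))%C = iR (Im w).
Proof.
  destruct w as [x y]. unfold iR, Cminus, Cplus, Copp, RtoC. simpl. f_equal; ring.
Qed.

Lemma sqr_le_inv (a b : R) : 0 <= b -> a ^ 2 <= b ^ 2 -> a <= b.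
Proof. intros Hb H. apply Rnot_lt_le. intros Hlt. nra. Qed.

(** Factor into [w - sqrt u] and [w + sqrt u]: both have modulus at least [Im w], and one of them,
    according to the sign of [Re w], has modulus at least [|w|]. *)
Lemma slit_distance (w : C) (u : R) : 0 < Im w -> 0 <= u -> Im w * Cmod w <= Cmod (w * w - RtoC u).
Proof.
  intros Hw Hu. set (s := sqrt u). assert (Hs : s * s = u) by now apply sqrt_sqrt.
  replace (w * w - RtoC u)%C with ((w - RtoC s) * (w + RtoC s))%C
    by (rewrite <- Hs, RtoC_mult; ring).
  rewrite Cmod_mult.
  assert (E1 := Cmod_sqr (w - RtoC s)). assert (E2 := Cmod_sqr (w + RtoC s)).
  assert (E3 := Cmod_sqr w). destruct w as [x y]. unfold Re, Im in *. simpl fst in *. simpl snd in *.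
  set (m := Cmod (x, y)) in *. set (m1 := Cmod ((x, y) - s)) in *. set (m2 := Cmod ((x, y) + s)) in *.
  assert (P0 : 0 <= m) by apply Cmod_ge_0. assert (P1 : 0 <= m1) by apply Cmod_ge_0.
  assert (P2 : 0 <= m2) by apply Cmod_ge_0.
  assert (S1 := pow2_ge_0 (x - s)). assert (S2 := pow2_ge_0 (x + s)). assert (S3 := pow2_ge_0 s).
  assert (Q1 : y <= m1) by (apply sqr_le_inv; [exact P1|rewrite E1; lra]).
  assert (Q2 : y <= m2) by (apply sqr_le_inv; [exact P2|rewrite E2; lra]).
  assert (Q3 : m <= m1 \/ m <= m2).
  { destruct (Rle_dec 0 (x * s)); [right|left]; (apply sqr_le_inv; [assumption|]);
      [rewrite E2, E3|rewrite E1, E3]; lra. }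
  destruct Q3.
  - rewrite Rmult_comm. apply Rmult_le_compat; lra.
  - apply Rmult_le_compat; lra.
Qed.

(* [tau = 1] at a left endpoint and [tau = -1] at a right one; the chart [e0 + tau mu^2 w^2]
   opens the slit. *)
Lemma summable_at_endpoint (j : nat) (e0 tau len : R) : (j <= n)%nat ->
  tau = 1 \/ tau = -1 -> 0 < len ->
  (forall x, alpha j <= x <= beta j <-> 0 <= tau * (x - e0) <= len) ->
  ends (RtoC e0) -> (forall w, ends w -> w = RtoC e0 \/ len <= Rabs (Re w - e0) \/
     exists i, i <> j /\ (i <= n)%nat /\ alpha i <= Re w <= beta i) ->
  exists r, 0 < r /\ summable_on (fun z => Cmod (z - RtoC e0) < r).
Proof.
  intros Hj Htau Hlen Hband He0 Hends.
  assert (Ht2 : tau * tau = 1) by (destruct Htau; subst; ring).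
  assert (Hta : Rabs tau = 1) by (destruct Htau as [->| ->]; [apply Rabs_R1|rewrite Rabs_left; lra]).
  assert (He0b : alpha j <= e0 <= beta j) by (apply Hband; lra).
  destruct (bands_separated n alpha beta e0 (fun i => i <> j)) as (d1 & Hd1 & Hsep).
  { intros i Hi Hij Hxi. destruct (Nat.lt_total i j) as [h|[h|h]]; [|contradiction|].
    - assert (b := bands_ordered n alpha beta Hadm i j h Hj). lra.
    - assert (b := bands_ordered n alpha beta Hadm j i h Hi). lra. }
  set (d := Rmin d1 len). assert (Hd : 0 < d) by (apply Rmin_pos; lra).
  assert (Hdd1 : d <= d1) by apply Rmin_l. assert (Hdl : d <= len) by apply Rmin_r.
  (* For [|w| < 20] this gives [2 mu |w|^2 <= d], so points at distance at least [d] from [e0] are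
     no closer to [psi w] than [e0] is. *)
  set (mu := d / 1600). assert (Hmu : 0 < mu) by (unfold mu; lra).
  exists (mu / 64). split; [lra|].
  set (psi := fun w : C => (RtoC e0 + 0 * w + RtoC (tau * mu) * (w * w))%C).
  assert (Hm : Cmod (RtoC (tau * mu)) = mu) by (rewrite Cmod_R, Rabs_mult, Hta, Rabs_pos_eq; lra).
  assert (Hsm : RtoC (tau * mu) <> 0) by (apply Cmod_gt_0; lra).
  assert (Hpsi : forall w, Cmod (psi w - RtoC e0) = mu * Cmod w ^ 2).
  { intros w. unfold psi. replace (RtoC e0 + 0 * w + RtoC (tau * mu) * (w * w) - RtoC e0)%C
      with (RtoC (tau * mu) * (w * w))%C by ring. rewrite !Cmod_mult, Hm. ring. }
  assert (Hfar : forall w v, Cmod w < 20 -> d <= Cmod (RtoC e0 - v) -> mu * Cmod w ^ 2 <= Cmod (psi w - v)).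
  { intros w v Hw Hv. specialize (Hpsi w). assert (t := Cmod_sub_triangle e0 (psi w) v).
    rewrite (Cmod_sub_sym e0 (psi w)) in t. assert (h := Cmod_ge_0 w).
    assert (Cmod w ^ 2 <= 20 ^ 2) by (apply pow_incr; lra).
    assert (mu * Cmod w ^ 2 <= mu * 20 ^ 2) by (apply Rmult_le_compat_l; lra). unfold mu in *. lra. }
  assert (HIw : forall w, Im w <= Cmod w).
  { intros w. eapply Rle_trans; [apply Rle_abs|apply Cmod_Im]. }
  assert (HdE : forall w, 0 < Im w -> Cmod w < 20 -> mu * (Im w * Cmod w) <= dE (psi w)).
  { intros w Hw1 Hw2. apply dist_bands_ge; [exact Hadm|]. intros v Hv. assert (Hv' := Hv).
    destruct Hv as [Hv0 (i & Hi & Hvi)]. destruct (Nat.eq_dec i j) as [->|Hne].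
    - apply Hband in Hvi. set (u := tau * (Re v - e0)) in *.
      assert (Ev : v = RtoC (e0 + tau * u)).
      { rewrite (on_axis v Hv0) at 1. f_equal. unfold u. rewrite <- Rmult_assoc, Ht2. ring. }
      replace (psi w - v)%C with (RtoC (tau * mu) * (w * w - RtoC (u / mu)))%C.
      + rewrite Cmod_mult, Hm. apply Rmult_le_compat_l; [lra|]. apply slit_distance; [exact Hw1|].
        apply Rdiv_le_0_compat; lra.
      + rewrite Ev. unfold psi.
        replace (RtoC (e0 + tau * u)) with (RtoC e0 + RtoC (tau * mu) * RtoC (u / mu))%C; [ring|].
        rewrite <- RtoC_mult, <- RtoC_plus. f_equal. field. lra.
    - apply Rle_trans with (mu * Cmod w ^ 2).
      + apply Rmult_le_compat_l; [lra|]. specialize (HIw w). nra.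
      + apply Hfar; [exact Hw2|]. eapply Rle_trans; [exact Hdd1|].
        rewrite (on_axis v Hv0), <- RtoC_minus, Cmod_R. now apply (Hsep i). }
  assert (Hde : forall w, Cmod w < 20 -> de (psi w) = mu * Cmod w ^ 2).
  { intros w Hw. apply Rle_antisym.
    - rewrite <- Hpsi. now apply dist_set_le.
    - apply dist_ends_ge. intros v Hv. destruct (Hends v Hv) as [->|[Hl|(i & Hij & Hi & Hvi)]].
      + rewrite Hpsi. lra.
      + apply Hfar; [exact Hw|]. rewrite (ends_on_axis v Hv), <- RtoC_minus, Cmod_R, Rabs_minus_sym. lra.
      + apply Hfar; [exact Hw|]. eapply Rle_trans; [exact Hdd1|].
        rewrite (ends_on_axis v Hv), <- RtoC_minus, Cmod_R. now apply (Hsep i). }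
  set (U := Rabs e0 + d + 1). assert (Hxp := Rabs_pos e0).
  destruct (Rpower_bounded 1 U (b_exp p q eps)) as (M3 & HM3 & H3); [lra|].
  assert (Hmp := Rpower_pos mu p). assert (Hmq := Rpower_pos mu q).
  assert (Hmue := Rpower_pos (2 * mu) (p + 1 + eps)). assert (Hmua := Rpower_pos mu (a_exp p q eps)).
  assert (Hpow2 : forall x a, 0 < x -> Rpower (mu * x ^ 2) a = Rpower mu a * Rpower x (2 * a)).
  { intros x a Hx. rewrite <- Rpower_mult_distr by (try apply pow_lt; lra). f_equal.
    rewrite <- (Rpower_pow 2 x Hx), Rpower_mult. reflexivity. }
  assert (Hsqrt : forall om : C, Im om <> 0 \/ Re om < 0 -> exists w, psi w = (RtoC e0 + RtoC (tau * mu) * om)%C /\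
     0 < Im w /\ 2 * Im w ^ 2 = Cmod om - Re om /\ Cmod w ^ 2 = Cmod om).
  { intros om Hom. destruct (upper_sqrt om Hom) as (w & Ew & h). exists w. split; [|exact h].
    unfold psi. rewrite Ew. ring. }
  (* The exponent [p + 2 * q] collects [|w|^p] from the distance to the bands and [|w|^(2 q)] from
     the distance to the endpoints. The target [9/4] is the square of [3/2], up to the factor [i],
     which keeps its square root well above the axis. *)
  apply (summable_on_chart n alpha beta Hadm p q eps Hp Hq Heps
           (RtoC e0) 0 (RtoC (tau * mu)) (RtoC e0 + RtoC (tau * mu) * iR (9 / 4))%C p (p + 2 * q)
           (/ (Rpower mu p * Rpower mu q)) (Rpower (2 * mu) (p + 1 + eps) * Rpower mu (a_exp p q eps) * M3) (mu / 4)); try lra.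
  - apply Rinv_0_lt_compat. now apply Rmult_lt_0_compat.
  - repeat apply Rmult_lt_0_compat; assumption.
  - simpl. intros E. replace (0 + (tau * mu * (9 / 4) + 0 * 0)) with (tau * (9 / 4 * mu)) in E by ring.
    apply Rmult_integral in E. destruct E as [E|E]; [rewrite E in Ht2; lra|lra].
  - intros w Hw1 Hw2. fold (psi w). specialize (HdE w Hw1 Hw2). specialize (Hde w Hw2).
    specialize (HIw w). assert (Hcw : 0 < Cmod w) by lra.
    assert (Hprod : 0 < Im w * Cmod w) by now apply Rmult_lt_0_compat.
    split.
    + intros Hin. apply (dist_bands_mem n alpha beta) in Hin. nra.
    + assert (HB : 0 < Rpower mu p * Rpower mu q) by now apply Rmult_lt_0_compat.
      apply Rmult_le_reg_l with (Rpower mu p * Rpower mu q); [exact HB|].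
      rewrite <- (Rmult_assoc _ (/ _)), Rinv_r, Rmult_1_l by lra.
      rewrite Hde, Hpow2 by exact Hcw. rewrite (Rpower_plus p).
      replace (Rpower mu p * Rpower mu q * (Rpower (Im w) p * (Rpower (Cmod w) p * Rpower (Cmod w) (2 * q))))
        with (Rpower (mu * (Im w * Cmod w)) p * (Rpower mu q * Rpower (Cmod w) (2 * q))).
      * apply Rmult_le_compat_r; [left; apply Rmult_lt_0_compat; apply Rpower_pos|].
        apply Rpower_le_l; [exact Hp|]. split; [now apply Rmult_lt_0_compat|exact HdE].
      * rewrite <- !Rpower_mult_distr by assumption. ring.
  - intros z Hz. set (om := ((z - RtoC e0) / RtoC (tau * mu))%C).
    assert (Hom : Cmod (om - iR (9 / 4)) <= / 4).
    { replace (om - iR (9 / 4))%C with ((z - (RtoC e0 + RtoC (tau * mu) * iR (9 / 4))) / RtoC (tau * mu))%C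
        by (unfold om; field; exact Hsm).
      rewrite Cmod_div, Hm by exact Hsm. apply Rmult_le_reg_r with mu; [exact Hmu|].
      unfold Rdiv. rewrite Rmult_assoc, Rinv_l by lra. lra. }
    assert (t1 := Im_sub_iR om (9 / 4)). assert (t2 := Rle_abs (- (Im om - 9 / 4))). rewrite Rabs_Ropp in t2.
    assert (t3 := Cmod_triangle_inv om (iR (9 / 4))). assert (t4 := Cmod_triangle_inv (iR (9 / 4)) om).
    rewrite Cmod_sub_sym in t4. rewrite Cmod_iR, (Rabs_pos_eq (9 / 4)) in t3, t4 by lra.
    assert (t5 : Re om <= / 4).
    { assert (t := re_le_Cmod (om - iR (9 / 4))). assert (t' := Rle_abs (Re om)).
      replace (Re (om - iR (9 / 4))) with (Re om) in t by (unfold Re; simpl; ring). lra. }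
    destruct (Hsqrt om) as (w & Ew & h1 & h2 & h3); [left; lra|]. fold (psi w).
    exists w. split; [change (psi w = z); rewrite Ew; unfold om; field; exact Hsm|].
    assert (h4 := Cmod_ge_0 w). split; [split; nra|nra].
  - intros z Hz Hzx. set (om := ((z - RtoC e0) / RtoC (tau * mu))%C).
    assert (Ez : z = (RtoC e0 + RtoC (tau * mu) * om)%C) by (unfold om; field; exact Hsm).
    assert (Hom : Cmod om < / 64).
    { unfold om. rewrite Cmod_div, Hm by exact Hsm. apply Rmult_lt_reg_r with mu; [exact Hmu|].
      unfold Rdiv. rewrite Rmult_assoc, Rinv_l by lra. lra. }
    assert (Hreom := re_le_Cmod om). apply Rabs_le_between in Hreom.
    destruct (Hsqrt om) as (w & Ew & h1 & h2 & h3).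
    { apply NNPP. intros Hno. apply not_or_and in Hno. destruct Hno as [N1 N2].
      apply NNPP in N1. apply Rnot_lt_le in N2. apply Hz. rewrite Ez, (on_axis om N1).
      rewrite <- RtoC_mult, <- RtoC_plus. split; [reflexivity|]. exists j. split; [exact Hj|].
      change (alpha j <= e0 + tau * mu * Re om <= beta j).
      apply Hband. replace (tau * (e0 + tau * mu * Re om - e0)) with (tau * tau * (mu * Re om)) by ring.
      rewrite Ht2. unfold mu in *. nra. }
    rewrite <- Ez in Ew. fold (psi w) in *. exists w. fold (psi w).
    assert (h4 := Cmod_ge_0 w). assert (h5 := HIw w).
    assert (Hw8 : Cmod w < / 8) by nra.
    split; [exact Ew|]. split; [exact h1|]. split; [exact Hw8|].
    (* The definition of [a_exp] solved for the positive part: the two distances supply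
       [|w|^(p + 1 + eps)] and [|w|^(2 a)]. *)
    replace (posp (p + 2 * q - 1 + eps)) with (p + 1 + eps + 2 * a_exp p q eps) by (unfold a_exp; field).
    assert (Hcw : 0 < Cmod w) by lra.
    (* For [Re om >= 0] the foot of the perpendicular lies in the band, and
       [(Im om)^2 = (|om| - Re om)(|om| + Re om)] is at most [4 (Im w)^2 |w|^2]. Otherwise the
       endpoint itself is used, and [|om| <= |om| - Re om] gives [|w| <= 2 Im w]. *)
    assert (HdEu : dE z <= 2 * mu * (Im w * Cmod w)).
    { destruct (Rle_dec 0 (Re om)) as [Hr|Hr].
      - eapply Rle_trans; [apply (dist_set_le z _ (RtoC (e0 + tau * mu * Re om)))|].
        + split; [reflexivity|]. exists j. split; [exact Hj|].
          change (alpha j <= e0 + tau * mu * Re om <= beta j). apply Hband.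
          replace (tau * (e0 + tau * mu * Re om - e0)) with (tau * tau * (mu * Re om)) by ring.
          rewrite Ht2. unfold mu in *. nra.
        + replace (z - RtoC (e0 + tau * mu * Re om))%C with (RtoC (tau * mu) * iR (Im om))%C.
          2:{ rewrite Ez at 1. rewrite RtoC_plus, (RtoC_mult (tau * mu) (Re om)), <- sub_Re. ring. }
          rewrite Cmod_mult, Hm, Cmod_iR. rewrite (Rmult_comm 2), Rmult_assoc. apply Rmult_le_compat_l; [lra|].
          assert (E := Cmod_sqr om). rewrite <- (pow2_abs (Im om)) in E.
          assert (B := Rabs_pos (Im om)). assert (P : 0 <= Im w * Cmod w) by (apply Rmult_le_pos; lra).
          apply Rsqr_incr_0_var; [|lra]. unfold Rsqr.
          replace (2 * (Im w * Cmod w) * (2 * (Im w * Cmod w))) with (2 * (2 * Im w ^ 2) * Cmod w ^ 2) by ring.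
          rewrite h2, h3. nra.
      - eapply Rle_trans; [apply (dist_set_le z _ (RtoC e0))|].
        + now apply endpoint_in_band.
        + rewrite <- Ew, Hpsi. rewrite (Rmult_comm 2), Rmult_assoc. apply Rmult_le_compat_l; [lra|].
          assert (Cmod w <= 2 * Im w) by nra. nra. }
    assert (HdEp : 0 < dE z) by now apply dist_bands_pos.
    assert (Hzde : de z = mu * Cmod w ^ 2) by (rewrite <- Ew; apply Hde; lra).
    assert (Hzb : Cmod z <= Rabs e0 + d).
    { assert (t := Cmod_triangle_inv z (RtoC e0)). rewrite Cmod_R in t. unfold mu in Hzx. lra. }
    assert (Hz0 := Cmod_ge_0 z).
    unfold zero_weight. rewrite Hzde, Hpow2 by exact Hcw. rewrite (Rpower_plus _ (2 * a_exp p q eps)).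
    replace (Rpower (2 * mu) (p + 1 + eps) * Rpower mu (a_exp p q eps) * M3 *
      (Rpower (Im w) (p + 1 + eps) * (Rpower (Cmod w) (p + 1 + eps) * Rpower (Cmod w) (2 * a_exp p q eps))))
      with (Rpower (2 * mu * (Im w * Cmod w)) (p + 1 + eps) * (Rpower mu (a_exp p q eps) * Rpower (Cmod w) (2 * a_exp p q eps)) * M3).
    2:{ assert (Hwp : 0 < Im w * Cmod w) by now apply Rmult_lt_0_compat.
        assert (Hmu2 : 0 < 2 * mu) by lra.
        rewrite <- (Rpower_mult_distr (2 * mu) _ _ Hmu2 Hwp), <- (Rpower_mult_distr (Im w) _ _ h1 Hcw). ring. }
    apply Rmult_le_compat; try (left; apply Rpower_pos).
    + left. repeat apply Rmult_lt_0_compat; apply Rpower_pos.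
    + apply Rmult_le_compat_r; [left; apply Rmult_lt_0_compat; apply Rpower_pos|]. apply Rpower_le_l; lra.
    + apply H3. unfold U. lra.
Qed.

Lemma summable_near_band_end (j : nat) : (j <= n)%nat ->
  (exists r, 0 < r /\ summable_on (fun z => Cmod (z - RtoC (alpha j)) < r)) /\
  (exists r, 0 < r /\ summable_on (fun z => Cmod (z - RtoC (beta j)) < r)).
Proof.
  intros Hj. assert (Hab := alpha_lt_beta n alpha beta Hadm j Hj).
  assert (Hother : forall w i, (i <= n)%nat -> i <> j -> (w = RtoC (alpha i) \/ w = RtoC (beta i)) ->
    exists i, i <> j /\ (i <= n)%nat /\ alpha i <= Re w <= beta i).
  { intros w i Hi Hne Hw. exists i. assert (h := alpha_lt_beta n alpha beta Hadm i Hi).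
    destruct Hw as [-> | ->]; simpl; repeat split; trivial; lra. }
  split.
  - apply (summable_at_endpoint j (alpha j) 1 (beta j - alpha j)); trivial; try lra.
    + intros x. split; lra.
    + exists j. split; [exact Hj|now left].
    + intros w (i & Hi & Hw). destruct (Nat.eq_dec i j) as [->|Hne]; [|right; right; now apply (Hother w i)].
      destruct Hw as [-> | ->]; [now left|]. right. left. simpl. apply Rle_abs.
  - apply (summable_at_endpoint j (beta j) (-1) (beta j - alpha j)); trivial; try lra.
    + intros x. split; lra.
    + exists j. split; [exact Hj|now right].
    + intros w (i & Hi & Hw). destruct (Nat.eq_dec i j) as [->|Hne]; [|right; right; now apply (Hother w i)].
      destruct Hw as [-> | ->]; [|now left]. right. left. simpl. rewrite Rabs_minus_sym. apply Rle_abs.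
Qed.

Lemma summable_locally (c : C) : exists r, 0 < r /\ summable_on (fun z => Cmod (z - c) < r).
Proof.
  destruct (classic (inE c)) as [[Hc (j & Hj & Hx)]|Hc].
  2:{ now apply summable_off_bands. }
  rewrite (on_axis c Hc). destruct (summable_near_band_end j Hj) as [HA HB].
  destruct (Req_dec (Re c) (alpha j)) as [->|N1]; [exact HA|].
  destruct (Req_dec (Re c) (beta j)) as [->|N2]; [exact HB|].
  apply (summable_inside_band j); [exact Hj|lra].
Qed.

(** Bisection is applied to summability itself: it holds on small rectangles and passes from four
    quarters to the whole. *)
Lemma summable_on_square (R0 : R) : 0 <= R0 ->
  summable_on (fun z => Rabs (Re z) <= R0 /\ Rabs (Im z) <= R0).
Proof.
  intros HR0.
  assert (H : summable_on (fun z => - R0 <= Re z <= R0 /\ - R0 <= Im z <= R0)).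
  { apply (rect_bisection (fun a b c d => summable_on (fun z => a <= Re z <= b /\ c <= Im z <= d))); try lra.
    - intros a b c d Hab Hcd S1 S2 S3 S4.
      apply (summable_on_cover n alpha beta p q eps _ _ _
        (summable_on_cover n alpha beta p q eps _ _ (fun z => a <= Re z <= b /\ c <= Im z <= (c + d) / 2) S1 S2 ltac:(intros z _ [h1 h2]; destruct (Rle_dec (Re z) ((a + b) / 2)); [left|right]; lra))
        (summable_on_cover n alpha beta p q eps _ _ (fun z => a <= Re z <= b /\ (c + d) / 2 <= Im z <= d) S3 S4 ltac:(intros z _ [h1 h2]; destruct (Rle_dec (Re z) ((a + b) / 2)); [left|right]; lra))).
      intros z _ [h1 h2]. destruct (Rle_dec (Im z) ((c + d) / 2)); [left|right]; lra.
    - intros x y _ _. destruct (summable_locally (x, y)) as (r & Hr & HS).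
      exists (r / 2). split; [lra|]. intros a b c d h1 h2 h3 h4 h5 h6.
      apply (summable_on_cover n alpha beta p q eps _ _ _ HS HS). intros [u v] _ [k1 k2]. left.
      simpl in k1, k2. eapply Rle_lt_trans; [apply Cmod_coord|].
      assert (Rabs (u - x) < r / 2) by (apply Rabs_lt_between; lra).
      assert (Rabs (v - y) < r / 2) by (apply Rabs_lt_between; lra). lra. }
  apply (summable_on_cover n alpha beta p q eps _ _ _ H H). intros z _ [h1 h2]. left.
  split; now apply Rabs_le_between.
Qed.

End BandCharts.

(** * Zeros near infinity *)

Lemma Cmod_circle_reflection (w a : C) (rho : R) : a <> 0 -> Cmod w = rho ->
  Cmod (w - RtoC (rho ^ 2) / Cconj a) * Cmod a = rho * Cmod (w - a).
Proof.
  intros Ha Hw.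
  assert (Hca : Cconj a <> 0) by (apply Cmod_gt_0; rewrite Cmod_conj; now apply Cmod_gt_0).
  rewrite <- (Cmod_conj a), <- Cmod_mult.
  replace ((w - RtoC (rho ^ 2) / Cconj a) * Cconj a)%C with (w * Cconj a - RtoC (rho ^ 2))%C by (field; exact Hca).
  rewrite <- Hw, Cmod2_conj.
  replace (w * Cconj a - w * Cconj w)%C with (w * - Cconj (w - a))%C.
  - rewrite Cmod_mult, Cmod_opp, Cmod_conj. reflexivity.
  - destruct w, a. unfold Cconj, Cmult, Cminus, Cplus, Copp. simpl. f_equal; ring.
Qed.

(** Replacing each zero [a] by [rho^2 / conj a] multiplies the modulus by [rho / |a|] on the circle
    and by its square at 0, leaving a net gain of one [rho / |a|] per zero. *)
Lemma Jensen (G : C -> C) (rho B : R) (s : list (C * nat)) : 0 < rho ->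
  (forall w, Cmod w <= rho -> cdiff G w /\ Cmod (G w) <= exp B) -> Cmod (G 0) = 1 ->
  NoDup (map fst s) ->
  (forall zm, In zm s -> 0 < Cmod (fst zm) <= rho /\ divides_at G (fst zm) (snd zm)) ->
  zsum (fun a => ln (rho / Cmod a)) s <= B.
Proof.
  intros Hrho HG HG0 Hnd Hs.
  destruct (factor_zeros (fun w => Cmod w <= rho) s G) as (H & HH & EG); trivial.
  { intros z Hz. now apply HG. } { intros zm Hin. now apply Hs. }
  set (S := zsum (fun a => ln (rho / Cmod a)) s).
  set (A := fun a : C => (RtoC (rho ^ 2) / Cconj a)%C).
  set (h := fun w => (lprod A s w * H w)%C).
  assert (Hmax : Cmod (h 0) <= exp (B + S)).
  { apply (maximum_modulus ((fun w => rho - Cmod w) :: nil) h rho).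
    - intros z Hz. specialize (Hz _ (or_introl eq_refl)). simpl in Hz. lra.
    - intros phi Hin z. cbn [In] in Hin. destruct Hin as [<-|[]].
      apply rcont_minus; [apply rcont_const|apply rcont_Cmod, cdiff_ccont, cdiff_id].
    - intros z Hz. specialize (Hz _ (or_introl eq_refl)). simpl in Hz.
      apply cdiff_mult; [apply cdiff_lprod|apply HH; lra].
    - intros z _ phi Hin Hphi. cbn [In] in Hin. destruct Hin as [<-|[]].
      assert (Ez : Cmod z = rho) by lra. unfold h. rewrite Cmod_mult.
      assert (Hl : Cmod (lprod A s z) <= Cmod (lprod (fun a => a) s z) * exp S).
      { apply lprod_le. intros zm Hin. destruct (Hs zm Hin) as [[Ha Ha'] _].
        assert (Ha0 : fst zm <> 0) by now apply Cmod_gt_0.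
        rewrite exp_ln by (now apply Rdiv_lt_0_compat).
        apply Rmult_le_reg_r with (Cmod (fst zm)); [exact Ha|]. unfold A.
        rewrite (Cmod_circle_reflection z (fst zm) rho Ha0 Ez). right. field. lra. }
      apply Rle_trans with (Cmod (lprod (fun a => a) s z) * exp S * Cmod (H z)).
      + apply Rmult_le_compat_r; [apply Cmod_ge_0|exact Hl].
      + replace (Cmod (lprod (fun a => a) s z) * exp S * Cmod (H z)) with (Cmod (G z) * exp S)
          by (rewrite EG, Cmod_mult; ring).
        rewrite exp_plus. apply Rmult_le_compat_r; [left; apply exp_pos|]. apply HG. lra.
    - intros phi Hin. cbn [In] in Hin. destruct Hin as [<-|[]]. rewrite Cmod_0. lra. }
  assert (Hl : Cmod (lprod (fun a => a) s 0) <= Cmod (lprod A s 0) * exp (zsum (fun a => (-2) * ln (rho / Cmod a)) s)).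
  { apply lprod_le. intros zm Hin. destruct (Hs zm Hin) as [[Ha Ha'] _].
    assert (Ha0 : fst zm <> 0) by now apply Cmod_gt_0.
    assert (Hca : Cconj (fst zm) <> 0) by (apply Cmod_gt_0; now rewrite Cmod_conj).
    replace (-2 * ln (rho / Cmod (fst zm))) with (- (ln (rho / Cmod (fst zm)) + ln (rho / Cmod (fst zm)))) by ring.
    rewrite exp_Ropp, exp_plus, exp_ln by (now apply Rdiv_lt_0_compat).
    unfold A. replace (0 - RtoC (rho ^ 2) / Cconj (fst zm))%C with (- (RtoC (rho ^ 2) / Cconj (fst zm)))%C by ring.
    replace (0 - fst zm)%C with (- fst zm)%C by ring.
    rewrite !Cmod_opp, Cmod_div, Cmod_conj, Cmod_R, Rabs_pos_eq by (trivial; apply pow2_ge_0).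
    right. field. lra. }
  rewrite zsum_scal in Hl. fold S in Hl.
  assert (E0 : Cmod (lprod (fun a => a) s 0) * Cmod (H 0) = 1) by (rewrite <- Cmod_mult, <- EG; exact HG0).
  assert (H1 : 1 <= exp (B + S) * exp (-2 * S)).
  { rewrite <- E0. apply Rle_trans with (Cmod (lprod A s 0) * exp (-2 * S) * Cmod (H 0)).
    - apply Rmult_le_compat_r; [apply Cmod_ge_0|exact Hl].
    - replace (Cmod (lprod A s 0) * exp (-2 * S) * Cmod (H 0)) with (Cmod (h 0) * exp (-2 * S))
        by (unfold h; rewrite Cmod_mult; ring).
      apply Rmult_le_compat_r; [left; apply exp_pos|exact Hmax]. }
  rewrite <- exp_plus, <- exp_0 in H1. apply exp_monotone_inv in H1. lra.
Qed.

Lemma divides_at_infty (f : C -> C) (finf a : C) (m : nat) : a <> 0 ->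
  divides_at f a m -> divides_at (finf_ext f finf) (/ a)%C m.
Proof.
  intros Ha (g & r & Hr & Hg).
  assert (Hia : (/ a)%C <> 0).
  { apply Cmod_gt_0. rewrite Cmod_inv by exact Ha. apply Rinv_0_lt_compat. now apply Cmod_gt_0. }
  destruct (ccont_inv (/ a)%C Hia r Hr) as (d & Hd & H).
  exists (fun w => Defs.Cpow (- a / w) m * g (/ w))%C, (Rmin d (Cmod (/ a)%C)).
  split; [apply Rmin_pos; [exact Hd|now apply Cmod_gt_0]|].
  intros w Hw. assert (h1 := Rlt_le_trans _ _ _ Hw (Rmin_l _ _)).
  assert (h2 := Rlt_le_trans _ _ _ Hw (Rmin_r _ _)).
  assert (Hw0 : w <> 0).
  { intros ->. replace (0 - / a)%C with (- / a)%C in h2 by ring. rewrite Cmod_opp in h2. lra. }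
  specialize (H w h1). replace (/ / a)%C with a in H by (field; exact Ha).
  destruct (Hg (/ w)%C H) as [k1 k2]. split.
  - apply cdiff_mult.
    + apply (cdiff_pow (fun w => - a / w)%C). apply cdiff_div; [exact Hw0|apply cdiff_const|apply cdiff_id].
    + apply (cdiff_comp g Cinv); [exact k1|now apply cdiff_inv].
  - unfold finf_ext. destruct (Ceq_dec w 0) as [|_]; [contradiction|]. rewrite k2.
    replace (/ w - a)%C with ((w - / a) * (- a / w))%C by (field; now split).
    rewrite Cmult_assoc. f_equal. clear. induction m as [|m IH]; simpl; [ring|]. rewrite IH. ring.
Qed.

Lemma Rpower_Rinv (x a : R) : 0 < x -> Rpower (/ x) a = / Rpower x a.
Proof.
  intros Hx. unfold Rpower. rewrite ln_Rinv, <- exp_Ropp by exact Hx. f_equal. ring.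
Qed.

Section Infinity.

Variables (n : nat) (alpha beta : nat -> R).
Hypothesis Hadm : admissible n alpha beta.
Variables (p q eps : R).
Hypothesis Hp : 0 <= p.
Hypothesis Hq : 0 <= q.
Hypothesis Heps : 0 < eps < 1.

Local Notation inE := (frak_e n alpha beta).
Local Notation dE := (dist_bands n alpha beta).
Local Notation de := (dist_ends n alpha beta).
Local Notation wt := (zero_weight n alpha beta p q eps).
Local Notation tame := (tame n alpha beta p q).
Local Notation summable_on := (summable_on n alpha beta p q eps).

(** In the coordinate [w = 1 / z] the bound on [log |f|] is [K (2 |w|)^(p + q)], small near
    infinity. Each zero with [|w| <= rho / 2] contributes at least [ln 2] to Jensen's sum on
    [|w| <= rho]. *)
Lemma zeros_near_infty_count (R0 : R) : 0 < R0 -> (forall z, inE z -> Cmod z <= R0) ->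
  exists N, 0 < N /\ forall f finf K s rho, tame f finf K -> NoDup (map fst s) ->
    0 < rho -> rho * (2 * (R0 + 1)) <= 1 ->
    (forall zm, In zm s -> divides_at f (fst zm) (snd zm) /\ 2 <= rho * Cmod (fst zm)) ->
    zsum (fun _ => 1) s <= N * K * Rpower rho (p + q).
Proof.
  intros HR0 HR. assert (Hln2 : 0 < ln 2) by (assert (h := ln_lt_2); lra).
  exists (Rpower 2 (p + q) / ln 2). split; [apply Rdiv_lt_0_compat; [apply Rpower_pos|exact Hln2]|].
  intros f finf K s rho Ht Hnd Hrho HrhoR Hs. assert (HK : 0 < K) by apply Ht.
  set (B := K * (Rpower 2 (p + q) * Rpower rho (p + q))).
  assert (HB : 0 <= B).
  { apply Rmult_le_pos; [lra|]. left. apply Rmult_lt_0_compat; apply Rpower_pos. }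
  set (s' := map (fun zm : C * nat => (/ fst zm, snd zm)%C) s).
  assert (Hnz : forall zm, In zm s -> fst zm <> 0).
  { intros zm Hin E. destruct (Hs zm Hin) as [_ h]. rewrite E, Cmod_0 in h. lra. }
  assert (HJ : zsum (fun a => ln (rho / Cmod a)) s' <= B).
  { apply (Jensen (finf_ext f finf)); trivial.
    - intros w Hw. assert (Hw1 : Cmod w * (R0 + 1) <= 1) by nra.
      destruct (tame_at_infty n alpha beta Hadm p q Hp Hq R0 f finf K w HR Ht Hw1) as [h1 _].
      split; [exact h1|]. unfold finf_ext. destruct (Ceq_dec w 0) as [E|E].
      + destruct Ht as (_ & _ & _ & -> & _). rewrite <- exp_0. now apply exp_monotone.
      + assert (Hwp : 0 < Cmod w) by now apply Cmod_gt_0.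
        assert (Hinv : 2 * (R0 + 1) <= / Cmod w).
        { apply Rmult_le_reg_l with (Cmod w); [exact Hwp|]. rewrite Rinv_r by lra. nra. }
        assert (HdE : / Cmod w / 2 <= dE (/ w)%C).
        { apply dist_bands_ge; [exact Hadm|]. intros v Hv. assert (t := Cmod_triangle_inv (/ w) v).
          rewrite Cmod_inv in t by exact E. specialize (HR v Hv). lra. }
        assert (Hni : ~ inE (/ w)%C).
        { intros Hin. specialize (HR _ Hin). rewrite Cmod_inv in HR by exact E. lra. }
        eapply Rle_trans; [apply (tame_bound n alpha beta Hadm p q Hp Hq f finf K _ (/ Cmod w / 2) Ht Hni); [lra|exact HdE]|].
        apply exp_monotone. unfold B. rewrite Rmult_comm. apply Rmult_le_compat_l; [lra|].
        rewrite <- Rpower_plus. replace (/ Cmod w / 2) with (/ (2 * Cmod w)) by (field; lra).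
        rewrite Rpower_Rinv, Rinv_inv, Rpower_mult_distr by lra. apply Rpower_le_l; lra.
    - unfold finf_ext. destruct (Ceq_dec 0 0) as [_|N]; [|now destruct N]. apply Ht.
    - apply (NoDup_map_inv Cinv). unfold s'. rewrite !map_map.
      replace (map (fun x : C * nat => (/ fst (/ fst x, snd x))%C) s) with (map fst s); [exact Hnd|].
      apply map_ext_in. intros zm Hin. simpl. field. now apply Hnz.
    - intros zm Hin. unfold s' in Hin. apply in_map_iff in Hin. destruct Hin as (zm0 & <- & Hin).
      cbn [fst snd]. destruct (Hs zm0 Hin) as [h1 h2]. assert (h3 := Hnz zm0 Hin).
      assert (h4 : 0 < Cmod (fst zm0)) by now apply Cmod_gt_0.
      split; [|now apply divides_at_infty]. rewrite Cmod_inv by exact h3.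
      split; [now apply Rinv_0_lt_compat|]. apply Rmult_le_reg_r with (Cmod (fst zm0)); [exact h4|].
      rewrite Rinv_l by lra. lra. }
  unfold s' in HJ.
  rewrite (zsum_map (fun a => ln (rho / Cmod a)) Cinv s) in HJ.
  assert (Hle : ln 2 * zsum (fun _ => 1) s <= B).
  { rewrite <- zsum_scal. eapply Rle_trans; [|exact HJ]. apply zsum_le. intros zm Hin.
    destruct (Hs zm Hin) as [_ h]. assert (h3 := Hnz zm Hin).
    rewrite Rmult_1_r, Cmod_inv by exact h3. unfold Rdiv. rewrite Rinv_inv. apply ln_le; lra. }
  apply Rmult_le_reg_l with (ln 2); [exact Hln2|]. eapply Rle_trans; [exact Hle|].
  right. unfold B. field. lra.
Qed.

(** Both distances and [1 + |z|] are within a factor 2 of [|z|], and [b_exp] is designed so that the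
    three exponents add up to this positive part. *)
Lemma zero_weight_near_infty (R0 : R) : 0 < R0 -> (forall z, inE z -> Cmod z <= R0) ->
  exists M, 0 < M /\ forall z, 2 * (R0 + 1) <= Cmod z ->
    wt z <= M * Rpower (Cmod z) (posp (p + q - 1 + eps)).
Proof.
  intros HR0 HR.
  destruct (Rpower_bounded (/ 2) 2 (p + 1 + eps)) as (M1 & HM1 & H1); [lra|].
  destruct (Rpower_bounded (/ 2) 2 (a_exp p q eps)) as (M2 & HM2 & H2); [lra|].
  destruct (Rpower_bounded (/ 2) 2 (b_exp p q eps)) as (M3 & HM3 & H3); [lra|].
  exists (M1 * M2 * M3). split; [repeat apply Rmult_lt_0_compat; assumption|].
  intros z Hz. set (m := Cmod z) in *.
  assert (HdE : / 2 * m <= dE z).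
  { apply dist_bands_ge; [exact Hadm|]. intros v Hv. assert (t := Cmod_triangle_inv z v).
    specialize (HR v Hv). fold m in t. lra. }
  assert (Hde := dist_bands_le_dist_ends n alpha beta Hadm z).
  assert (Hup : de z <= 2 * m).
  { destruct (endpoints_nonempty n alpha beta) as [v Hv].
    eapply Rle_trans; [apply (dist_set_le z _ v Hv)|].
    assert (t := Cmod_triangle z (- v)). rewrite Cmod_opp in t.
    replace (z + - v)%C with (z - v)%C in t by ring.
    specialize (HR v (endpoint_in_band n alpha beta Hadm v Hv)). fold m in t. lra. }
  assert (Hscale : forall x e M, / 2 * m <= x <= 2 * m -> (forall y, / 2 <= y <= 2 -> Rpower y e <= M) ->
     Rpower x e <= M * Rpower m e).
  { intros x e M Hx HM. replace x with (x / m * m) by (field; lra).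
    assert (Hxm : / 2 <= x / m <= 2).
    { split; apply Rmult_le_reg_r with m; try lra; unfold Rdiv; rewrite Rmult_assoc, Rinv_l; lra. }
    rewrite <- Rpower_mult_distr by lra. apply Rmult_le_compat_r; [left; apply Rpower_pos|]. now apply HM. }
  unfold zero_weight. fold m.
  replace (posp (p + q - 1 + eps)) with ((p + 1 + eps) + a_exp p q eps + b_exp p q eps)
    by (unfold a_exp, b_exp; field).
  rewrite !Rpower_plus.
  replace (M1 * M2 * M3 * (Rpower m p * Rpower m 1 * Rpower m eps * Rpower m (a_exp p q eps) * Rpower m (b_exp p q eps)))
    with ((M1 * Rpower m (p + 1 + eps)) * (M2 * Rpower m (a_exp p q eps)) * (M3 * Rpower m (b_exp p q eps)))
    by (rewrite !Rpower_plus; ring).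
  rewrite <- !Rpower_plus.
  apply Rmult_le_compat; try (left; apply Rpower_pos).
  - left. apply Rmult_lt_0_compat; apply Rpower_pos.
  - apply Rmult_le_compat; try (left; apply Rpower_pos); apply Hscale; trivial; lra.
  - apply Hscale; trivial; lra.
Qed.

Lemma summable_near_infty : exists R1, 0 < R1 /\ summable_on (fun z => R1 <= Cmod z).
Proof.
  destruct (bands_bounded n alpha beta) as (R0 & HR0 & HR).
  destruct (zeros_near_infty_count R0 HR0 HR) as (N & HN & Hcount).
  destruct (zero_weight_near_infty R0 HR0 HR) as (M & HM & Hwt).
  set (T := 2 * (R0 + 1)) in *. assert (HT : 2 < T) by (unfold T; lra).
  exists (2 * T). split; [lra|].
  set (B := posp (p + q - 1 + eps)) in *.
  assert (HB : 0 <= B) by apply posp_nonneg.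
  (* If the positive part vanishes, the weight is bounded and one disc suffices. Otherwise [p + q]
     exceeds it by [1 - eps > 0], the ratio exponent of the dyadic series. *)
  destruct (Rle_dec (p + q - 1 + eps) 0) as [Hcase|Hcase].
  - assert (EB : B = 0) by (unfold B, posp; apply Rmax_right; exact Hcase).
    exists (M * (N * Rpower (/ T) (p + q))). split.
    { repeat apply Rmult_lt_0_compat; trivial. apply Rpower_pos. }
    intros f finf K s Ht Hnd Hs.
    apply Rle_trans with (zsum (fun z => M * (fun _ => 1) z) s).
    + apply zsum_le. intros zm Hin. destruct (Hs zm Hin) as (_ & _ & h).
      eapply Rle_trans; [apply Hwt; lra|]. rewrite EB, Rpower_0_r. lra.
    + rewrite zsum_scal, Rmult_assoc. apply Rmult_le_compat_l; [lra|].
      replace (N * Rpower (/ T) (p + q) * K) with (N * K * Rpower (/ T) (p + q)) by ring.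
      apply (Hcount f finf); trivial.
      * apply Rinv_0_lt_compat. lra.
      * rewrite Rinv_l; lra.
      * intros zm Hin. destruct (Hs zm Hin) as (_ & h1 & h2). split; [exact h1|].
        apply Rmult_le_reg_l with T; [lra|]. rewrite <- Rmult_assoc, Rinv_r; lra.
  - apply Rnot_le_lt in Hcase.
    assert (EB : p + q = B + (1 - eps)) by (unfold B, posp; rewrite Rmax_left; lra).
    set (r := Rpower (/ 2) (1 - eps)).
    assert (Hr : 0 <= r < 1).
    { split; [left; apply Rpower_pos|]. unfold r, Rpower. apply Rlt_le_trans with (exp 0); [|rewrite exp_0; lra]. apply exp_increasing.
      rewrite ln_Rinv by lra. assert (h := ln_lt_2). assert (0 < (1 - eps) * ln 2) by (apply Rmult_lt_0_compat; lra). lra. }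
    assert (P4 := Rpower_pos 4 B).
    exists (M * Rpower 4 B * N / (1 - r)). split.
    { apply Rdiv_lt_0_compat; [|lra]. repeat apply Rmult_lt_0_compat; trivial. }
    intros f finf K s Ht Hnd Hs. assert (HK : 0 < K) by apply Ht.
    replace (M * Rpower 4 B * N / (1 - r) * K) with (M * Rpower 4 B * N * K / (1 - r)) by (field; lra).
    (* In a class [2 T <= x |z| <= 4 T], so [rho = x / T] meets both conditions of the count:
       [rho |z| >= 2] and [rho T <= 1]. *)
    apply (zsum_geometric wt (fun k zm => dyadic k (2 * T / Cmod (fst zm)))); trivial.
    { repeat apply Rmult_le_pos; lra. }
    { intros zm _. apply zero_weight_nonneg. }
    { intros zm Hin. destruct (Hs zm Hin) as (_ & _ & h). apply dyadic_exists. split.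
      - apply Rdiv_lt_0_compat; lra.
      - apply Rmult_le_reg_r with (Cmod (fst zm)); [lra|]. unfold Rdiv. rewrite Rmult_assoc, Rinv_l; lra. }
    intros k. set (x := (/ 2) ^ k).
    assert (Hx : 0 < x <= 1).
    { split; [apply pow_lt; lra|]. unfold x. rewrite <- (pow1 k). apply pow_incr. lra. }
    set (s' := filter _ s).
    assert (Hcls : forall zm, In zm s' -> In zm s /\ 2 * T <= Cmod (fst zm) /\ 2 * T <= x * Cmod (fst zm) <= 4 * T).
    { intros zm Hin. unfold s' in Hin. apply filter_In in Hin. destruct Hin as [Hin Hd].
      destruct (Hs zm Hin) as (_ & _ & h). rewrite dyadic_spec in Hd. simpl in Hd. fold x in Hd.
      split; [exact Hin|]. split; [exact h|].
      assert (E : 2 * T / Cmod (fst zm) * Cmod (fst zm) = 2 * T) by (field; lra).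
      destruct Hd as [d1 d2].
      apply Rmult_le_compat_r with (r := Cmod (fst zm)) in d1; [|lra].
      apply Rmult_le_compat_r with (r := Cmod (fst zm)) in d2; [|lra].
      rewrite E in d1, d2. lra. }
    assert (Hxx : Rpower (x / T) (p + q) <= Rpower (x / T) B * r ^ k).
    { rewrite EB, Rpower_plus. apply Rmult_le_compat_l; [left; apply Rpower_pos|].
      unfold r. rewrite <- Rpower_pow_l by lra. fold x. apply Rpower_le_l; [lra|].
      split; [apply Rdiv_lt_0_compat; lra|]. apply Rmult_le_reg_r with T; [lra|].
      unfold Rdiv. rewrite Rmult_assoc, Rinv_l by lra. nra. }
    assert (PxT : 0 < Rpower (x / T) B) by apply Rpower_pos.
    apply Rle_trans with (zsum (fun z => M * Rpower 4 B / Rpower (x / T) B * (fun _ => 1) z) s').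
    + apply zsum_le. intros zm Hin. destruct (Hcls zm Hin) as (_ & h1 & h2).
      eapply Rle_trans; [apply Hwt; lra|]. rewrite Rmult_1_r. unfold Rdiv. rewrite Rmult_assoc.
      apply Rmult_le_compat_l; [lra|].
      apply Rle_trans with (Rpower (4 * (T / x)) B).
      * apply Rpower_le_l; [exact HB|]. split; [lra|].
        apply Rmult_le_reg_r with x; [lra|]. replace (4 * (T / x) * x) with (4 * T) by (field; lra). lra.
      * assert (HTx : 0 < T / x) by (apply Rdiv_lt_0_compat; lra).
        rewrite <- Rpower_mult_distr by lra. right. f_equal.
        replace (T / x) with (/ (x / T)) by (field; lra).
        apply Rpower_Rinv. apply Rdiv_lt_0_compat; lra.
    + rewrite zsum_scal.
      assert (Hn1 : zsum (fun _ => 1) s' <= N * K * Rpower (x / T) (p + q)).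
      { apply (Hcount f finf); trivial.
        - now apply NoDup_map_filter.
        - apply Rdiv_lt_0_compat; lra.
        - unfold Rdiv. rewrite Rmult_assoc, Rinv_l; lra.
        - intros zm Hin. destruct (Hcls zm Hin) as (h0 & h1 & h2). split; [now apply Hs|].
          apply Rmult_le_reg_r with T; [lra|].
          replace (x / T * Cmod (fst zm) * T) with (x * Cmod (fst zm)) by (field; lra). lra. }
      assert (HMP : 0 < M * Rpower 4 B / Rpower (x / T) B).
      { apply Rdiv_lt_0_compat; trivial. now apply Rmult_lt_0_compat. }
      apply Rle_trans with (M * Rpower 4 B / Rpower (x / T) B * (N * K * (Rpower (x / T) B * r ^ k))).
      * apply Rmult_le_compat_l; [lra|]. eapply Rle_trans; [exact Hn1|].
        apply Rmult_le_compat_l; [|exact Hxx]. apply Rmult_le_pos; lra.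
      * right. field. lra.
Qed.

End Infinity.

(** * The global estimate *)

Lemma divides_at_of_zero_mult (f : C -> C) (z : C) (m : nat) : zero_mult f z m -> divides_at f z m.
Proof.
  intros (g & r & Hr & _ & Hg & Hf). exists g, r. split; [exact Hr|]. intros w Hw.
  split; [now apply cdiff_of_ex_derive, Hg|now apply Hf].
Qed.

Theorem theorem0p1 :
  forall (n : nat) (alpha beta : nat -> R),
  admissible n alpha beta ->
  forall p q eps : R, 0 <= p -> 0 <= q -> 0 < eps < 1 ->
  exists Cst : R, 0 < Cst /\
  forall (f : C -> C) (finf : C) (K1 : R),
    0 < K1 ->
    (forall z, ~ frak_e n alpha beta z -> ex_derive f z) ->
    analytic_at_infty f finf ->
    Cmod finf = 1 ->
    (forall lam, ~ frak_e n alpha beta lam ->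
       ln (Cmod (f lam)) <=
       K1 / (Rpower (dist_set lam (frak_e n alpha beta)) p *
             Rpower (dist_set lam (endpoints n alpha beta)) q)) ->
    forall s : list (C * nat),
      NoDup (map fst s) ->
      (forall zm, In zm s ->
         ~ frak_e n alpha beta (fst zm) /\ f (fst zm) = RtoC 0 /\
         zero_mult f (fst zm) (snd zm)) ->
      zsum (fun lam =>
              Rpower (dist_set lam (frak_e n alpha beta)) (p + 1 + eps) *
              Rpower (dist_set lam (endpoints n alpha beta)) (a_exp p q eps) *
              Rpower (1 + Cmod lam) (b_exp p q eps)) s
      <= Cst * K1.
Proof.
  intros n alpha beta Hadm p q eps Hp Hq Heps.
  destruct (summable_near_infty n alpha beta Hadm p q eps Hp Hq Heps) as (R1 & HR1 & S1).
  assert (S2 := summable_on_square n alpha beta Hadm p q eps Hp Hq Heps R1 ltac:(lra)).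
  destruct (summable_on_cover n alpha beta p q eps _ _ (fun _ => True) S1 S2) as (A & HA & H).
  { intros z _ _. destruct (Rle_dec R1 (Cmod z)) as [h|h]; [now left|right].
    assert (h1 := re_le_Cmod z). assert (h2 := Cmod_Im z). lra. }
  exists A. split; [exact HA|].
  intros f finf K1 HK Hf Hinf Hfi Hln s Hnd Hs.
  apply (H f finf K1 s); trivial.
  - now apply (tame_intro n alpha beta p q).
  - intros zm Hin. destruct (Hs zm Hin) as (h1 & _ & h2). split; [exact h1|]. split; [|exact I].
    now apply divides_at_of_zero_mult.
Qed.
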